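(* Let $1/2<\alpha<2$, $d\in\mathbb{N}$, let $\boldsymbol{\gamma}=(\gamma_1,\ldots,\gamma_d)$ be a collection of positive weights, and let $M\ge1$. Let $\mathcal{A}_d^{\mathrm{sym}}=\{\boldsymbol{k}\in\mathbb{Z}^d\mid r_{\alpha,\boldsymbol{\Gamma}_\alpha}(|\boldsymbol{k}|)\le M\}$ be the weighted hyperbolic cross with rescaled weights $\boldsymbol{\Gamma}_\alpha=\underline{\kappa}_\alpha^{-1/2}\boldsymbol{\gamma}$, and assume $|\mathcal{A}_d^{\mathrm{sym}}|\ge2$. Consider the multiple tent-transformed lattice algorithm $A^{\mathrm{mult}}$ (defined in the context), where the number of lattices $L$, the common prime $n=n_1=\cdots=n_L$ and the generating vectors $\boldsymbol{z}_1,\ldots,\boldsymbol{z}_L$ are chosen by the multiple-lattice construction described in the context with inputs $0<\delta<1$ and $c>1$, so that the covering condition $\bigcup_{t=1}^L\mathcal{A}_{d,t}^{\mathrm{sym}}=\mathcal{A}_d^{\mathrm{sym}}$ is met. Then $$e_\infty^{\mathrm{wor}}(H_{\alpha,\boldsymbol{\gamma},d}^{\mathrm{sob}};A^{\mathrm{mult}})\le C_{c,\delta,\beta,\lambda}\frac{\left(V_d(\alpha,\lambda,\boldsymbol{\gamma})\right)^{\lambda}}{n_{\mathrm{tot}}^{\lambda/(1+\beta)-1/2}},$$ for any $1/2<\lambda<\alpha$ and $0<\beta<\min(1,2\lambda-1)$. Here $n_{\mathrm{tot}}=n_1+\cdots+n_L=nL$ is the total number of function evaluations, $C_{c,\delta,\beta,\lambda}>0$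 is a constant depending only on $c,\delta,\beta,\lambda$, and $V_d(\alpha,\lambda,\boldsymbol{\gamma})=\prod_{j=1}^d\left(1+2\Gamma_{j,\alpha}^{1/\lambda}\zeta(\alpha/\lambda)\right)$ with $\Gamma_{j,\alpha}=\underline{\kappa}_\alpha^{-1/2}\gamma_j$ and $\zeta$ the Riemann zeta function.
   Context: **Spaces.** Functions are real-valued. Let $\phi_0(x)=1$, $\phi_k(x)=\sqrt2\cos(k\pi x)$ for $k\in\mathbb{N}$, and $\phi_{\boldsymbol{k}}(\boldsymbol{x})=\prod_{j=1}^d\phi_{k_j}(x_j)$ for $\boldsymbol{k}\in\mathbb{N}_0^d$; put $\widetilde f(\boldsymbol{k})=\int_{[0,1]^d}f\phi_{\boldsymbol{k}}$. For $\alpha>1/2$ and weights $\gamma_j>0$ let $r_{\alpha,\gamma}(0)=1$, $r_{\alpha,\gamma}(k)=\gamma^{-1}k^\alpha$ for $k\in\mathbb{N}$, $r_{\alpha,\boldsymbol{\gamma}}(\boldsymbol{k})=\prod_{j=1}^d r_{\alpha,\gamma_j}(k_j)$. The half-period cosine space $H_{\alpha,\boldsymbol{\gamma},d}^{\cos}$ consists of $f\in L_2([0,1]^d)$ with $(\|f\|_{\alpha,\boldsymbol{\gamma},d}^{\cos})^2=\sum_{\boldsymbol{k}\in\mathbb{N}_0^d}|\widetilde f(\boldsymbol{k})|^2r_{\alpha,\boldsymbol{\gamma}}^2(\boldsymbol{k})<\infty$. Let $\mathcal{P}^{\cos}=\operatorname{span}\{\phi_k\mid k\in\mathbb{N}_0\}$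 on $[0,1]$. On $\mathcal{P}^{\cos}$ define, for $1/2<\alpha<1$, $$\langle f,g\rangle_{\alpha,\gamma,1}^{\mathrm{sob}}=\int_0^1 f\int_0^1 g+\frac{1}{\gamma^2}\cdot\frac{(1-\alpha)\pi^3}{8}\int_0^1\!\int_0^1(f(x)-f(y))(g(x)-g(y))\left(\frac{1}{|\sin\frac{\pi(x-y)}{2}|^{2\alpha+1}}+\frac{1}{|\sin\frac{\pi(x+y)}{2}|^{2\alpha+1}}\right)dx\,dy,$$ and, for $1<\alpha<2$, $$\langle f,g\rangle_{\alpha,\gamma,1}^{\mathrm{sob}}=\int_0^1 f\int_0^1 g+\frac{1}{\gamma^2}\left(\int_0^1 f'g'+\mathcal{B}_\alpha(f',g')\right),$$ $$\mathcal{B}_\alpha(f',g')=\frac{(\alpha-1)(2-\alpha)\pi^3}{8}\int_0^1\!\int_0^1\left(\frac{(f'(x)-f'(y))(g'(x)-g'(y))}{|\sin\frac{\pi(x-y)}{2}|^{2\alpha-1}}+\frac{(f'(x)+f'(y))(g'(x)+g'(y))}{|\sin\frac{\pi(x+y)}{2}|^{2\alpha-1}}\right)dx\,dy.$$ For these $\alpha$, $H_{\alpha,\gamma,1}^{\mathrm{sob}}$ is the completion of $\mathcal{P}^{\cos}$ in the induced norm. For $\alpha=1$, $H_{1,\gamma,1}^{\mathrm{sob}}$ is the space of $f$ with weak derivative $f'\in L_2([0,1])$ and inner product $\int_0^1 f\int_0^1 g+\gamma^{-2}\int_0^1 f'g'$. For $d\ge1$, $H_{\alpha,\boldsymbol{\gamma},d}^{\mathrm{sob}}=\bigotimes_{j=1}^dH_{\alpha,\gamma_j,1}^{\mathrm{sob}}$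 (Hilbert tensor product), with norm $\|\cdot\|_{\alpha,\boldsymbol{\gamma},d}^{\mathrm{sob}}$. The identity on finite cosine expansions extends to an isomorphism of $H_{\alpha,\boldsymbol{\gamma},d}^{\cos}$ onto $H_{\alpha,\boldsymbol{\gamma},d}^{\mathrm{sob}}$, through which the two spaces are identified; their elements are continuous functions on $[0,1]^d$ (given by absolutely and uniformly convergent cosine series). **Constants.** $\underline{\kappa}_\alpha=c_\alpha$ if $1/2<\alpha<1$, $\underline{\kappa}_1=\pi^2$, $\underline{\kappa}_\alpha=c'_\alpha$ if $1<\alpha<2$, where $$c_\alpha=2(1-\alpha)\pi^{2-2\alpha}\int_0^{1/2}\frac{\sin^2(\pi t)}{t^{2\alpha+1}}dt,\qquad c'_\alpha=2(\alpha-1)(2-\alpha)\pi^{6-2\alpha}\int_0^{1/2}\frac{\sin^2(\pi t)}{t^{2\alpha-1}}dt.$$ **Notation.** For $\boldsymbol{k}\in\mathbb{Z}^d$: $|\boldsymbol{k}|=(|k_1|,\ldots,|k_d|)$, and $|\boldsymbol{k}|_0$ is the number of non-zero components. The tent transformation is $\varphi(x)=1-|2x-1|$, applied componentwise. For $\boldsymbol{z}\in\{0,\ldots,n-1\}^d$, $\boldsymbol{y}_i=(\{iz_1/n\},\ldots,\{iz_d/n\})$, $0\le i<n$ ($\{\cdot\}$ = fractional part), and $$\widehat{(f\circ\varphi)}_{n,\boldsymbol{z}}(\boldsymbol{k})=\frac1n\sum_{i=0}^{n-1}f(\varphi(\boldsymbol{y}_i))e^{-2\pi\mathrm{i}\boldsymbol{k}\cdot\boldsymbol{y}_i}.$$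 **Multiple-lattice construction.** Let $N=\max_{j}\left(\max_{\boldsymbol{k}\in\mathcal{A}_d^{\mathrm{sym}}}k_j-\min_{\boldsymbol{h}\in\mathcal{A}_d^{\mathrm{sym}}}h_j\right)$, $c'=\max\{c,N/(|\mathcal{A}_d^{\mathrm{sym}}|-1)\}$, $\tau=c'(|\mathcal{A}_d^{\mathrm{sym}}|-1)$, $$L=\left\lceil\left(\frac{c'}{c'-1}\right)^2\frac{\log|\mathcal{A}_d^{\mathrm{sym}}|-\log\delta}{2}\right\rceil,$$ and let $n$ be the smallest prime $>\tau$. Choose $\boldsymbol{z}_1,\ldots,\boldsymbol{z}_L\in\{0,\ldots,n-1\}^d$ (drawn at random, repeatedly if necessary, until the covering condition below holds; then fixed). Put $$\mathcal{A}_{d,t}^{\mathrm{sym}}=\{\boldsymbol{k}\in\mathcal{A}_d^{\mathrm{sym}}\mid\boldsymbol{k}\cdot\boldsymbol{z}_t\not\equiv\boldsymbol{\ell}\cdot\boldsymbol{z}_t\ (\mathrm{mod}\ n)\text{ for all }\boldsymbol{\ell}\in\mathcal{A}_d^{\mathrm{sym}}\setminus\{\boldsymbol{k}\}\}.$$ Covering condition: $\bigcup_{t=1}^L\mathcal{A}_{d,t}^{\mathrm{sym}}=\mathcal{A}_d^{\mathrm{sym}}$. The theorem concerns any fixed choice of $\boldsymbol{z}_1,\ldots,\boldsymbol{z}_L$ satisfying it. **Approximation algorithm and error.** With $U(\boldsymbol{k})=|\{t\in\{1,\ldots,L\}\mid\boldsymbol{k}\in\mathcal{A}_{d,t}^{\mathrm{sym}}\}|$,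 $$A^{\mathrm{mult}}(f)(\boldsymbol{x})=\sum_{t=1}^L\sum_{\boldsymbol{k}\in\mathcal{A}_{d,t}^{\mathrm{sym}}}\frac{\widehat{(f\circ\varphi)}_{n,\boldsymbol{z}_t}(\boldsymbol{k})}{U(\boldsymbol{k})\,2^{|\boldsymbol{k}|_0/2}}\phi_{|\boldsymbol{k}|}(\boldsymbol{x}),$$ and $$e_\infty^{\mathrm{wor}}(H_{\alpha,\boldsymbol{\gamma},d}^{\mathrm{sob}};A^{\mathrm{mult}})=\sup_{\|f\|_{\alpha,\boldsymbol{\gamma},d}^{\mathrm{sob}}\le1}\ \sup_{\boldsymbol{x}\in[0,1]^d}|f(\boldsymbol{x})-A^{\mathrm{mult}}(f)(\boldsymbol{x})|.$$ *)

(* Defs.v *)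
From HB Require Import structures.
From mathcomp Require Import all_boot all_order all_algebra finmap.
From mathcomp Require Import all_classical all_reals all_analysis.
From mathcomp Require Import complex.

Set Implicit Arguments.
Unset Strict Implicit.
Unset Printing Implicit Defensive.

Import Order.TTheory GRing.Theory Num.Theory.
Import numFieldNormedType.Exports.

Local Open Scope classical_set_scope.
Local Open Scope ring_scope.

(* Functions on [0,1] are represented by functions on the whole real line of
   which only the restriction to [0,1] matters; likewise for functions on
   [0,1]^d, which are represented by functions on 'rV[R]_d. *)

Definition unit_itv (R : realType) : set R := `[0, 1].

Definition unit_cube (R : realType) (d : nat) : set 'rV[R]_d :=
  [set x | forall j, 0 <= x ord0 j <= 1].
Arguments unit_itv : clear implicits.
Arguments unit_cube : clear implicits.

Section CosineBasis.
Context {R : realType}.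

Definition phi (k : nat) (x : R) : R :=
  if k == 0%N then 1 else Num.sqrt 2 * cos (k%:R * pi * x).

Definition phi_vec (d : nat) (k : 'rV[nat]_d) (x : 'rV[R]_d) : R :=
  \prod_(j < d) phi (k ord0 j) (x ord0 j).

Definition r_wt (alpha gamma : R) (k : nat) : R :=
  if k == 0%N then 1 else gamma^-1 * k%:R `^ alpha.

Definition r_wt_vec (d : nat) (alpha : R) (gamma : 'I_d -> R)
    (k : 'rV[nat]_d) : R :=
  \prod_(j < d) r_wt alpha (gamma j) (k ord0 j).

(* The elements are trigonometric polynomials on the whole line, so that the
   derivative used in [sob_form] below is the usual one, also at 0 and 1. *)
Definition pcos : set (R -> R) :=
  [set f | exists (n : nat) (a : nat -> R),
     f = fun x => \sum_(k < n) a k * phi k x].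

End CosineBasis.

(* Completion, realized as a space of functions, of a (semi-)inner product
   space: [V] is the underlying set, [ip] the inner product and [ev v] the
   function on [D] represented by [v]. Under the hypothesis that the norm
   dominates the sup norm on [D], every Cauchy sequence of [V] converges
   uniformly on [D], and it is identified with its limit. *)
Section FunctionCompletion.
Context {R : realType} {E : choiceType} {T : choiceType}.
Variables (V : set E) (ip : E -> E -> R) (D : set T) (ev : E -> T -> R).

(* the square of the norm of u - v, expanded *)
Definition sq_dist (u v : E) : R := ip u u - ip u v - ip v u + ip v v.

Definition ip_cauchy (u : nat -> E) : Prop :=
  forall e : R, 0 < e -> exists m0 : nat, forall m p : nat,
    (m0 <= m)%N -> (m0 <= p)%N -> sq_dist (u m) (u p) < e.

Definition represents (u : nat -> E) (f : T -> R) : Prop :=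
  [/\ forall m, V (u m), ip_cauchy u &
      {uniform D, (fun m => ev (u m)) @ \oo --> f}].

Definition completion : set (T -> R) := [set f | exists u, represents u f].

Variable e0 : E.

Definition repr_seq (f : T -> R) : nat -> E :=
  xget (fun=> e0) [set u | represents u f].

Definition completion_ip (f g : T -> R) : R :=
  limn (fun m => ip (repr_seq f m) (repr_seq g m)).

End FunctionCompletion.

Section Sobolev1.
Context {R : realType}.
Local Notation mu := (@lebesgue_measure R).
Local Notation I01 := (unit_itv R).

(* On the null sets where a denominator vanishes the kernels take the
   value given by 0^-1 = 0. *)
Definition frac_kernel_low (alpha : R) (f g : R -> R) (x y : R) : R :=
  (f x - f y) * (g x - g y) *
  ((`|sin (pi * (x - y) / 2)| `^ (2 * alpha + 1))^-1 +
   (`|sin (pi * (x + y) / 2)| `^ (2 * alpha + 1))^-1).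

Definition frac_kernel_high (alpha : R) (f g : R -> R) (x y : R) : R :=
  (f x - f y) * (g x - g y) /
    `|sin (pi * (x - y) / 2)| `^ (2 * alpha - 1) +
  (f x + f y) * (g x + g y) /
    `|sin (pi * (x + y) / 2)| `^ (2 * alpha - 1).

Definition frac_form_high (alpha : R) (f g : R -> R) : R :=
  (alpha - 1) * (2 - alpha) * pi ^+ 3 / 8 *
  \int[mu]_(y in I01) \int[mu]_(x in I01) frac_kernel_high alpha f g x y.

(* the inner product on [pcos], for 1/2 < alpha < 1 and for 1 < alpha < 2 *)
Definition sob_form (alpha gamma : R) (f g : R -> R) : R :=
  (\int[mu]_(x in I01) f x) * (\int[mu]_(x in I01) g x) +
  if alpha < 1 then
    (gamma ^+ 2)^-1 * ((1 - alpha) * pi ^+ 3 / 8) *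
    \int[mu]_(y in I01) \int[mu]_(x in I01) frac_kernel_low alpha f g x y
  else
    (gamma ^+ 2)^-1 *
    (\int[mu]_(x in I01) (derive1 f x * derive1 g x) +
     frac_form_high alpha (derive1 f) (derive1 g)).

(* Testing weak derivatives against C^1 functions with compact support in
   ]0, 1[ gives the same notion as testing against smooth ones. *)
Definition test_function (h : R -> R) : Prop :=
  [/\ forall x, derivable h x 1, continuous (derive1 h) &
      exists a b : R, [/\ 0 < a, b < 1 & forall x, x \notin `[a, b] -> h x = 0]].

Definition L2_weak_derivative (f g : R -> R) : Prop :=
  [/\ measurable_fun I01 g,
      mu.-integrable I01 (fun x => (g x ^+ 2)%:E) &
      forall h, test_function h ->
        \int[mu]_(x in I01) (f x * derive1 h x) = - \int[mu]_(x in I01) (g x * h x)].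

(* unique up to a null set when it exists *)
Definition weak_derivative (f : R -> R) : R -> R :=
  xget (fun=> 0) [set g | L2_weak_derivative f g].

Definition sob_space1 (alpha gamma : R) : set (R -> R) :=
  if alpha == 1 then
    [set f | {within I01, continuous f} /\ exists g, L2_weak_derivative f g]
  else completion pcos (sob_form alpha gamma) I01 id.

Definition sob_ip1 (alpha gamma : R) (f g : R -> R) : R :=
  if alpha == 1 then
    (\int[mu]_(x in I01) f x) * (\int[mu]_(x in I01) g x) +
    (gamma ^+ 2)^-1 *
      \int[mu]_(x in I01) (weak_derivative f x * weak_derivative g x)
  else completion_ip pcos (sob_form alpha gamma) I01 id (fun=> 0) f g.

End Sobolev1.

(* The Hilbert tensor product is the completion of the algebraic one, whose
   elements are given by formal linear combinations of simple tensors, the pair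
   (a, u) standing for a times the tensor product of the u j. *)
Section SobolevTensor.
Context {R : realType} {d : nat}.
Variables (alpha : R) (gamma : 'I_d -> R).

Local Notation tensor := (seq (R * ('I_d -> R -> R))).

Definition tensor_space : set tensor :=
  [set S : tensor | forall p, p \in S -> forall j, sob_space1 alpha (gamma j) (p.2 j)].

Definition tensor_ip (S S' : tensor) : R :=
  \sum_(p <- S) \sum_(q <- S')
    p.1 * q.1 * \prod_(j < d) sob_ip1 alpha (gamma j) (p.2 j) (q.2 j).

Definition tensor_fun (S : tensor) (x : 'rV[R]_d) : R :=
  \sum_(p <- S) p.1 * \prod_(j < d) p.2 j (x ord0 j).

Definition sob_space : set ('rV[R]_d -> R) :=
  completion tensor_space tensor_ip (unit_cube R d) tensor_fun.

Definition sob_norm (f : 'rV[R]_d -> R) : R :=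
  Num.sqrt (completion_ip tensor_space tensor_ip (unit_cube R d) tensor_fun
              [::] f f).

End SobolevTensor.

Section Constants.
Context {R : realType}.
Local Notation mu := (@lebesgue_measure R).

Definition c_low (alpha : R) : R :=
  2 * (1 - alpha) * pi `^ (2 - 2 * alpha) *
  \int[mu]_(t in `[0%R, 2^-1%R]) (sin (pi * t) ^+ 2 / t `^ (2 * alpha + 1)).

Definition c_high (alpha : R) : R :=
  2 * (alpha - 1) * (2 - alpha) * pi `^ (6 - 2 * alpha) *
  \int[mu]_(t in `[0%R, 2^-1%R]) (sin (pi * t) ^+ 2 / t `^ (2 * alpha - 1)).

Definition kappa (alpha : R) : R :=
  if alpha < 1 then c_low alpha
  else if alpha == 1 then pi ^+ 2 else c_high alpha.

Definition Gamma_wt (d : nat) (alpha : R) (gamma : 'I_d -> R) (j : 'I_d) : R :=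
  kappa alpha `^ (- 2^-1) * gamma j.

Definition zeta (s : R) : R := limn (series (fun k : nat => k.+1%:R `^ (- s))).

Definition V_const (d : nat) (alpha lambda : R) (gamma : 'I_d -> R) : R :=
  \prod_(j < d)
    (1 + 2 * Gamma_wt alpha gamma j `^ lambda^-1 * zeta (alpha / lambda)).

End Constants.

Section IndexSets.
Context {d : nat}.
Implicit Types (A : set 'rV[int]_d) (k : 'rV[int]_d).

Definition abs_vec k : 'rV[nat]_d := map_mx absz k.

Definition nnz k : nat := #|[pred j | k ord0 j != 0]|.

Definition dotz (n : nat) k (z : 'rV['I_n]_d) : int :=
  \sum_(j < d) k ord0 j * (nat_of_ord (z ord0 j))%:Z.

Definition Asym {R : realType} (alpha : R) (gamma : 'I_d -> R) (M : R) :
    set 'rV[int]_d :=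
  [set k | r_wt_vec alpha gamma (abs_vec k) <= M].

Definition cardA A : nat := #|` fset_set A|.

(* Meant for a finite set containing the zero vector (such as [Asym] when
   1 <= M), so that the initial value 0 of the inner maximum and minimum is
   attained. *)
Definition spread A : int :=
  \big[Num.max/0]_(j < d)
    (\big[Num.max/0]_(k <- fset_set A) k ord0 j -
     \big[Num.min/0]_(h <- fset_set A) h ord0 j).

Definition alias_free A (n : nat) (z : 'rV['I_n]_d) : set 'rV[int]_d :=
  [set k | A k /\
     forall l, A l -> l <> k -> (dotz k z != dotz l z %[mod n%:Z])%Z].

Definition multiplicity A (n L : nat) (z : 'I_L -> 'rV['I_n]_d) k : nat :=
  #|[pred t : 'I_L | k \in alias_free A (z t)]|.

Definition covers A (n L : nat) (z : 'I_L -> 'rV['I_n]_d) : Prop :=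
  \bigcup_(t in [set: 'I_L]) alias_free A (z t) = A.

End IndexSets.

Section Construction.
Context {R : realType} {d : nat}.
Variables (A : set 'rV[int]_d) (c delta : R).

Definition c_adj : R := Num.max c ((spread A)%:~R / ((cardA A)%:R - 1)).

Definition tau : R := c_adj * ((cardA A)%:R - 1).

Definition num_lattices : int :=
  Num.ceil ((c_adj / (c_adj - 1)) ^+ 2 * ((ln (cardA A)%:R - ln delta) / 2)).

Definition smallest_prime_above (x : R) (n : nat) : Prop :=
  [/\ prime n, x < n%:R &
      forall p : nat, prime p -> x < p%:R -> (n <= p)%N].

End Construction.

Section Algorithm.
Context {R : realType} {d : nat}.
Local Open Scope complex_scope.

Definition tent (x : R) : R := 1 - `|2 * x - 1|.

Definition frac_part (x : R) : R := x - (Num.floor x)%:~R.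

Definition lattice_point (n : nat) (z : 'rV['I_n]_d) (i : nat) : 'rV[R]_d :=
  \row_(j < d) frac_part (i%:R * (nat_of_ord (z ord0 j))%:R / n%:R).

Definition cexpi (theta : R) : R[i] := cos theta +i* sin theta.

Definition lattice_coeff (n : nat) (z : 'rV['I_n]_d) (f : 'rV[R]_d -> R)
    (k : 'rV[int]_d) : R[i] :=
  (n%:R)^-1 * \sum_(i < n)
    (f (map_mx tent (lattice_point z i)))%:C *
    cexpi (- (2 * pi *
      \sum_(j < d) (k ord0 j)%:~R * lattice_point z i ord0 j)).

Definition A_mult (A : set 'rV[int]_d) (n L : nat) (z : 'I_L -> 'rV['I_n]_d)
    (f : 'rV[R]_d -> R) (x : 'rV[R]_d) : R[i] :=
  \sum_(t < L) \sum_(k \in alias_free A (z t))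
    lattice_coeff (z t) f k /
      ((multiplicity A z k)%:R * 2 `^ ((nnz k)%:R / 2))%:C *
    (phi_vec (abs_vec k) x)%:C.

Definition wor_error (alpha : R) (gamma : 'I_d -> R)
    (Alg : ('rV[R]_d -> R) -> 'rV[R]_d -> R[i]) : \bar R :=
  ereal_sup
    [set ereal_sup
       [set (ComplexField.Normc.normc ((f x)%:C - Alg f x))%:E
          | x in unit_cube R d]
       | f in [set f | sob_space alpha gamma f /\ sob_norm alpha gamma f <= 1]].

End Algorithm.

(* Main.v *)
(** In dimension one the fractional Sobolev form is diagonal in the cosine basis:
   shifting the inner integral and folding it over one period leaves integrals
   of products of cosines. Since [|sin x| <= x], the eigenvalue of [phi k] is at
   least [r k ^+ 2] for the rescaled weight, so the Sobolev norm dominates the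
   cosine norm. The defect is a kernel whose entrywise product with every
   positive semidefinite kernel is positive semidefinite; this property survives
   products over the coordinates, limits and completions, so the domination
   passes to the tensor product.

   Every element of the space is thus a pointwise limit of cosine polynomials
   [f = \sum_h c_h \prod_j cos (h_j pi x_j)] over symmetric boxes. After the tent
   transformation the lattice sums become character sums: the frequencies in [A]
   are reproduced exactly, and each of the others contributes at most
   [(1 + L) |c_h|]. By the Cauchy-Schwarz inequality the error is at most
   [(1 + L) (\sum_(h notin A) r h ^- 2) ^ (1/2)] times the norm. As [A] collects
   the smallest weights and [\sum_h r h ^ (- 1 / lambda) <= V], the sum over the
   complement is at most [V ^ (2 lambda) |A| ^ (1 - 2 lambda) / (2 lambda - 1)].

   Finally [L = O(log |A|)], and [n = O(|A| log |A|)] since the spread of [A] is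
   at most [2 |A|] and there is a prime between [m] and [O(m log m)] (from the
   central binomial coefficient); the margin in [beta] absorbs the logarithms. *)
Require Import Defs.
From HB Require Import structures.
From mathcomp Require Import all_boot all_order all_algebra finmap.
From mathcomp Require Import all_classical all_reals all_analysis.
From mathcomp Require Import measurable_realfun complex.
From mathcomp Require Import zify ring lra.

Import Order.TTheory GRing.Theory Num.Theory.
Import numFieldNormedType.Exports.

Set Implicit Arguments.
Unset Strict Implicit.
Unset Printing Implicit Defensive.

Local Open Scope classical_set_scope.
Local Open Scope ring_scope.

(** The Sobolev norm is accessible only through limits of inner products along representing
    sequences, and away from order 1 these limits are nested: the factors of a simple tensor are
    limits themselves. Finite Gram matrices survive such limits, so norms are compared on Gram
    matrices. An inequality between Gram matrices passes to entrywise products by Schur's product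
    theorem; taking its conclusion as the definition [schur] reduces that theorem to composition,
    and each defect that occurs is visibly of this kind, being a nonnegative sum or integral of
    rank-one kernels. For order 1 the space is not given as a completion, so approximating cosine
    polynomials are constructed. Integration by parts turns the energy into sine coefficients of the
    weak derivative, and a summability kernel with multipliers in [-1, 1] gives pointwise
    convergence without raising the energy. The constant [kappa] records what remains of an
    eigenvalue when only [[0, 1/k]] is kept in its integral; rescaling that interval to [[0, 1/2]]
    explains the upper limit 1/2. *)

(** * Primes between [m] and a multiple of [m log m] *)

Section PrimeGap.
Local Open Scope nat_scope.

(** The recurrence [(M + 1) C(2M + 2, M + 1) = 2 (2M + 1) C(2M, M)] multiplies the right-hand side
    by [4 + 2 / M] at each step. *)
Lemma central_bin_ge M : 0 < M -> 4 ^ M <= M.*2 * 'C(M.*2, M).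
Proof.
elim: M => // -[_ _ //|M IH _].
have {}IH := IH isT.
have e1 := bin_fact (leq_addr M.+1 M.+1); have e2 := bin_fact (leq_addr M.+2 M.+2).
rewrite !addnK !addnn in e1 e2.
have e3 : (M.+2.*2)`! = M.+2.*2 * (M.+1.*2).+1 * (M.+1.*2)`!.
  by rewrite !doubleS !factS; lia.
have f0 := fact_gt0 M.+1.
have h : M.+2 * 'C(M.+2.*2, M.+2) = 2 * (M.+1.*2).+1 * 'C(M.+1.*2, M.+1).
  have f1 : 0 < M.+2 * (M.+1)`! * (M.+1)`! by rewrite !muln_gt0 !fact_gt0.
  apply/eqP; rewrite -(eqn_pmul2r f1).
  apply/eqP; move: e2; rewrite e3 -e1 [in (M.+2)`!]factS.
  set c := 'C(_, _); set c' := 'C(_, _); set u := (M.+1)`!.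
  by rewrite -!mul2n; nia.
have -> : M.+2.*2 * 'C(M.+2.*2, M.+2) = 2 * (M.+2 * 'C(M.+2.*2, M.+2)) by rewrite mulnA mul2n.
rewrite expnS h; apply: leq_trans (leq_mul (leqnn 4) IH) _.
by set c := 'C(_, _); rewrite -mul2n; nia.
Qed.

(** By Legendre's formula the exponent of [p] is the sum of [floor (2M / p^k) - 2 floor (M / p^k)].
    Each term is 0 or 1, and it is 0 once [p^k > 2M]. *)
Lemma pfactor_central_bin p M : prime p -> 0 < M ->
  p ^ logn p 'C(M.*2, M) <= M.*2.
Proof.
move=> pp M0; have p1 := prime_gt1 pp.
have M2 : 0 < M.*2 by rewrite double_gt0.
have /andP[tl tu] := trunc_log_bounds p1 M2.
apply: leq_trans tl; rewrite leq_exp2l //.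
have C0 : 0 < 'C(M.*2, M) by rewrite bin_gt0 -addnn leq_addr.
have f0 := fact_gt0 M.
have := congr1 (logn p) (bin_fact (leq_addr M M)); rewrite addnK addnn.
rewrite !lognM ?muln_gt0 ?f0 // !logn_fact // => e.
have sh : \sum_(1 <= k < M.+1) M %/ p ^ k = \sum_(1 <= k < (M.*2).+1) M %/ p ^ k.
  rewrite (big_cat_nat (n := M.+1) (p := (M.*2).+1)) //=; last by rewrite ltnS -addnn leq_addr.
  rewrite [X in _ + X]big_nat_cond [X in _ + X]big1 ?addn0 // => i /andP[/andP[Mi _] _].
  by rewrite divn_small //; apply: leq_trans Mi (ltnW (ltn_expl _ p1)).
have : logn p 'C(M.*2, M) <= \sum_(1 <= k < (M.*2).+1) (k <= trunc_log p M.*2).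
  rewrite -(leq_add2r (\sum_(1 <= k < (M.*2).+1) (M %/ p ^ k) + \sum_(1 <= k < (M.*2).+1) (M %/ p ^ k))).
  rewrite -{1 2}sh e -!big_split /=; apply: leq_sum => k _.
  have pk : 0 < p ^ k by rewrite expn_gt0 prime_gt0.
  case: (leqP k (trunc_log p M.*2)) => [_|kt].
    rewrite -addnn; have := divn_eq M (p ^ k); have := ltn_pmod M pk.
    have := leq_divM (M + M) (p ^ k).
    by set q := M %/ _; set s := _ %/ _; set r := M %% _; nia.
  rewrite divn_small // (leq_trans tu) // leq_exp2l //.
move=> /leq_trans; apply.
rewrite -big_mkcond /= sum1_count -size_filter.
rewrite -[X in _ <= X](size_iota 1); apply: uniq_leq_size.
  by rewrite filter_uniq // iota_uniq.
by move=> k; rewrite mem_filter mem_index_iota mem_iota => /andP[kt /andP[k1 _]]; rewrite k1 /=; lia.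
Qed.

(** Every prime divisor is at most [2M], hence at most [m]; so there are at most [m] of them, and
    each contributes a power not exceeding [2M]. *)
Lemma central_bin_le m M : 0 < M ->
  (forall p, prime p -> p <= M.*2 -> p <= m) -> 'C(M.*2, M) <= M.*2 ^ m.
Proof.
move=> M0 H.
have C0 : 0 < 'C(M.*2, M) by rewrite bin_gt0 -addnn leq_addr.
rewrite [X in X <= _](prod_prime_decomp C0) prime_decompE big_map /=.
apply: (@leq_trans (\prod_(p <- primes 'C(M.*2, M)) M.*2)).
  rewrite big_seq [X in _ <= X]big_seq; elim/big_ind2: _ => // [*|p]; first exact: leq_mul.
  by rewrite mem_primes => /and3P[pp _ _]; apply: pfactor_central_bin.
rewrite big_const_seq count_predT iter_muln_1 leq_pexp2l ?double_gt0 //.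
rewrite -[X in _ <= X](size_iota 1); apply: uniq_leq_size; first exact: primes_uniq.
move=> p pC; have := pC; rewrite mem_primes mem_iota => /and3P[pp _ _].
rewrite prime_gt0 //= add1n ltnS; apply: H => //.
apply: leq_trans (pfactor_central_bin pp M0); rewrite -[X in X <= _]expn1.
by rewrite leq_exp2l ?prime_gt1 // logn_gt0.
Qed.

Lemma prime_gap m l : 0 < m -> m < 2 ^ l ->
  exists p, [/\ prime p, m < p & p <= 16 * m * l].
Proof.
move=> m0 ml.
have l0 : 0 < l by case: l ml => //; rewrite expn0; lia.
(* Without a prime in []m, 2M]] one would have [4 ^ M <= (2M) ^ (m + 1)]. But [2M < 2 ^ (2l + 3)]
   and [(2l + 3)(m + 1) <= 10 m l], while [4 ^ M = 2 ^ (16 m l)]. *)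
set M := 8 * m * l; have M2 : M.*2 = 16 * m * l by rewrite /M -mul2n; lia.
have M0 : 0 < M by rewrite /M !muln_gt0 m0.
apply/not_existsP => H.
have /(central_bin_le M0) C : forall p, prime p -> p <= M.*2 -> p <= m.
  move=> p pp; rewrite M2 => pM; rewrite leqNgt; apply/negP => mp.
  by apply: (H p).
have := leq_trans (central_bin_ge M0) (leq_mul (leqnn _) C); rewrite -expnS.
apply/negP; rewrite -ltnNge.
have l2 : l <= 2 ^ l.-1 by case: l l0 {ml M M2 M0 H C} => // l _; exact: ltn_expl.
have : M.*2 < 2 ^ (4 + l + l.-1).
  rewrite M2 !expnD; apply: (@leq_trans (16 * (2 ^ l * l))); last by rewrite -mulnA leq_mul2l leq_mul2l l2 !orbT.
  by rewrite -mulnA ltn_pmul2l // ltn_pmul2r.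
move=> h; apply: (@leq_trans ((2 ^ (4 + l + l.-1)) ^ m.+1)).
  by rewrite ltn_exp2r.
have -> : 4 ^ M = 2 ^ (2 * M) by rewrite expnM.
rewrite -expnM leq_exp2l // /M; nia.
Qed.

End PrimeGap.

(** * Translation, reflection and scaling in Lebesgue integrals *)

Section AffineChange.
Context {R : realType}.
Local Notation mu := (@lebesgue_measure R).

(** Both sides are differences of the integrals of the positive and the negative part, so the
    nonnegative case suffices and integrability is not an issue. *)
Lemma integral_pushforward_measurable d1 d2 (X : measurableType d1)
    (Y : measurableType d2) (m : {measure set X -> \bar R}) (h : X -> Y)
    (D : set Y) (f : Y -> \bar R) :
  measurable_fun setT h -> measurable D -> measurable_fun setT f ->
  (\int[pushforward m h]_(y in D) f y = \int[m]_(x in h @^-1` D) f (h x))%E.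
Proof.
move=> mh mD mf; rewrite [LHS]integralE [RHS]integralE.
rewrite ge0_integral_pushforward //; last exact/measurable_funepos/measurable_funTS.
rewrite [X in (_ - X)%E = _]ge0_integral_pushforward //; last exact/measurable_funeneg/measurable_funTS.
by congr (_ - _)%E; apply: eq_integral => x _; rewrite ?(funepos_comp f h) ?(funeneg_comp f h).
Qed.

Let shift (c : R) : measurableTypeR R -> measurableTypeR R := fun x : R => x + c.
Let scale (c : R) : measurableTypeR R -> measurableTypeR R := fun x : R => c * x.

Let opp : measurableTypeR R -> measurableTypeR R := fun x : R => - x.

Let mshift c : measurable_fun setT (shift c).
Proof. by apply: measurable_funD => //; exact: measurable_cst. Qed.

Let mscl c : measurable_fun setT (scale c).
Proof. by apply: measurable_funM => //; exact: measurable_cst. Qed.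

(** Lebesgue measure is determined by its values on half-open intervals; the same argument serves
    for scaling. *)
Lemma lebesgue_measure_shift (c : R) (A : set R) : measurable A ->
  pushforward mu (shift c) A = mu A.
Proof.
move=> mA; apply/esym.
pose s := isMeasurableFun.Build _ _ _ _ _ (mshift c).
pose sp : {mfun _ >-> _} := HB.pack (shift c) s.
apply: (lebesgue_measure_unique (mu := pushforward mu sp)) => //= _ [[a b]] _ <-.
rewrite /pushforward (_ : _ @^-1` _ = `]a - c, b - c]%classic); last first.
  by apply/seteqP; split => x; rewrite /= !in_itv /= /shift ltrBlDr lerBrDr.
by rewrite !lebesgue_measure_itv /= !lte_fin ltrD2r -!EFinD (_ : b - c - (a - c) = b - a)//; ring.
Qed.

Lemma lebesgue_measure_scale (c : {posnum R}) (A : set R) : measurable A ->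
  (c%:num%:E * pushforward mu (scale c%:num) A = mu A)%E.
Proof.
move=> mA; apply/esym.
pose s := isMeasurableFun.Build _ _ _ _ _ (mscl c%:num).
pose sp : {mfun _ >-> _} := HB.pack (scale c%:num) s.
apply: (lebesgue_measure_unique (mu := mscale c%:num%:nng (pushforward mu sp))) => //= _ [[a b]] _ <-.
have pE : scale c%:num @^-1` `]a, b]%classic = `]a / c%:num, b / c%:num]%classic.
  by apply/seteqP; split => x; rewrite /= !in_itv /= /scale ltr_pdivrMr // ler_pdivlMr // ![x * _]mulrC.
change (mu `]a, b]%classic = c%:num%:E * mu (scale c%:num @^-1` `]a, b]%classic))%E.
rewrite pE.
rewrite !lebesgue_measure_itv /= !lte_fin ltr_pM2r ?invr_gt0 //; case: ifP => _; last by rewrite mule0.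
by rewrite -!EFinD -EFinM; congr (_%:E); field.
Qed.

Lemma integral_shift (c : R) (D : set R) (f : R -> \bar R) :
  measurable D -> measurable_fun setT f ->
  (\int[mu]_(x in D) f x = \int[mu]_(x in [set x | D (x + c)%R]) f (x + c)%R)%E.
Proof.
move=> mD mf.
have <- := @integral_pushforward_measurable _ _ _ _ mu (shift c) D f (mshift c) mD mf.
by apply: eq_measure_integral => A mA _; exact/esym/lebesgue_measure_shift.
Qed.

Lemma integral_opp (D : set R) (f : R -> \bar R) :
  measurable D -> measurable_fun setT f ->
  (\int[mu]_(x in D) f x = \int[mu]_(x in [set x | D (- x)%R]) f (- x)%R)%E.
Proof.
move=> mD mf.
have mo : measurable_fun setT opp by exact: oppr_measurable.
have <- := @integral_pushforward_measurable _ _ _ _ mu opp D f mo mD mf.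
by apply: eq_measure_integral => A mA _; exact/esym/lebesgue_measureN.
Qed.

Lemma ge0_integral_scale (c : R) (D : set R) (f : R -> \bar R) : 0 < c ->
  measurable D -> measurable_fun setT f -> (forall x, 0 <= f x)%E ->
  (\int[mu]_(x in D) f x =
    c%:E * \int[mu]_(x in [set x | D (c * x)%R]) f (c * x)%R)%E.
Proof.
move=> c0 mD mf f0; pose cp := PosNum c0.
have <- := @integral_pushforward_measurable _ _ _ _ mu (scale c) D f (mscl c) mD mf.
pose s := isMeasurableFun.Build _ _ _ _ _ (mscl c).
pose sp : {mfun _ >-> _} := HB.pack (scale c) s.
have <- := @ge0_integral_mscale _ _ _ (pushforward mu sp) D mD cp%:num%:nng f (measurable_funTS mf) (fun x _ => f0 x).
by apply: eq_measure_integral => A mA _; exact/esym/(lebesgue_measure_scale cp).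
Qed.

End AffineChange.

(** * Interval integrals and folding over one period *)

Section IntervalIntegrals.
Context {R : realType}.
Local Notation mu := (@lebesgue_measure R).
Implicit Types (f G : R -> R) (a b c : R).

Lemma Rintegral_shift f a b c : measurable_fun setT f ->
  \int[mu]_(x in `[a, b]) f (x + c) = \int[mu]_(x in `[a + c, b + c]) f x.
Proof.
move=> mf; rewrite /Rintegral.
have -> := @integral_shift R c `[a + c, b + c]%classic (EFin \o f) _ _ => //; last exact/measurable_EFinP.
by congr (fine (integral _ _ _)); apply/seteqP; split => x /=; rewrite !in_itv /= !lerD2r.
Qed.

Lemma Rintegral_opp f a b : measurable_fun setT f ->
  \int[mu]_(x in `[a, b]) f (- x) = \int[mu]_(x in `[- b, - a]) f x.
Proof.
move=> mf; rewrite /Rintegral.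
have -> := @integral_opp R `[- b, - a]%classic (EFin \o f) _ _ => //; last exact/measurable_EFinP.
by congr (fine (integral _ _ _)); apply/seteqP; split => x /=; rewrite !in_itv /= !lerN2 andbC.
Qed.

Lemma integrable_shift f a b c : measurable_fun setT f ->
  mu.-integrable `[a + c, b + c] (EFin \o f) ->
  mu.-integrable `[a, b] (EFin \o (fun x => f (x + c))).
Proof.
move=> mf /integrableP[_ fi]; apply/integrableP; split.
  apply/measurable_EFinP; apply: measurable_funTS; apply: (measurableT_comp mf).
  by apply: measurable_funD => //; exact: measurable_cst.
apply: le_lt_trans fi.
have -> := @integral_shift R c `[a + c, b + c]%classic (fun x => `|(EFin \o f) x|%E) _ _ => //.
  rewrite le_eqVlt; apply/orP; left; apply/eqP.
  by congr (integral _ _ _); apply/seteqP; split => x /=; rewrite !in_itv /= !lerD2r.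
by apply: measurableT_comp => //; exact/measurable_EFinP.
Qed.

Lemma integrable_opp f a b : measurable_fun setT f ->
  mu.-integrable `[- b, - a] (EFin \o f) ->
  mu.-integrable `[a, b] (EFin \o (fun x => f (- x))).
Proof.
move=> mf /integrableP[_ fi]; apply/integrableP; split.
  apply/measurable_EFinP; apply: measurable_funTS; apply: (measurableT_comp mf).
  exact: oppr_measurable.
apply: le_lt_trans fi.
have -> := @integral_opp R `[- b, - a]%classic (fun x => `|(EFin \o f) x|%E) _ _ => //.
  rewrite le_eqVlt; apply/orP; left; apply/eqP.
  by congr (integral _ _ _); apply/seteqP; split => x /=; rewrite !in_itv /= !lerN2 andbC.
by apply: measurableT_comp => //; exact/measurable_EFinP.
Qed.

Lemma integrable_itv_cat f a b c : a <= b -> b <= c ->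
  mu.-integrable `[a, b] (EFin \o f) -> mu.-integrable `[b, c] (EFin \o f) ->
  mu.-integrable `[a, c] (EFin \o f).
Proof.
move=> ab bc i1 i2.
have E : `[a, c]%classic = (`[a, b] `|` `]b, c])%classic :> set R.
  by rewrite -itv_bndbnd_setU //= ?bnd_simp.
have {}i2 : mu.-integrable `]b, c] (EFin \o f).
  by apply: integrableS i2 => // x /=; rewrite !in_itv /= => /andP[/ltW-> ->].
have [/integrableP[m1 l1] /integrableP[m2 l2]] := (i1, i2).
have mf : measurable_fun (`[a, b] `|` `]b, c])%classic (EFin \o f) by apply/measurable_funU.
apply/integrableP; rewrite E; split => //.
rewrite ge0_integral_setU //; first exact: lte_add_pinfty.
- exact: measurableT_comp.
- apply/disj_setPS => x [] /=; rewrite !in_itv /= => /andP[_ h] /andP[+ _].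
  by rewrite ltNge h.
Qed.

Lemma Rintegral_itv_cat f a b c : a <= b -> b <= c ->
  mu.-integrable `[a, c] (EFin \o f) ->
  \int[mu]_(x in `[a, c]) f x = \int[mu]_(x in `[a, b]) f x + \int[mu]_(x in `[b, c]) f x.
Proof.
move=> ab bc fi.
have := Rintegral_itvB (a := BLeft a) (b := BRight c) (x := b) fi.
rewrite !bnd_simp => /(_ ab bc) h.
rewrite -(@Rintegral_itv_obnd_cbnd _ b (BRight c) f) -?h ?subrKC //.
by apply: integrableS fi => // x /=; rewrite !in_itv /= => /andP[h1 ->]; rewrite (le_trans ab (ltW h1)).
Qed.

(* [G (x - y)] and [G (- x - y)] for x in [0, 1] together cover one period. *)
Lemma Rintegral_fold_period G y : 0 <= y <= 1 -> measurable_fun setT G ->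
  (forall x, G (x + 2) = G x) ->
  mu.-integrable `[0, 1] (EFin \o G) ->
  mu.-integrable `[0, 1] (EFin \o (fun x => G (- x))) ->
  \int[mu]_(x in `[0, 1]) (G (x - y) + G (- x - y)) =
  \int[mu]_(u in `[0, 1]) (G u + G (- u)).
Proof.
move=> /andP[y0 y1] mG per iG iGo.
have mGo : measurable_fun setT (fun x : R => G (- x)).
  by apply: (measurableT_comp mG); exact: oppr_measurable.
have i10 : mu.-integrable `[-1, 0] (EFin \o G).
  rewrite (_ : G = fun x => (fun z => G (- z)) (- x)); last by apply/funext => x /=; rewrite opprK.
  by apply: (@integrable_opp (fun z => G (- z)) (-1) 0) => //; rewrite opprK oppr0.
have i21 : mu.-integrable `[-2, -1] (EFin \o G).
  rewrite (_ : G = fun x => G (x + 2)); last by apply/funext => x; rewrite per.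
  apply: (@integrable_shift G (-2) (-1) 2 mG).
  have e2 : -2 + 2 = 0 :> R by ring.
  have e1 : -1 + 2 = 1 :> R by ring.
  by rewrite e1 e2.
have i11 : mu.-integrable `[-1, 1] (EFin \o G) by apply: integrable_itv_cat iG => //; lra.
have iT : mu.-integrable `[-2, 1] (EFin \o G) by apply: integrable_itv_cat i11 => //; lra.
have iS a b : -2 <= a -> b <= 1 -> mu.-integrable `[a, b] (EFin \o G).
  move=> a2 b1; apply: integrableS iT => // x /=; rewrite !in_itv /= => /andP[ax xb].
  by rewrite (le_trans a2 ax) (le_trans xb b1).
have mGy : measurable_fun setT (fun x : R => G (x - y)).
  by apply: (measurableT_comp mG); apply: measurable_funD => //; exact: measurable_cst.
rewrite RintegralD //; last 2 first.
- by apply: (@integrable_shift G 0 1 (- y)) => //; apply: iS; lra.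
- apply: (@integrable_opp (fun x => G (x - y)) 0 1) => //.
  by apply: (@integrable_shift G _ _ (- y)) => //; apply: iS; lra.
rewrite (@Rintegral_opp (fun x => G (x - y)) 0 1) // !Rintegral_shift // RintegralD // Rintegral_opp //.
rewrite oppr0.
have l1 : -1 - y <= 0 - y by lra.
have l2 : 0 - y <= 1 - y by lra.
have l3 : -1 - y <= -1 by lra.
have l4 : -1 <= 1 - y by lra.
have l5 : 1 - y <= 1 by lra.
have l6 : -1 <= 0 :> R by lra.
have i3 : mu.-integrable `[-1 - y, 1 - y] (EFin \o G) by apply: iS; lra.
have h1 := Rintegral_itv_cat l1 l2 i3.
have h2 := Rintegral_itv_cat l3 l4 i3.
have h3 := Rintegral_itv_cat l4 l5 i11.
have h4 := Rintegral_itv_cat l6 ler01 i11.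
(* Periodicity moves the piece [[-1 - y, -1]] to [[1 - y, 1]], which turns [[-1 - y, 1 - y]] into
   [[-1, 1]]. *)
have := @Rintegral_shift G (-1 - y) (-1) 2 mG.
have -> : -1 - y + 2 = 1 - y by ring.
have -> : -1 + 2 = 1 :> R by ring.
under eq_Rintegral do rewrite per.
move: h1 h2 h3 h4.
set A1 := Rintegral _ _ _; set A2 := Rintegral _ _ _; set A3 := Rintegral _ _ _; set A4 := Rintegral _ _ _.
set A5 := Rintegral _ _ _; set A6 := Rintegral _ _ _; set A7 := Rintegral _ _ _.
lra.
Qed.

End IntervalIntegrals.

(** * Integrability of negative powers; elementary bounds for the sine *)

Section PowerIntegrability.
Context {R : realType}.
Local Notation mu := (@lebesgue_measure R).

Lemma Rintegral_derive (f F : R -> R) (a b : R) : a <= b ->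
  (forall x, a <= x <= b -> is_derive x 1 F (f x)) ->
  {within `[a, b], continuous f} ->
  (\int[mu]_(x in `[a, b]) (f x)%:E = (F b - F a)%:E)%E.
Proof.
rewrite le_eqVlt => /predU1P[<- _ _|ab dF cf].
  by rewrite set_itv1 integral_set1 subrr.
have dx x : x \in `]a, b[ -> is_derive x 1 F (f x).
  by rewrite in_itv /= => /andP[/ltW ax /ltW xb]; apply: dF; rewrite ax.
rewrite (continuous_FTC2 ab cf (F := F)) //.
- have cF x : a <= x <= b -> {for x, continuous F}.
    by move=> /dF [d _]; apply: differentiable_continuous; exact/derivable1_diffP.
  split.
  + by move=> x /dx[].
  + by apply: cvg_at_right_filter; apply: cF; rewrite lexx ltW.
  + by apply: cvg_at_left_filter; apply: cF; rewrite lexx ltW.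
- by move=> x /dx[_ <-]; rewrite derive1E.
Qed.

(** Monotone convergence along [[1 / (n + 1), 1]], where the antiderivative [u ^ (1 - p) / (1 - p)]
    bounds all integrals by [1 / (1 - p)]. *)
Lemma integrable_powRN (p : R) : p < 1 ->
  mu.-integrable `[0, 1] (EFin \o (fun u => u `^ (- p))).
Proof.
move=> p1; have q0 : 0 < 1 - p by lra.
apply/integrableP; split.
  by apply/measurable_EFinP/measurable_funTS; exact: measurable_powR.
under eq_integral do rewrite /= ger0_norm ?powR_ge0 //.
rewrite -integral_itv_obnd_cbnd; last first.
  by apply/measurable_EFinP/measurable_funTS; exact: measurable_powR.
pose F (n : nat) : set R := `[n.+1%:R^-1, 1]%classic.
have -> : `]0%R, 1%R]%classic = \bigcup_n F n.
  apply/seteqP; split => x /=.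
    rewrite in_itv /= => /andP[x0 x1].
    exists (Num.bound x^-1) => //; rewrite /F /= in_itv /= x1 andbT.
    rewrite -[leRHS]invrK lef_pV2 ?posrE ?invr_gt0 ?ltr0n //.
    apply/ltW/(lt_le_trans (archi_boundP _)); first by rewrite invr_ge0 ltW.
    by rewrite ler_nat.
  by case=> n _; rewrite /F /= !in_itv /= => /andP[h ->]; rewrite (lt_le_trans _ h) ?invr_gt0 ?ltr0n.
have cv : (\int[mu]_(x in F n) (x `^ (- p))%:E)%E @[n --> \oo] -->
    (\int[mu]_(x in \bigcup_n F n) (x `^ (- p))%:E)%E.
  apply: ge0_nondecreasing_set_cvg_integral.
  - move=> m n mn; apply/subsetPset => x; rewrite /F /= !in_itv /= => /andP[h ->].
    by rewrite andbT (le_trans _ h) // lef_pV2 ?posrE ?ltr0n // ler_nat.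
  - by move=> n; exact: measurable_itv.
  - by move=> n; apply/measurable_EFinP/measurable_funTS; exact: measurable_powR.
  - by move=> n x _; rewrite lee_fin powR_ge0.
rewrite -(cvg_lim _ cv) //.
apply: (@le_lt_trans _ _ ((1 - p)^-1)%:E); last exact: ltey.
apply: lime_le; first by apply/cvg_ex; eexists; exact: cv.
near=> n.
pose G (u : R) := u `^ (1 - p) / (1 - p).
have n0 : 0 < n.+1%:R^-1 :> R by rewrite invr_gt0 ltr0n.
have dG (x : R) : n.+1%:R^-1 <= x <= 1 -> is_derive x 1 G (x `^ (- p)).
  move=> /andP[/(lt_le_trans n0) x0 _].
  have d := is_derive1_powR (1 - p) x0.
  have -> : G = (1 - p)^-1 *: ((fun u : R => u `^ (1 - p)) : R -> R).
    by apply/funext => u; rewrite /G /GRing.scale /= mulrC.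
  apply: is_derive_eq; rewrite /GRing.scale /= (_ : 1 - p - 1 = - p); last by ring.
  by field; rewrite gt_eqF.
rewrite /F (Rintegral_derive (F := G)) //.
- rewrite lee_fin /G powR1 -mulrBl ler_pdivrMr // mulVf ?gt_eqF // gerBl powR_ge0 //.
- by rewrite invf_le1 ?ltr0n // ler1n.
- apply: derivable_within_continuous => x; rewrite in_itv /= => /andP[/(lt_le_trans n0) x0 _].
  by have [] := is_derive1_powR (- p) x0.
Unshelve. all: by end_near. Qed.

Lemma sin_le_id (x : R) : 0 <= x -> sin x <= x.
Proof.
rewrite le_eqVlt => /predU1P[<-|x0]; first by rewrite sin0.
have [c _] := MVT x0 (fun y _ => is_derive_sin y) (continuous_subspaceT (@continuous_sin R)).
rewrite sin0 !subr0 => ->.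
by rewrite ler_piMl ?cos_le1 // ltW.
Qed.

(** A weak Jordan inequality: [sin x = 2 sin (x/2) cos (x/2) >= x cos (x/2) ^ 2 = x (1 + cos x) /
    2], the middle step by the mean value theorem. *)
Lemma sin_ge_half (x : R) : 0 <= x <= pi / 2 -> x / 2 <= sin x.
Proof.
move=> /andP[+ xp]; rewrite le_eqVlt => /predU1P[<-|x0].
  by rewrite mul0r sin0.
have h0 : 0 < x / 2 by rewrite divr_gt0.
have pi0 := pi_gt0 R.
have [c] := MVT h0 (fun y _ => is_derive_sin y) (continuous_subspaceT (@continuous_sin R)).
rewrite in_itv /= sin0 !subr0 => /andP[c0 cx] e.
have cc : cos (x / 2) <= cos c.
  by apply: ltW; rewrite ltr_cos // in_itv /=; apply/andP; split; lra.
have c2 : 0 <= cos (x / 2) by apply: cos_ge0_pihalf; lra.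
have xx : x = x / 2 + x / 2 by lra.
have sx : sin x = 2 * (sin (x / 2) * cos (x / 2)) by rewrite {1}xx sinD; ring.
have c3 : 0 <= cos x by apply: cos_ge0_pihalf; apply/andP; split; lra.
have c4 : cos x = 2 * cos (x / 2) ^+ 2 - 1.
  by rewrite {1}xx cosD; have := cos2Dsin2 (x / 2); rewrite !expr2; lra.
have c5 : cos (x / 2) * cos (x / 2) <= cos c * cos (x / 2) by rewrite ler_wpM2r.
have : x / 2 <= x * (cos c * cos (x / 2)).
  by apply: ler_wpM2l; [exact: ltW|rewrite expr2 in c4; lra].
by rewrite sx e; lra.
Qed.

Lemma ler_norm_sinM (k : nat) (x : R) : `|sin (k%:R * x)| <= k%:R * `|sin x|.
Proof.
elim: k => [|k IH]; first by rewrite !mul0r sin0 normr0.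
rewrite -natr1 !mulrDl !mul1r sinD (le_trans (ler_normD _ _)) // lerD //.
  by rewrite normrM (le_trans _ IH) // ler_piMr // cos_max.
by rewrite normrM ler_piMl // cos_max.
Qed.

End PowerIntegrability.

(** * The singular kernel and the folding of the double integral *)

Section SingularKernel.
Context {R : realType}.
Local Notation mu := (@lebesgue_measure R).

Definition sin_kernel (s u : R) : R := (`|sin (pi * u / 2)| `^ s)^-1.

Lemma sin_kernelN s u : sin_kernel s (- u) = sin_kernel s u.
Proof. by rewrite /sin_kernel mulrN mulNr sinN normrN. Qed.

Lemma sin_kernel_ge0 s u : 0 <= sin_kernel s u.
Proof. by rewrite invr_ge0 powR_ge0. Qed.

Lemma measurable_fun_half_sin : measurable_fun setT (fun u : R => sin (pi * u / 2)).
Proof.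
apply: continuous_measurable_fun => x; apply: continuous_comp; last exact: continuous_sin.
by apply: cvgMl; apply: cvgMr; exact: cvg_id.
Qed.

Lemma measurable_sin_kernel s : measurable_fun setT (sin_kernel s).
Proof.
rewrite (_ : sin_kernel s = (fun x : R => x `^ (- s)) \o (fun u : R => `|sin (pi * u / 2)|)).
  apply: (measurableT_comp (measurable_powR _)).
  by apply: measurableT_comp => //; exact: measurable_fun_half_sin.
by apply/funext => u; rewrite /= powRN.
Qed.

(** A zero of second order lowers the singularity from [u ^ (- s)] to [u ^ (2 - s)]. The condition
    [s < 3] covers [2 alpha + 1] for [alpha < 1] and [2 alpha - 1] for [alpha < 2]. *)
Lemma integrable_sin_kernel (s C : R) (h : R -> R) : s < 3 -> 0 <= C ->
  measurable_fun setT h ->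
  (forall u, `|h u| <= C * sin (pi * u / 2) ^+ 2) ->
  mu.-integrable `[0, 1] (EFin \o (fun u => h u * sin_kernel s u)).
Proof.
move=> s3 C0 mh hb.
(* The maximum with 0 keeps [u ^ (- p)] a nonpositive power, so that [u / 2 <= sin (pi u / 2)] can
   be inserted also when [s < 2]. *)
pose p := Num.max (s - 2) 0.
have p0 : 0 <= p by rewrite le_max lexx orbT.
have p1 : p < 1 by rewrite gt_max ltr01 andbT; lra.
have ps : s - 2 <= p by rewrite le_max lexx.
have hi := integrable_powRN p1.
apply: (@le_integrable _ _ _ mu _ _ _ (EFin \o (fun u : R => C * 2 `^ p * u `^ (- p)))) => //.
- apply/measurable_EFinP/measurable_funTS; apply: measurable_funM => //.
  exact: measurable_sin_kernel.
- move=> u; rewrite /= in_itv /= => /andP[u0 u1].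
  rewrite lee_fin normrM [X in _ * X]ger0_norm ?sin_kernel_ge0 //.
  rewrite [X in _ <= X]ger0_norm; last by rewrite !mulr_ge0 ?powR_ge0.
  have P := pi_gt0 R.
  have hw : u / 2 <= sin (pi * u / 2).
    apply: (@le_trans _ _ ((pi * u / 2) / 2)); last first.
      apply: sin_ge_half; apply/andP; split; first by rewrite divr_ge0 // mulr_ge0 // ltW.
      by rewrite ler_pM2r ?invr_gt0 // ler_piMr // ltW.
    have := pi_ge2 R; nra.
  have w1 := sin_le1 (pi * u / 2).
  have [uz|un] := eqVneq u 0.
    have := hb u; rewrite uz mulr0 mul0r sin0 expr0n /= mulr0 normr_le0 => /eqP ->.
    by rewrite normr0 mul0r !mulr_ge0 ?powR_ge0.
  have u0' : 0 < u by rewrite lt_def un.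
  move: hw w1 (hb u); rewrite /sin_kernel; set w := sin _ => hw w1 hbu.
  have w0 : 0 < w by apply: lt_le_trans hw; rewrite divr_gt0.
  rewrite (gtr0_norm w0).
  apply: (le_trans (ler_wpM2r _ hbu)); first by rewrite invr_ge0 powR_ge0.
  rewrite -(mulrA C) -(mulrA C) ler_wpM2l //.
  have -> : w ^+ 2 / w `^ s = w `^ (2 - s).
    by rewrite -powRN -powR_mulrn ?(ltW w0) // -powRD // (gt_eqF w0) implybT.
  apply: (@le_trans _ _ (w `^ (- p))); first by apply: ger_powR; [rewrite w0|lra].
  have -> : 2 `^ p * u `^ (- p) = (u / 2) `^ (- p).
    rewrite powRM ?invr_ge0 ?(ltW u0') // mulrC; congr (_ * _).
    by rewrite -powR_inv1 // -powRrM mulN1r opprK.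
  rewrite !powRN lef_pV2 ?posrE ?powR_gt0 ?divr_gt0 //.
  by apply: ge0_ler_powR => //; rewrite nnegrE ?(ltW w0) // divr_ge0.
- have := integrableZl (mu := mu) _ (C * 2 `^ p) hi => /(_ (measurable_itv _)).
  by apply: eq_integrable => // x _ /=; rewrite EFinM.
Qed.

(** For functions of parity [e] the kernel in [x + y] is the kernel in [x - y] taken at [- x], since
    [f (- x) - f y = e (f x - e f y)] and [e ^ 2 = 1]. Both terms thus fill one period, and the
    singularity moves to [u = 0] for every [y]. The cases [e = 1] and [e = -1] are those of
    [frac_kernel_low] for cosines and of [frac_kernel_high] for their derivatives. *)
Lemma frac_kernel_fold (f g : R -> R) (e s C y : R) :
  e = 1 \/ e = -1 -> s < 3 -> 0 <= C ->
  measurable_fun setT f -> measurable_fun setT g ->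
  (forall x, f (x + 2) = f x) -> (forall x, g (x + 2) = g x) ->
  (forall x, f (- x) = e * f x) -> (forall x, g (- x) = e * g x) ->
  (forall x u, `|f (x + u) - f x| <= C * `|sin (pi * u / 2)|) ->
  (forall x u, `|g (x + u) - g x| <= C * `|sin (pi * u / 2)|) ->
  0 <= y <= 1 ->
  \int[mu]_(x in `[0, 1])
    ((f x - f y) * (g x - g y) * sin_kernel s (x - y) +
     (f x - e * f y) * (g x - e * g y) * sin_kernel s (x + y)) =
  \int[mu]_(u in `[0, 1])
    (((f (y + u) - f y) * (g (y + u) - g y) +
      (f (y - u) - f y) * (g (y - u) - g y)) * sin_kernel s u).
Proof.
move=> e1 s3 C0 mf mg pf pg rf rg lf lg y01.
pose H u := (f (y + u) - f y) * (g (y + u) - g y).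
have Hb u : `|H u| <= (C * C) * sin (pi * u / 2) ^+ 2.
  rewrite normrM -(real_normK (num_real (sin _))) expr2.
  have -> : forall a b : R, a * a * (b * b) = (a * b) * (a * b) by move=> a b; ring.
  by apply: ler_pM.
have mH : measurable_fun setT H.
  have ms : measurable_fun setT (fun u : R => y + u).
    by apply: measurable_funD => //; exact: measurable_cst.
  by apply: measurable_funM; apply: measurable_funB; try exact: measurable_cst;
    [exact: (measurableT_comp mf)|exact: (measurableT_comp mg)].
have mK := measurable_sin_kernel s.
have mo : measurable_fun setT (fun x : R => - x) by exact: oppr_measurable.
pose G u := H u * sin_kernel s u.
have perK u : sin_kernel s (u + 2) = sin_kernel s u.
  rewrite /sin_kernel (_ : pi * (u + 2) / 2 = pi * u / 2 + pi); last by field.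
  by rewrite sinDpi normrN.
have := @Rintegral_fold_period _ G y y01.
have -> : (fun x : R => G (x - y) + G (- x - y)) = (fun x => (f x - f y) * (g x - g y) * sin_kernel s (x - y) +
     (f x - e * f y) * (g x - e * g y) * sin_kernel s (x + y)).
  apply/funext => x; rewrite /G /H.
  have -> : y + (x - y) = x by ring.
  have -> : y + (- x - y) = - x by ring.
  rewrite (_ : - x - y = - (x + y)); last by ring.
  rewrite sin_kernelN rf rg; congr (_ + _ * _).
  by case: e1 => ->; ring.
move=> ->.
- by apply: eq_Rintegral => u _; rewrite /G /H sin_kernelN -mulrDl.
- exact: measurable_funM.
- by move=> u; rewrite /G perK /H addrA pf pg.
- exact: (integrable_sin_kernel s3 (mulr_ge0 C0 C0) mH Hb).
- rewrite (_ : (fun x : R => G (- x)) = fun x => H (- x) * sin_kernel s x); last first.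
    by apply/funext => x; rewrite /G sin_kernelN.
  apply: (integrable_sin_kernel s3 (mulr_ge0 C0 C0)); first exact: (measurableT_comp mH mo).
  by move=> u; rewrite (le_trans (Hb _)) // mulrN mulNr sinN sqrrN.
Qed.
End SingularKernel.

(** * Diagonalization of the fractional form on trigonometric polynomials *)

Section FractionalForm.
Context {R : realType}.
Local Notation mu := (@lebesgue_measure R).

Lemma integrable_scale d (T : measurableType d) (m : {measure set T -> \bar R})
    (D : set T) (x : R) (p : T -> R) : measurable D ->
  m.-integrable D (EFin \o p) -> m.-integrable D (EFin \o (fun u => x * p u)).
Proof.
move=> mD ip; apply: (eq_integrable mD _ _ _ (integrableZl mD x ip)).
by move=> u _; rewrite /= EFinM.
Qed.

Lemma integrable_add d (T : measurableType d) (m : {measure set T -> \bar R})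
    (D : set T) (p q : T -> R) : measurable D ->
  m.-integrable D (EFin \o p) -> m.-integrable D (EFin \o q) ->
  m.-integrable D (EFin \o (fun u => p u + q u)).
Proof.
move=> mD ip iq; apply: (eq_integrable mD _ _ _ (integrableD mD ip iq)).
by move=> u _; rewrite /= EFinD.
Qed.

Lemma integrable_bigsum d (T : measurableType d) (m : {measure set T -> \bar R})
    (D : set T) (I : Type) (s : seq I) (F : I -> T -> R) : measurable D ->
  (forall i, m.-integrable D (EFin \o F i)) ->
  m.-integrable D (EFin \o (fun x => \sum_(i <- s) F i x)).
Proof.
move=> mD h; elim: s => [|i s IH].
  apply: (@eq_integrable _ _ _ _ _ mD (cst 0%E)); last exact: integrable0.
  by move=> x _; rewrite /= big_nil.
apply: (@eq_integrable _ _ _ _ _ mD ((EFin \o F i) \+ (EFin \o (fun x => (\sum_(i <- s) F i x)%R)))%E).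
  by move=> x _ /=; rewrite big_cons.
exact: integrableD.
Qed.

Lemma Rintegral_sum d (T : measurableType d) (m : {measure set T -> \bar R})
    (D : set T) (I : Type) (s : seq I) (F : I -> T -> R) : measurable D ->
  (forall i, m.-integrable D (EFin \o F i)) ->
  \int[m]_(x in D) (\sum_(i <- s) F i x) = \sum_(i <- s) \int[m]_(x in D) F i x.
Proof.
move=> mD h; elim: s => [|i s IH].
  rewrite big_nil; under eq_Rintegral do rewrite big_nil.
  by rewrite Rintegral_cst // mul0r.
rewrite big_cons -IH -RintegralD //; last exact: integrable_bigsum.
by apply: eq_Rintegral => x _; rewrite big_cons.
Qed.

Definition trig (b : bool) (k : nat) (x : R) : R :=
  if b then cos (k%:R * pi * x) else sin (k%:R * pi * x).
Definition parity (b : bool) : R := if b then 1 else -1.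
Definition tpoly b n (a : nat -> R) (x : R) : R := \sum_(k < n) a k * trig b k x.
(** The half-angle factor of an increment by [u]; a product of two of them supplies the second-order
    zero that tames the kernel. *)
Definition hs (k : nat) (u : R) : R := sin (k%:R * (pi * u / 2)).
Definition hc (k : nat) (u : R) : R := cos (k%:R * (pi * u / 2)).

Lemma sin_nat_pi (k : nat) : sin (k%:R * pi) = 0 :> R.
Proof.
elim: k => [|k IH]; first by rewrite mul0r sin0.
by rewrite -natr1 mulrDl mul1r sinDpi IH oppr0.
Qed.

Lemma hcE k u : hc k u ^+ 2 = 1 - hs k u ^+ 2.
Proof. by rewrite /hc cos2sin2. Qed.

Lemma trig_diff b k x u : trig b k (x + u) - trig b k x =
  2 * hs k u * (if b then - (trig false k x * hc k u + trig true k x * hs k u)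
                else trig true k x * hc k u - trig false k x * hs k u).
Proof.
have e : k%:R * pi * (x + u) = k%:R * pi * x + (k%:R * (pi * u / 2) + k%:R * (pi * u / 2)) :> R by field.
rewrite /trig; case: b; rewrite e ?cosD ?sinD.
  rewrite -/(hs k u) -/(hc k u); have := hcE k u; set c := hc _ _; set s := hs _ _.
  set C := cos _; set S := sin _; rewrite !expr2 => h.
  by rewrite h; ring.
rewrite -/(hs k u) -/(hc k u); have := hcE k u; set c := hc _ _; set s := hs _ _.
rewrite cosD -/(hs k u) -/(hc k u) -/c -/s.
set C := cos _; set S := sin _; rewrite !expr2 => h.
by rewrite h; ring.
Qed.

Lemma hsN k u : hs k (- u) = - hs k u.
Proof. by rewrite /hs (_ : k%:R * (pi * - u / 2) = - (k%:R * (pi * u / 2))) ?sinN //; ring. Qed.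

Lemma hcN k u : hc k (- u) = hc k u.
Proof. by rewrite /hc (_ : k%:R * (pi * - u / 2) = - (k%:R * (pi * u / 2))) ?cosN //; ring. Qed.

(** Symmetrizing in [u] separates the variables: [y] enters only through cosines of frequency
    [k - l] and [k + l], which are then integrated in closed form. *)
Lemma trig_diff2 b k l y u :
  (trig b k (y + u) - trig b k y) * (trig b l (y + u) - trig b l y) +
  (trig b k (y - u) - trig b k y) * (trig b l (y - u) - trig b l y) =
  4 * (cos ((k%:R - l%:R) * pi * y) * (hs k u * hs l u * cos ((k%:R - l%:R) * (pi * u / 2)))
   - parity b * cos ((k%:R + l%:R) * pi * y) * (hs k u * hs l u * cos ((k%:R + l%:R) * (pi * u / 2)))).
Proof.
rewrite !trig_diff !hsN !hcN.
have -> : cos ((k%:R - l%:R) * pi * y) =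
    trig true k y * trig true l y + trig false k y * trig false l y :> R.
  by rewrite /trig !mulrBl cosB.
have -> : cos ((k%:R + l%:R) * pi * y) =
    trig true k y * trig true l y - trig false k y * trig false l y :> R.
  by rewrite /trig !mulrDl cosD.
have -> : cos ((k%:R - l%:R) * (pi * u / 2)) = hc k u * hc l u + hs k u * hs l u :> R.
  by rewrite mulrBl cosB.
have -> : cos ((k%:R + l%:R) * (pi * u / 2)) = hc k u * hc l u - hs k u * hs l u :> R.
  by rewrite mulrDl cosD.
by rewrite /parity; case: b; ring.
Qed.

Lemma trig_period b k x : trig b k (x + 2) = trig b k x.
Proof.
apply/eqP; rewrite -subr_eq0 trig_diff /hs (_ : pi * 2 / 2 = pi); last by field.
by rewrite sin_nat_pi mulr0 mul0r.
Qed.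

Lemma trigN b k x : trig b k (- x) = parity b * trig b k x.
Proof. by rewrite /trig mulrN /parity; case: b; rewrite ?cosN ?sinN; ring. Qed.

Lemma ler_norm_hs k u : `|hs k u| <= k%:R * `|sin (pi * u / 2)|.
Proof. exact: ler_norm_sinM. Qed.

Lemma trig_max b k x : `|trig b k x| <= 1.
Proof. by rewrite /trig; case: b; [exact: cos_max|exact: sin_max]. Qed.

Lemma trig_lip b k x u : `|trig b k (x + u) - trig b k x| <= 4 * k%:R * `|sin (pi * u / 2)|.
Proof.
have h (p q p' q' : R) : `|p| <= 1 -> `|q| <= 1 -> `|p'| <= 1 -> `|q'| <= 1 -> `|p * q + p' * q'| <= 2.
  move=> *; rewrite (le_trans (ler_normD _ _)) // (_ : 2 = 1 * 1 + 1 * 1 :> R); last by ring.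
  by rewrite lerD // normrM ler_pM.
have c1 : `|hc k u| <= 1 by exact: cos_max.
have s1 : `|hs k u| <= 1 by exact: sin_max.
rewrite trig_diff normrM normrM normr_nat.
set Q := if b then _ else _.
have Q2 : `|Q| <= 2.
  by rewrite /Q {Q}; case: b; [rewrite normrN; apply: h|rewrite -mulrN; apply: h]; rewrite ?normrN // ?trig_max.
apply: (@le_trans _ _ (2 * (k%:R * `|sin (pi * u / 2)|) * 2)).
  by apply: ler_pM => //; rewrite ?mulr_ge0 // ler_wpM2l // ler_norm_hs.
by rewrite le_eqVlt; apply/orP; left; apply/eqP; ring.
Qed.

Lemma continuous_trig b k : continuous (trig b k).
Proof.
rewrite /trig => x; case: b; apply: continuous_comp.
- by apply: cvgMr; exact: cvg_id.
- exact: continuous_cos.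
- by apply: cvgMr; exact: cvg_id.
- exact: continuous_sin.
Qed.

Lemma measurable_trig b k : measurable_fun setT (trig b k).
Proof. by apply: continuous_measurable_fun; exact: continuous_trig. Qed.

Lemma measurable_tpoly b n a : measurable_fun setT (tpoly b n a).
Proof.
apply: measurable_sum => i; apply: measurable_funM => //.
exact: measurable_trig.
Qed.

Lemma tpoly_lip b n a : exists2 C : R, 0 <= C &
  forall x u, `|tpoly b n a (x + u) - tpoly b n a x| <= C * `|sin (pi * u / 2)|.
Proof.
exists (\sum_(k < n) `|a k| * (4 * k%:R)).
  by apply: sumr_ge0 => k _; rewrite !mulr_ge0.
move=> x u; rewrite /tpoly -sumrB (le_trans (ler_norm_sum _ _ _)) //.
rewrite mulr_suml; apply: ler_sum => k _.
by rewrite -mulrBr normrM -[X in _ <= X]mulrA; apply: ler_wpM2l => //; exact: trig_lip.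
Qed.

Lemma lebesgue_measure_unit : fine (mu `[0, 1]%classic) = 1.
Proof. by rewrite lebesgue_measure_itv /= lte_fin ltr01 oppr0 adde0. Qed.

Lemma Rintegral_cos_int (k l : nat) (e : R) : e = 1 \/ e = -1 ->
  \int[mu]_(y in `[0, 1]) cos ((k%:R + e * l%:R) * pi * y) =
  if k%:R + e * l%:R == 0 then 1 else 0 :> R.
Proof.
move=> e1; have P := pi_gt0 R.
case: eqVneq => [->|h].
  under eq_Rintegral do rewrite !mul0r cos0.
  by rewrite Rintegral_cst ?mul1r ?lebesgue_measure_unit //; exact: measurable_itv.
set w := (_ + _) * pi.
have w0 : w != 0 by rewrite mulf_neq0 // gt_eqF.
have dF (x : R) : 0 <= x <= 1 -> is_derive x 1 (fun y : R => w^-1 * sin (w * y)) (cos (w * x)).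
  move=> _.
  have d : is_derive x 1 (fun y : R => w * y) w.
    by apply: is_derive_eq; rewrite /GRing.scale /= mulr1.
  have d2 := is_derive1_comp (f := sin) (is_derive_sin (w * x)) d.
  have d3 := is_deriveZ w^-1 d2.
  by apply: (is_derive_eq d3); rewrite /GRing.scale /= mulrA mulrAC mulVf // mul1r.
have cw : {within `[0, 1], continuous (fun y : R => cos (w * y))}.
  apply: continuous_subspaceT => x; apply: continuous_comp; last exact: continuous_cos.
  by apply: cvgMr; exact: cvg_id.
rewrite /Rintegral (Rintegral_derive ler01 dF cw) /= mulr1 mulr0 sin0 mulr0 subr0 /w mulrDl sinD -mulrA.
have -> : sin (e * (l%:R * pi)) = 0 :> R.
  by case: e1 => ->; rewrite ?mulN1r ?sinN ?mul1r sin_nat_pi ?oppr0.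
by rewrite sin_nat_pi mul0r mulr0 add0r mulr0.
Qed.

Lemma integrable_hs_cos k l (s w : R) : s < 3 ->
  mu.-integrable `[0, 1] (EFin \o (fun u => hs k u * hs l u * cos (w * (pi * u / 2)) * sin_kernel s u)).
Proof.
move=> s3; apply: (integrable_sin_kernel (C := k%:R * l%:R)) => //.
- have m (j : R) : measurable_fun setT (fun u : R => j * (pi * u / 2)).
    by apply: continuous_measurable_fun => x; apply: cvgMr; apply: cvgMl; apply: cvgMr; exact: cvg_id.
  by apply: measurable_funM; [apply: measurable_funM|]; (apply: measurableT_comp; last exact: m);
    apply: continuous_measurable_fun; first [exact: continuous_sin|exact: continuous_cos].
- move=> u; rewrite !normrM -(real_normK (num_real (sin _))) expr2.
  rewrite -[X in _ <= X]mulr1; apply: ler_pM => //; last exact: cos_max.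
  rewrite mulrACA; apply: ler_pM => //; exact: ler_norm_hs.
Qed.

Lemma Rintegral_lin2 (p q : R -> R) (x z : R) :
  mu.-integrable `[0, 1] (EFin \o p) -> mu.-integrable `[0, 1] (EFin \o q) ->
  mu.-integrable `[0, 1] (EFin \o (fun u => x * p u + z * q u)) /\
  \int[mu]_(u in `[0, 1]) (x * p u + z * q u) =
  x * \int[mu]_(u in `[0, 1]) p u + z * \int[mu]_(u in `[0, 1]) q u.
Proof.
move=> ip iq.
have ipx : mu.-integrable `[0, 1] (EFin \o (fun u => x * p u)) by exact: integrable_scale.
have iqz : mu.-integrable `[0, 1] (EFin \o (fun u => z * q u)) by exact: integrable_scale.
split; first exact: integrable_add.
by rewrite RintegralD // !RintegralZl.
Qed.

Lemma integrable_continuous01 (f : R -> R) : {within `[0, 1], continuous f} ->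
  mu.-integrable `[0, 1] (EFin \o f).
Proof. by move=> cf; apply: continuous_compact_integrable => //; exact: segment_compact. Qed.

Definition hs_energy (s : R) (k : nat) : R :=
  \int[mu]_(u in `[0, 1]) (hs k u ^+ 2 * sin_kernel s u).

(** After folding, the outer integral of [cos ((k - l) pi y)] vanishes unless [k = l], and that of
    [cos ((k + l) pi y)] unless [k = l = 0]. On the diagonal the remaining cosine in [u] is 1. *)
Lemma frac_form_diag (b : bool) (s : R) n (a c : nat -> R) : s < 3 ->
  let f := tpoly b n a in let g := tpoly b n c in
  \int[mu]_(y in `[0, 1]) \int[mu]_(x in `[0, 1])
    ((f x - f y) * (g x - g y) * sin_kernel s (x - y) +
     (f x - parity b * f y) * (g x - parity b * g y) * sin_kernel s (x + y)) =
  4 * \sum_(k < n) a k * c k * hs_energy s k.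
Proof.
move=> s3 f g.
have [C1 C10 L1] := tpoly_lip b n a; have [C2 C20 L2] := tpoly_lip b n c.
have e1 : parity b = 1 \/ parity b = -1 by rewrite /parity; case: b {f g L1 L2}; [left|right].
pose P k l : R := \int[mu]_(u in `[0, 1]) (hs k u * hs l u * cos ((k%:R - l%:R) * (pi * u / 2)) * sin_kernel s u).
pose Q k l : R := \int[mu]_(u in `[0, 1]) (hs k u * hs l u * cos ((k%:R + l%:R) * (pi * u / 2)) * sin_kernel s u).
pose W k l (y : R) : R := cos ((k%:R - l%:R) * pi * y) * P k l - parity b * cos ((k%:R + l%:R) * pi * y) * Q k l.
transitivity (\int[mu]_(y in `[0, 1]) (\sum_(k < n) \sum_(l < n) a k * c l * (4 * W k l y))).
  apply: eq_Rintegral => y; rewrite inE /= in_itv /= => y01.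
  have per h : forall x, tpoly b n h (x + 2) = tpoly b n h x.
    by move=> x; apply: eq_bigr => k _; rewrite trig_period.
  have par h : forall x, tpoly b n h (- x) = parity b * tpoly b n h x.
    by move=> x; rewrite mulr_sumr; apply: eq_bigr => k _; rewrite trigN mulrCA.
  have L1' x u : `|f (x + u) - f x| <= Num.max C1 C2 * `|sin (pi * u / 2)|.
    by rewrite (le_trans (L1 _ _)) // ler_wpM2r // le_max lexx.
  have L2' x u : `|g (x + u) - g x| <= Num.max C1 C2 * `|sin (pi * u / 2)|.
    by rewrite (le_trans (L2 _ _)) // ler_wpM2r // le_max lexx orbT.
  have CC : 0 <= Num.max C1 C2 by rewrite le_max C10.
  rewrite (frac_kernel_fold e1 s3 CC (measurable_tpoly b n a) (measurable_tpoly b n c)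
    (per a) (per c) (par a) (par c) L1' L2' y01).
  transitivity (\int[mu]_(u in `[0, 1]) (\sum_(k < n) \sum_(l < n) a k * c l *
     (4 * (cos ((k%:R - l%:R) * pi * y) * (hs k u * hs l u * cos ((k%:R - l%:R) * (pi * u / 2)) * sin_kernel s u)
      - parity b * cos ((k%:R + l%:R) * pi * y) * (hs k u * hs l u * cos ((k%:R + l%:R) * (pi * u / 2)) * sin_kernel s u))))).
    apply: eq_Rintegral => u _.
    have bil (v v' w w' : nat -> R) : (\sum_(k < n) a k * v k) * (\sum_(k < n) c k * w k) +
       (\sum_(k < n) a k * v' k) * (\sum_(k < n) c k * w' k) =
       \sum_(k < n) \sum_(l < n) a k * c l * (v k * w l + v' k * w' l).
      rewrite !mulr_suml -big_split /=; apply: eq_bigr => k _.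
      by rewrite !mulr_sumr -big_split /=; apply: eq_bigr => l _; ring.
    have df h x z : tpoly b n h x - tpoly b n h z = \sum_(k < n) h k * (trig b k x - trig b k z).
      by rewrite /tpoly -sumrB; apply: eq_bigr => k _; rewrite mulrBr.
    rewrite !df (bil (fun k => trig b k (y + u) - trig b k y) (fun k => trig b k (y - u) - trig b k y)
      (fun k => trig b k (y + u) - trig b k y) (fun k => trig b k (y - u) - trig b k y)).
    rewrite mulr_suml; apply: eq_bigr => k _; rewrite mulr_suml; apply: eq_bigr => l _.
    by rewrite trig_diff2; ring.
  have iP k l := integrable_hs_cos k l (k%:R - l%:R) s3.
  have iQ k l := integrable_hs_cos k l (k%:R + l%:R) s3.
  have mI : measurable (`[0, 1]%classic : set R) by exact: measurable_itv.
  have L k l := Rintegral_lin2 (a k * c l * 4 * cos ((k%:R - l%:R) * pi * y))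
    (- (a k * c l * 4 * (parity b * cos ((k%:R + l%:R) * pi * y)))) (iP k l) (iQ k l).
  have E k l : (fun u => a k * c l *
     (4 * (cos ((k%:R - l%:R) * pi * y) * (hs k u * hs l u * cos ((k%:R - l%:R) * (pi * u / 2)) * sin_kernel s u)
      - parity b * cos ((k%:R + l%:R) * pi * y) * (hs k u * hs l u * cos ((k%:R + l%:R) * (pi * u / 2)) * sin_kernel s u)))) =
    (fun u => a k * c l * 4 * cos ((k%:R - l%:R) * pi * y) * (hs k u * hs l u * cos ((k%:R - l%:R) * (pi * u / 2)) * sin_kernel s u) +
     (- (a k * c l * 4 * (parity b * cos ((k%:R + l%:R) * pi * y)))) * (hs k u * hs l u * cos ((k%:R + l%:R) * (pi * u / 2)) * sin_kernel s u)).
    by apply/funext => u; ring.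
  rewrite Rintegral_sum //; last first.
    by move=> k; apply: integrable_bigsum => // l; rewrite E; exact: (L k l).1.
  apply: eq_bigr => k _; rewrite Rintegral_sum //; last first.
    by move=> l; rewrite E; exact: (L k l).1.
  apply: eq_bigr => l _; rewrite E (L k l).2 /W /P /Q; ring.
have mI : measurable (`[0, 1]%classic : set R) by exact: measurable_itv.
have ic (w : R) : mu.-integrable `[0, 1] (EFin \o (fun y => cos (w * pi * y))).
  apply: integrable_continuous01; apply: continuous_subspaceT => x.
  by apply: continuous_comp; [apply: cvgMr; exact: cvg_id|exact: continuous_cos].
have L k l := Rintegral_lin2 (a k * c l * 4 * P k l) (- (a k * c l * 4 * (parity b * Q k l)))
  (ic (k%:R - l%:R)) (ic (k%:R + l%:R)).
have E k l : (fun y => a k * c l * (4 * W k l y)) = (fun y =>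
  a k * c l * 4 * P k l * cos ((k%:R - l%:R) * pi * y) +
  (- (a k * c l * 4 * (parity b * Q k l))) * cos ((k%:R + l%:R) * pi * y)).
  by apply/funext => y; rewrite /W; ring.
rewrite Rintegral_sum //; last first.
  by move=> k; apply: integrable_bigsum => // l; rewrite E; exact: (L k l).1.
rewrite mulr_sumr; apply: eq_bigr => k _.
rewrite Rintegral_sum //; last by move=> l; rewrite E; exact: (L k l).1.
have V l : \int[mu]_(x in `[0, 1]) (a k * c l * (4 * W k l x)) =
    if l == k then 4 * (a k * c k * hs_energy s k) else 0.
  rewrite E (L k l).2.
  have := @Rintegral_cos_int k l (-1) (or_intror erefl); rewrite mulN1r => ->.
  have := @Rintegral_cos_int k l 1 (or_introl erefl); rewrite mul1r => ->.
  have -> : (k%:R - l%:R == 0 :> R) = (l == k) by rewrite subr_eq0 eqr_nat eq_sym.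
  (* The sum frequency survives only for [k = l = 0], where [hs 0] is zero. *)
  have Q0 : Q k l * (if k%:R + l%:R == 0 :> R then 1 else 0) = 0.
    rewrite -natrD pnatr_eq0 addn_eq0; case: eqP => [k0|]; last by rewrite mulr0.
    rewrite (_ : Q k l = 0) ?mul0r // /Q; under eq_Rintegral.
      by move=> u _; rewrite {1}/hs k0 mul0r sin0 !mul0r; over.
    by rewrite Rintegral_cst // mul0r.
  move: Q0; set t := (if k%:R + l%:R == 0 then _ else _) => Q0.
  rewrite (_ : - _ * t = - (a k * c l * 4 * parity b) * (Q k l * t)); last by ring.
  rewrite Q0; case: eqP => [->|_]; last by ring.
  rewrite (_ : P k k = hs_energy s k); first by ring.
  by apply: eq_Rintegral => u _; rewrite subrr mul0r cos0 mulr1 expr2.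
rewrite (eq_bigr (fun l : 'I_n => if l == k then 4 * (a k * c k * hs_energy s k) else 0)); last first.
  by move=> l _; rewrite V.
by rewrite -big_mkcond /= big_pred1_eq.
Qed.

End FractionalForm.

(** * Lower bound for the energies and origin of the constants *)

Section SobolevForm.
Context {R : realType}.
Local Notation mu := (@lebesgue_measure R).

Definition base_integral (s : R) : R :=
  \int[mu]_(t in `[0%R, 2^-1%R]) (sin (pi * t) ^+ 2 / t `^ s).

Lemma hs0 u : hs 0 u = 0 :> R.
Proof. by rewrite /hs mul0r sin0. Qed.

Lemma hs_energy0 s : hs_energy s 0 = 0 :> R.
Proof.
rewrite /hs_energy; under eq_Rintegral do rewrite hs0 expr0n /= mul0r.
by rewrite Rintegral_cst // mul0r.
Qed.

(** On [[0, 1]] a minorant of the energy density: the sine in the denominator is replaced by its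
    argument, which makes an exact rescaling possible. *)
Let low_kernel (s : R) (k : nat) (u : R) : R := hs k u ^+ 2 * (pi * u / 2) `^ (- s).

Lemma measurable_hs k : measurable_fun setT (hs k : R -> R).
Proof.
apply: continuous_measurable_fun => x; apply: continuous_comp; last exact: continuous_sin.
by apply: cvgMr; apply: cvgMl; apply: cvgMr; exact: cvg_id.
Qed.

Let measurable_low_kernel s k : measurable_fun setT (low_kernel s k).
Proof.
apply: measurable_funM; first by apply: measurable_funX; exact: measurable_hs.
apply: (measurableT_comp (measurable_powR _)).
apply: continuous_measurable_fun => x.
by apply: cvgMl; apply: cvgMr; exact: cvg_id.
Qed.

Lemma integrable_hs_energy s k : s < 3 ->
  mu.-integrable `[0, 1] (EFin \o (fun u => hs k u ^+ 2 * sin_kernel s u)).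
Proof.
move=> s3; have := integrable_hs_cos k k 0 s3.
apply: eq_integrable; first exact: measurable_itv.
by move=> u _; rewrite /= mul0r cos0 mulr1 expr2.
Qed.

Let low_kernel_le (s : R) k (u : R) : 0 <= s -> 0 <= u <= 1 ->
  low_kernel s k u <= hs k u ^+ 2 * sin_kernel s u.
Proof.
move=> s0 /andP[u0 u1]; have P := pi_gt0 R.
move: u0; rewrite le_eqVlt => /predU1P[<-|u0].
  by rewrite /low_kernel /hs !mulr0 mul0r mulr0 sin0 expr0n /= !mul0r.
have w0 : 0 < sin (pi * u / 2).
  apply: (@lt_le_trans _ _ (pi * u / 2 / 2)); first by rewrite !divr_gt0 // mulr_gt0.
  apply: sin_ge_half; apply/andP; split; first by rewrite divr_ge0 // mulr_ge0 // ltW.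
  by rewrite ler_pM2r ?invr_gt0 // ler_piMr // ltW.
rewrite /low_kernel ler_wpM2l ?sqr_ge0 // powRN /sin_kernel gtr0_norm //.
have q0 : 0 < pi * u / 2 by rewrite divr_gt0 // mulr_gt0.
rewrite lef_pV2 ?posrE ?powR_gt0 //; apply: ge0_ler_powR => //; rewrite ?nnegrE ?(ltW w0) ?(ltW q0) //.
by apply: sin_le_id; exact: ltW.
Qed.

Let integrable_low_kernel (s : R) k : 0 <= s -> s < 3 ->
  mu.-integrable `[0, 1] (EFin \o low_kernel s k).
Proof.
move=> s0 s3.
have hi := integrable_hs_energy k s3.
apply: (@le_integrable _ _ _ mu _ _ _ (EFin \o (fun u => hs k u ^+ 2 * sin_kernel s u))) => //.
  by apply/measurable_EFinP/measurable_funTS; exact: measurable_low_kernel.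
move=> u; rewrite /= in_itv /= => u01; rewrite lee_fin.
rewrite !ger0_norm; first exact: low_kernel_le.
  by rewrite mulr_ge0 ?sqr_ge0 ?sin_kernel_ge0.
by rewrite mulr_ge0 ?sqr_ge0 ?powR_ge0.
Qed.

(** The substitution [u = 2 t / k] turns [hs k u] into [sin (pi t)]. The cut at [1 / k] becomes the
    limit 1/2 of the integrals in [c_low] and [c_high], and the Jacobian leaves [k ^ (s - 1)]. *)
Let scaled (s : R) k : (0 < k)%N -> 0 <= s ->
  (\int[mu]_(u in `[0%R, k%:R^-1%R]) (low_kernel s k u)%:E =
  (2 * k%:R `^ (s - 1) * pi `^ (- s))%:E *
   \int[mu]_(t in `[0%R, 2^-1%R]) (sin (pi * t) ^+ 2 / t `^ s)%:E)%E.
Proof.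
move=> k0 s0; have P := pi_gt0 R.
have kR : 0 < k%:R :> R by rewrite ltr0n.
have c0 : 0 < 2 / k%:R :> R by rewrite divr_gt0.
have pn : pi != 0 :> R := lt0r_neq0 P.
have kn : k%:R != 0 :> R := lt0r_neq0 kR.
rewrite (ge0_integral_scale c0) //; last 2 first.
- by apply/measurable_EFinP; exact: measurable_low_kernel.
- by move=> u; rewrite lee_fin mulr_ge0 ?sqr_ge0 ?powR_ge0.
have -> : ([set x : R | `[0%R, k%:R^-1%R]%classic (2 / k%:R * x)%R] = `[0%R, 2^-1%R])%classic.
  apply/seteqP; split => x /=; rewrite !in_itv /= pmulr_rge0 //.
    by move=> /andP[-> /=]; rewrite mulrAC ler_pdivrMr // mulVf ?gt_eqF // -ler_pdivlMl // mulr1.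
  by move=> /andP[-> /=]; rewrite mulrAC ler_pdivrMr // mulVf ?gt_eqF // -ler_pdivlMl // mulr1.
have E (x : R) : x \in `[0%R, 2^-1%R]%classic ->
    (low_kernel s k (2 / k%:R * x))%:E =
    (((k%:R / pi) `^ s)%:E * (sin (pi * x) ^+ 2 / x `^ s)%:E)%E.
  rewrite inE /= in_itv /= => /andP[x0 _].
  rewrite -EFinM /low_kernel /hs; congr (_%:E).
  have f1 (p q : R) : q != 0 -> q * (p * (2 / q * x) / 2) = p * x by move=> *; field.
  have f2 (p q : R) : p != 0 -> q != 0 -> p * (2 / q * x) / 2 = (q / p)^-1 * x.
    by move=> hp hq; field; rewrite ?hp ?hq.
  rewrite f1 // f2 //.
  rewrite powRM // ?invr_ge0 ?divr_ge0 ?(ltW P) //.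
  rewrite mulrCA; congr (_ * (_ * _)); last by rewrite powRN.
  by rewrite -powR_inv1 ?divr_ge0 ?(ltW P) // -powRrM mulN1r opprK.
rewrite (_ : \int[mu]_(x in `[0%R, 2^-1%R]) (low_kernel s k (2 / k%:R * x)%R)%:E =
  \int[mu]_(x in `[0%R, 2^-1%R]) (((k%:R / pi) `^ s)%:E * (sin (pi * x) ^+ 2 / x `^ s)%:E))%E; last exact: eq_integral.
rewrite ge0_integralZl_EFin //=; last 3 first.
- by move=> x; rewrite in_itv /= => /andP[x0 _]; rewrite lee_fin mulr_ge0 ?sqr_ge0 // invr_ge0 powR_ge0.
- apply/measurable_EFinP/measurable_funTS.
  under eq_fun do rewrite -powRN.
  apply: measurable_funM; last exact: measurable_powR.
  apply: measurable_funX; apply: continuous_measurable_fun => x.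
  by apply: continuous_comp; [apply: cvgMr; exact: cvg_id|exact: continuous_sin].
- by rewrite powR_ge0.
rewrite muleA -EFinM; congr (_%:E * _)%E.
rewrite powRM ?invr_ge0 ?(ltW P) //.
have -> : pi^-1 `^ s = pi `^ (- s) :> R by rewrite -powR_inv1 ?(ltW P) // -powRrM mulN1r.
rewrite mulrA; congr (_ * _); rewrite -mulrA; congr (_ * _).
by rewrite -[in LHS]powR_inv1 ?(ltW kR) // -powRD ?(gt_eqF kR) ?implybT //; congr (_ `^ _); ring.
Qed.

(** Finiteness excludes the default value of [fine] at infinity. For [k = 1] the rescaling exhibits
    the integral, up to a positive factor, as one already known to be finite. *)
Lemma base_integral_fin (s : R) : 0 <= s -> s < 3 ->
  (\int[mu]_(t in `[0%R, 2^-1%R]) (sin (pi * t) ^+ 2 / t `^ s)%:E = (base_integral s)%:E)%E.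
Proof.
move=> s0 s3; have P := pi_gt0 R.
have h : (\int[mu]_(u in `[0%R, 1%R]) (low_kernel s 1 u)%:E)%E \is a fin_num.
  by apply: integrable_fin_num => //; exact: integrable_low_kernel.
rewrite /base_integral /Rintegral fineK //.
have := scaled (k := 1) isT s0; rewrite invr1 => e.
move: h; rewrite e.
have : (0 <= \int[mu]_(t in `[0%R, 2^-1%R]) (sin (pi * t) ^+ 2 / t `^ s)%:E)%E.
  by apply: integral_ge0 => x; rewrite /= in_itv /= => /andP[x0 _]; rewrite lee_fin mulr_ge0 ?sqr_ge0 // invr_ge0 powR_ge0.
case: (integral _ _ _) => [r|_|] //.
by rewrite gt0_muley // lte_fin !mulr_gt0 // powR_gt0.
Qed.

(** Two losses only: [sin x <= x] in the denominator, and the restriction of [[0, 1]] to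
    [[0, 1/k]]. *)
Lemma hs_energy_ge (s : R) k : 0 <= s -> s < 3 -> (0 < k)%N ->
  2 * k%:R `^ (s - 1) * pi `^ (- s) * base_integral s <= hs_energy s k.
Proof.
move=> s0 s3 k0.
have e := scaled k0 s0; rewrite (base_integral_fin s0 s3) -EFinM in e.
rewrite -lee_fin -e.
have h := integrable_hs_energy k s3.
have -> : (hs_energy s k)%:E = (\int[mu]_(u in `[0%R, 1%R]) (hs k u ^+ 2 * sin_kernel s u)%:E)%E.
  by rewrite /hs_energy /Rintegral fineK //; apply: integrable_fin_num.
apply: (@le_trans _ _ (\int[mu]_(u in `[0%R, 1%R]) (low_kernel s k u)%:E)%E).
  apply: ge0_subset_integral => //.
  - by apply/measurable_EFinP/measurable_funTS; exact: measurable_low_kernel.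
  - by move=> u _; rewrite lee_fin mulr_ge0 ?sqr_ge0 ?powR_ge0.
  - move=> u; rewrite /= !in_itv /= => /andP[-> /= h1]; apply: le_trans h1 _.
    by rewrite invf_le1 ?ltr0n // ler1n.
apply: le_integral => //; first exact: integrable_low_kernel.
by move=> u; rewrite inE /= in_itv /= => u01; rewrite lee_fin low_kernel_le.
Qed.

Lemma base_integral_gt0 (s : R) : 0 <= s -> s < 3 -> 0 < base_integral s.
Proof.
move=> s0 s3; have P := pi_gt0 R.
rewrite -lte_fin -(base_integral_fin s0 s3).
(* On [[1/4, 1/2]] one has [sin (pi t) >= pi t / 2 >= 1/4] and [t ^ s <= 1]. *)
apply: (@lt_le_trans _ _ (\int[mu]_(t in `[4^-1%R, 2^-1%R]) (cst (16^-1)%:E t))%E).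
  rewrite integral_cst //= lebesgue_measure_itv /= lte_fin ifT; last by lra.
  by rewrite -?EFinN -?EFinD -?EFinM lte_fin mulr_gt0 //; lra.
have m : measurable_fun setT (fun t : R => (sin (pi * t) ^+ 2 / t `^ s)).
  under eq_fun do rewrite -powRN.
  apply: measurable_funM; last exact: measurable_powR.
  apply: measurable_funX; apply: continuous_measurable_fun => x.
  by apply: continuous_comp; [apply: cvgMr; exact: cvg_id|exact: continuous_sin].
apply: (@le_trans _ _ (\int[mu]_(t in `[4^-1%R, 2^-1%R]) (sin (pi * t) ^+ 2 / t `^ s)%:E)%E).
  apply: ge0_le_integral => //.
  - by move=> x _; rewrite lee_fin.
  - exact/measurable_EFinP/measurable_funTS.
  - move=> x; rewrite /= in_itv /= => /andP[x0 x1]; rewrite lee_fin.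
    have xs : 4^-1 <= sin (pi * x).
      apply: (@le_trans _ _ (pi * x / 2)); last by apply: sin_ge_half; apply/andP; split; nra.
      by have := pi_ge2 R; nra.
    have xp : 0 < x `^ s by rewrite powR_gt0; lra.
    have x2 : x `^ s <= 1.
      have <- : 1 `^ s = 1 :> R by rewrite powR1.
      by apply: ge0_ler_powR => //; rewrite ?nnegrE; lra.
    rewrite ler_pdivlMr // expr2; nra.
apply: ge0_subset_integral => //.
- exact/measurable_EFinP/measurable_funTS.
- by move=> u _; rewrite lee_fin mulr_ge0 ?sqr_ge0 ?invr_ge0 ?powR_ge0.
- by move=> u; rewrite /= !in_itv /= => /andP[h1 ->]; rewrite (le_trans _ h1).
Qed.

End SobolevForm.

(** * Eigenvalues of the Sobolev form in the cosine basis *)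

Section Diagonal.
Context {R : realType}.
Local Notation mu := (@lebesgue_measure R).
Implicit Types (a c : nat -> R) (b : bool) (k l n : nat) (alpha gamma : R).

Definition cos_series (n : nat) (a : nat -> R) (x : R) : R := \sum_(k < n) a k * phi k x.

Definition phi_scale (k : nat) : R := if k == 0%N then 1 else Num.sqrt 2.

Lemma phiE k x : phi k x = phi_scale k * trig true k x :> R.
Proof.
rewrite /phi /phi_scale /trig; case: eqP => [->|//].
by rewrite !mul0r cos0 mulr1.
Qed.

Lemma phi_scale_sqr k : phi_scale k ^+ 2 = if k == 0%N then 1 else 2 :> R.
Proof. by rewrite /phi_scale; case: eqP => _; rewrite ?expr1n // sqr_sqrtr. Qed.

Lemma cos_seriesE n a : cos_series n a = tpoly true n (fun k => a k * phi_scale k).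
Proof. by apply/funext => x; apply: eq_bigr => k _; rewrite phiE mulrA. Qed.

Lemma is_derive_trig b k (x : R) :
  is_derive x 1 (trig b k) (k%:R * pi * (if b then - trig false k x else trig true k x)).
Proof.
have d : is_derive x 1 (fun y : R => k%:R * pi * y) (k%:R * pi).
  by apply: is_derive_eq; rewrite /GRing.scale /= mulr1.
rewrite /trig; case: b.
- have := is_derive1_comp (f := cos) (is_derive_cos (k%:R * pi * x)) d => h.
  by apply: (is_derive_eq h); rewrite mulrC.
- have := is_derive1_comp (f := sin) (is_derive_sin (k%:R * pi * x)) d => h.
  by apply: (is_derive_eq h); rewrite mulrC.
Qed.

Lemma derive1_tpoly_cos n a :
  derive1 (tpoly true n a) = tpoly false n (fun k => - (k%:R * pi * a k)).
Proof.
apply/funext => x.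
have h : is_derive x 1 (\sum_(k < n) (a k *: trig true k))
    (\sum_(k < n) (a k *: (k%:R * pi * - trig false k x))).
  exact: (is_derive_sum (fun k : 'I_n => is_deriveZ (a k) (is_derive_trig true k x))).
have -> : tpoly true n a = \sum_(k < n) (a k *: trig true k).
  by apply/funext => y; rewrite /tpoly fct_sumE.
rewrite derive1E; case: h => _ ->; apply: eq_bigr => k _.
by rewrite /GRing.scale /=; ring.
Qed.

Lemma trig_mul b k l (x : R) : trig b k x * trig b l x =
  2^-1 * cos ((k%:R - l%:R) * pi * x) + parity b / 2 * cos ((k%:R + l%:R) * pi * x).
Proof.
have -> : cos ((k%:R - l%:R) * pi * x) =
    trig true k x * trig true l x + trig false k x * trig false l x :> R.
  by rewrite /trig !mulrBl cosB.
have -> : cos ((k%:R + l%:R) * pi * x) =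
    trig true k x * trig true l x - trig false k x * trig false l x :> R.
  by rewrite /trig !mulrDl cosD.
by rewrite /parity; case: b; field.
Qed.

Lemma Rintegral_trig_mul b k l :
  \int[mu]_(x in `[0, 1]) (trig b k x * trig b l x) =
  if k == l then (if k == 0%N then (1 + parity b) / 2 else 2^-1) else 0.
Proof.
have ic (w : R) : mu.-integrable `[0, 1] (EFin \o (fun y => cos (w * pi * y))).
  apply: integrable_continuous01; apply: continuous_subspaceT => x.
  by apply: continuous_comp; [apply: cvgMr; exact: cvg_id|exact: continuous_cos].
under eq_Rintegral do rewrite trig_mul.
rewrite (Rintegral_lin2 _ _ (ic _) (ic _)).2.
have := @Rintegral_cos_int R k l (-1) (or_intror erefl); rewrite mulN1r => ->.
have := @Rintegral_cos_int R k l 1 (or_introl erefl); rewrite mul1r => ->.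
rewrite subr_eq0 eqr_nat -natrD pnatr_eq0 addn_eq0.
have [->|kl] := eqVneq k l; first by rewrite andbb; case: eqP => _; field.
have -> : (k == 0%N) && (l == 0%N) = false.
  by apply/negP => /andP[/eqP k0 /eqP l0]; rewrite k0 l0 eqxx in kl.
by rewrite !mulr0 addr0.
Qed.

Lemma tpoly_mul b n a c (x : R) :
  tpoly b n a x * tpoly b n c x = \sum_(k < n) \sum_(l < n) a k * c l * (trig b k x * trig b l x).
Proof.
rewrite mulr_suml; apply: eq_bigr => k _; rewrite mulr_sumr; apply: eq_bigr => l _; ring.
Qed.

Lemma integrable_trig_mul b k l (t : R) :
  mu.-integrable `[0, 1] (EFin \o (fun x => t * (trig b k x * trig b l x))).
Proof.
apply: integrable_continuous01; apply: continuous_subspaceT => x.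
by apply: cvgMr; apply: cvgM; exact: continuous_trig.
Qed.

Lemma Rintegral_tpoly_mul b n a c :
  \int[mu]_(x in `[0, 1]) (tpoly b n a x * tpoly b n c x) =
  \sum_(k < n) a k * c k * (if k == 0%N :> nat then (1 + parity b) / 2 else 2^-1).
Proof.
under eq_Rintegral do rewrite tpoly_mul.
rewrite Rintegral_sum //; last first.
  by move=> k; apply: integrable_bigsum => // l; exact: integrable_trig_mul.
apply: eq_bigr => k _; rewrite Rintegral_sum //; last by move=> l; exact: integrable_trig_mul.
rewrite (bigD1 k) //= big1 ?addr0.
  by rewrite RintegralZl ?Rintegral_trig_mul ?eqxx //; have := integrable_trig_mul b k k 1;
    apply: eq_integrable => // x _; rewrite /= mul1r.
move=> l lk; rewrite RintegralZl ?Rintegral_trig_mul //; last first.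
  by have := integrable_trig_mul b k l 1; apply: eq_integrable => // x _; rewrite /= mul1r.
by rewrite eq_sym (inj_eq val_inj) (negbTE lk) mulr0.
Qed.

Lemma Rintegral_cos_series n a : (0 < n)%N ->
  \int[mu]_(x in `[0, 1]) cos_series n a x = a 0%N.
Proof.
move=> n0.
transitivity (\int[mu]_(x in `[0, 1])
   (tpoly true n (fun k => a k * phi_scale k) x * tpoly true n (fun k => (k == 0%N)%:R) x)).
  apply: eq_Rintegral => x _; rewrite cos_seriesE [X in _ = _ * X](_ : _ = 1) ?mulr1 //.
  rewrite /tpoly (bigD1 (Ordinal n0)) //= big1 ?addr0 ?mul1r ?/trig ?mul0r ?cos0 //.
  by move=> [[|k] kn] //= _; rewrite mul0r.
rewrite Rintegral_tpoly_mul (bigD1 (Ordinal n0)) //= big1 ?addr0.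
  by rewrite /phi_scale /parity /=; field.
by move=> [[|k] kn] //= _; rewrite mulr0 mul0r.
Qed.

Definition eigen (alpha gamma : R) (k : nat) : R :=
  if k == 0%N then 1
  else if alpha < 1 then
    (gamma ^+ 2)^-1 * ((1 - alpha) * pi ^+ 3 * hs_energy (2 * alpha + 1) k)
  else (gamma ^+ 2)^-1 * ((k%:R * pi) ^+ 2 +
    (alpha - 1) * (2 - alpha) * pi ^+ 3 * (k%:R * pi) ^+ 2 * hs_energy (2 * alpha - 1) k).

Lemma sob_form_diag alpha gamma n a c : (0 < n)%N -> 2^-1 < alpha < 2 -> alpha != 1 ->
  sob_form alpha gamma (cos_series n a) (cos_series n c) =
  \sum_(k < n) eigen alpha gamma k * (a k * c k).
Proof.
move=> n0 /andP[a1 a2] an.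
rewrite /sob_form !Rintegral_cos_series // (bigD1 (Ordinal n0)) //= /eigen mul1r.
congr (_ + _); rewrite /unit_itv; case: ifP => al.
  have s3 : 2 * alpha + 1 < 3 by lra.
  (* The factor 4 of [frac_form_diag] and [phi_scale k ^+ 2 = 2] together cancel the 8 in the
     definition of the form. *)
  rewrite [X in _ * X = _](_ : _ = \sum_(k < n) 8 * (a k * c k) * hs_energy (2 * alpha + 1) k).
    rewrite (bigD1 (Ordinal n0)) //= hs_energy0 mulr0 add0r mulr_sumr.
    apply: eq_bigr => -[[|k] kn] //= _.
    by set p := pi; set h := hs_energy _ _; set g := (gamma ^+ 2)^-1; field.
  have := frac_form_diag true n (fun k => a k * phi_scale k) (fun k => c k * phi_scale k) s3.
  rewrite -!cos_seriesE /= => h.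
  transitivity (4 * \sum_(k < n) a k * phi_scale k * (c k * phi_scale k) * hs_energy (2 * alpha + 1) k).
    rewrite -h; apply: eq_Rintegral => y _; apply: eq_Rintegral => x _.
    by rewrite /frac_kernel_low /parity !mul1r mulrDr.
  rewrite mulr_sumr; apply: eq_bigr => k _.
  have -> : 4 * (a k * phi_scale k * (c k * phi_scale k) * hs_energy (2 * alpha + 1) k) =
     4 * (a k * c k) * (phi_scale k ^+ 2) * hs_energy (2 * alpha + 1) k by ring.
  rewrite phi_scale_sqr; case: eqP => [->|_]; first by rewrite hs_energy0 !mulr0.
  by ring.
have s3 : 2 * alpha - 1 < 3 by lra.
rewrite /frac_form_high !cos_seriesE !derive1_tpoly_cos.
have h := frac_form_diag false n (fun k => - (k%:R * pi * (a k * phi_scale k)))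
   (fun k => - (k%:R * pi * (c k * phi_scale k))) s3.
rewrite Rintegral_tpoly_mul [X in _ + _ * X](_ : _ =
  \int[mu]_(y in `[0, 1]) \int[mu]_(x in `[0, 1])
    ((tpoly false n (fun k => - (k%:R * pi * (a k * phi_scale k))) x -
      tpoly false n (fun k => - (k%:R * pi * (a k * phi_scale k))) y) *
     (tpoly false n (fun k => - (k%:R * pi * (c k * phi_scale k))) x -
      tpoly false n (fun k => - (k%:R * pi * (c k * phi_scale k))) y) * sin_kernel (2 * alpha - 1) (x - y) +
     (tpoly false n (fun k => - (k%:R * pi * (a k * phi_scale k))) x - parity false *
      tpoly false n (fun k => - (k%:R * pi * (a k * phi_scale k))) y) *
     (tpoly false n (fun k => - (k%:R * pi * (c k * phi_scale k))) x - parity false *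
      tpoly false n (fun k => - (k%:R * pi * (c k * phi_scale k))) y) * sin_kernel (2 * alpha - 1) (x + y))); last first.
  apply: eq_Rintegral => y _; apply: eq_Rintegral => x _.
  by rewrite /frac_kernel_high /parity !mulN1r !opprK.
have lin (g C : R) (u w : 'I_n -> R) : g * (\sum_k u k + C * (4 * \sum_k w k)) =
    \sum_k (g * (u k + C * (4 * w k))).
  by rewrite !mulr_sumr -big_split mulr_sumr.
rewrite h lin (bigD1 (Ordinal n0)) //= !mul0r !oppr0 !mul0r !mulr0 addr0 mulr0 add0r.
apply: eq_bigr => -[[|k] kn] // _; rewrite /phi_scale /=.
have := phi_scale_sqr k.+1; rewrite /phi_scale /= => w2.
set w := Num.sqrt 2 in w2 *; set p := pi; set E := hs_energy _ _; set g := (gamma ^+ 2)^-1.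
have -> : - (k.+1%:R * p * (a k.+1 * w)) * - (k.+1%:R * p * (c k.+1 * w)) = (k.+1%:R * p) ^+ 2 * (a k.+1 * c k.+1) * w ^+ 2 by ring.
by rewrite w2; field.
Qed.

(** Positivity makes the power in [Gamma_wt] a genuine inverse square root. *)
Lemma kappa_gt0 alpha : 2^-1 < alpha < 2 -> 0 < kappa alpha.
Proof.
move=> /andP[a1 a2]; have P := pi_gt0 R; rewrite /kappa; case: ifP => al.
  have h : 0 < base_integral (2 * alpha + 1) by apply: base_integral_gt0; lra.
  by rewrite /c_low !mulr_gt0 ?powR_gt0 //; lra.
case: eqP => an; first by rewrite exprn_gt0.
have h : 0 < base_integral (2 * alpha - 1) by apply: base_integral_gt0; lra.
have a1' : 1 < alpha by rewrite lt_neqAle leNgt al andbT eq_sym; apply/eqP.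
by rewrite /c_high !mulr_gt0 ?powR_gt0 //; lra.
Qed.

Lemma Gamma_wt_gt0 d alpha (gamma : 'I_d -> R) j : 2^-1 < alpha < 2 ->
  0 < gamma j -> 0 < Gamma_wt alpha gamma j.
Proof. by move=> ha g0; rewrite mulr_gt0 // powR_gt0 // kappa_gt0. Qed.

Lemma r_wt_sqr alpha gamma k : 2^-1 < alpha < 2 -> (0 < k)%N ->
  r_wt alpha (kappa alpha `^ (- 2^-1) * gamma) k ^+ 2 =
  (gamma ^+ 2)^-1 * (kappa alpha * k%:R `^ (2 * alpha)).
Proof.
move=> ha k0; have K := kappa_gt0 ha.
have e1 : (kappa alpha `^ (- 2^-1)) ^+ 2 = (kappa alpha)^-1.
  rewrite -powR_mulrn ?powR_ge0 // -powRrM (_ : - 2^-1 * 2%:R = -1); last by field.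
  by rewrite powR_inv1 // ltW.
have e2 : (k%:R `^ alpha) ^+ 2 = k%:R `^ (2 * alpha) :> R.
  by rewrite -powR_mulrn ?powR_ge0 // -powRrM [alpha * _]mulrC.
by rewrite /r_wt gtn_eqF // exprMn exprVn exprMn e1 e2 invfM invrK; ring.
Qed.

(** The constants agree exactly with [hs_energy_ge]: [pi ^ 3 pi ^ (- (2 alpha + 1))] is the power in
    [c_low], and [pi ^ 5 pi ^ (- (2 alpha - 1))] the one in [c_high]. For [alpha > 1] the
    contribution [(k pi) ^ 2] of the plain derivative term is discarded. *)
Lemma r_wt_sqr_le_eigen alpha gamma k : 2^-1 < alpha < 2 -> alpha != 1 ->
  r_wt alpha (kappa alpha `^ (- 2^-1) * gamma) k ^+ 2 <= eigen alpha gamma k.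
Proof.
move=> ha an; have /andP[a1 a2] := ha; have P := pi_gt0 R.
have [->|k0] := posnP k; first by rewrite /r_wt /eigen /= expr1n.
rewrite r_wt_sqr // /eigen gtn_eqF //.
have kR : 0 < k%:R :> R by rewrite ltr0n.
rewrite /kappa; case: ifP => al.
  rewrite ler_wpM2l ?invr_ge0 ?sqr_ge0 //.
  have s0 : 0 <= 2 * alpha + 1 by lra.
  have s3 : 2 * alpha + 1 < 3 by lra.
  have h := hs_energy_ge s0 s3 k0.
  have c0 : 0 <= (1 - alpha) * pi ^+ 3 by rewrite mulr_ge0 ?exprn_ge0 ?ltW //; lra.
  apply: le_trans (ler_wpM2l c0 h); rewrite /c_low -/(base_integral _).
  have -> : 2 * alpha + 1 - 1 = 2 * alpha by ring.
  have -> : pi `^ (2 - 2 * alpha) = pi ^+ 3 * pi `^ (- (2 * alpha + 1)) :> R.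
    by rewrite -powR_mulrn ?(ltW P) // -powRD ?(gt_eqF P) ?implybT //; congr (_ `^ _); ring.
  by rewrite le_eqVlt; apply/orP; left; apply/eqP; set p := pi; ring.
rewrite (negbTE an) ler_wpM2l ?invr_ge0 ?sqr_ge0 //.
have a1' : 1 < alpha by rewrite lt_neqAle leNgt al andbT eq_sym.
have s0 : 0 <= 2 * alpha - 1 by lra.
have s3 : 2 * alpha - 1 < 3 by lra.
have h := hs_energy_ge s0 s3 k0.
have c0 : 0 <= (alpha - 1) * (2 - alpha) * pi ^+ 3 * (k%:R * pi) ^+ 2.
  by rewrite !mulr_ge0 ?exprn_ge0 ?ltW ?mulr_ge0 //; lra.
apply: (@le_trans _ _ ((alpha - 1) * (2 - alpha) * pi ^+ 3 * (k%:R * pi) ^+ 2 * hs_energy (2 * alpha - 1) k)); last first.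
  by rewrite lerDr sqr_ge0.
apply: le_trans (ler_wpM2l c0 h); rewrite /c_high -/(base_integral _).
have -> : pi `^ (6 - 2 * alpha) = pi ^+ 5 * pi `^ (- (2 * alpha - 1)) :> R.
  by rewrite -powR_mulrn ?(ltW P) // -powRD ?(gt_eqF P) ?implybT //; congr (_ `^ _); ring.
have -> : k%:R `^ (2 * alpha) = k%:R ^+ 2 * k%:R `^ (2 * alpha - 1 - 1) :> R.
  by rewrite -powR_mulrn ?(ltW kR) // -powRD ?(gt_eqF kR) ?implybT //; congr (_ `^ _); ring.
by rewrite le_eqVlt; apply/orP; left; apply/eqP; set p := pi; ring.
Qed.

End Diagonal.

(** * Integration by parts for weak derivatives against sines *)

Section WeakDerivative.
Context {R : realType}.
Local Notation mu := (@lebesgue_measure R).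

Lemma Rintegral_dominated_cvg d (T : measurableType d) (m : {measure set T -> \bar R})
    (D : set T) (F : nat -> T -> R) (f g : T -> R) : measurable D ->
  (forall n, measurable_fun D (F n)) -> measurable_fun D f ->
  (forall x, D x -> F n x @[n --> \oo] --> f x) ->
  m.-integrable D (EFin \o g) -> (forall n x, D x -> `|F n x| <= g x) ->
  \int[m]_(x in D) F n x @[n --> \oo] --> \int[m]_(x in D) f x.
Proof.
move=> mD mF mf cF ig bF.
have [|||||iF _ cv] := @dominated_convergence _ _ _ m D mD (fun n => EFin \o F n)
    (EFin \o f) (EFin \o g).
- by move=> n; exact/measurable_EFinP.
- exact/measurable_EFinP.
- by apply: aeW => x Dx; apply: cvg_EFin; [exact: nearW|exact: cF].
- exact: ig.
- by apply: aeW => x n Dx; rewrite lee_fin; exact: bF.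
have : fine (\int[m]_(x in D) (F n x)%:E) @[n --> \oo] --> fine (\int[m]_(x in D) (f x)%:E).
  apply: fine_cvg; rewrite fineK //; exact: integrable_fin_num.
by [].
Qed.

Lemma cvg_dist_le (u r : nat -> R) (l : R) :
  (forall n, `|u n - l| <= r n) -> r n @[n --> \oo] --> (0 : R) -> u n @[n --> \oo] --> l.
Proof.
move=> ur /cvgrPdist_le r0; apply/cvgrPdist_le => e e0.
near=> n; rewrite distrC (le_trans (ur n)) // (le_trans (ler_norm _)) //.
by rewrite -normrN -[- r n]sub0r; near: n; exact: r0.
Unshelve. all: by end_near. Qed.

Lemma continuous_itv_bounded (f : R -> R) : {within `[0, 1], continuous f} ->
  exists2 M : R, 0 <= M & forall x, 0 <= x <= 1 -> `|f x| <= M.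
Proof.
move=> cf; have [c _ hc] := EVT_max ler01 cf; have [c' _ hc'] := EVT_min ler01 cf.
exists (`|f c| + `|f c'|) => [|x x01]; first by rewrite addr_ge0.
have := hc x; have := hc' x; rewrite in_itv /= x01 => /(_ isT) h1 /(_ isT) h2.
have := ler_norm (f c); have := ler_norm (- f c'); rewrite normrN => h3 h4.
have := normr_ge0 (f c); have := normr_ge0 (f c'); rewrite ler_norml; lra.
Qed.

Lemma measurable_fun_within01 (f : R -> R) : {within `[0, 1], continuous f} ->
  measurable_fun (`[0, 1]%classic : set R) f.
Proof. by move=> cf; apply: subspace_continuous_measurable_fun => //; exact: measurable_itv. Qed.

Lemma integrable_L2 (w : R -> R) : measurable_fun (`[0, 1]%classic : set R) w ->
  mu.-integrable `[0, 1] (fun x => (w x ^+ 2)%:E) -> mu.-integrable `[0, 1] (EFin \o w).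
Proof.
move=> mw w2.
have i1 : mu.-integrable `[0, 1] (EFin \o (fun=> 1 : R)).
  by apply: integrable_continuous01; apply: continuous_subspaceT => x; exact: cvg_cst.
apply: (@le_integrable _ _ _ mu _ _ _ (EFin \o (fun x => 1 + w x ^+ 2))) => //.
- exact/measurable_EFinP.
- move=> x _; rewrite /= lee_fin [X in _ <= X]ger0_norm ?addr_ge0 ?sqr_ge0 //.
  have := real_normK (num_real (w x)); have := normr_ge0 (w x).
  by set a := `|w x|; rewrite !expr2 => a0 <-; nra.
- exact: integrable_add.
Qed.

Lemma integrable_mul_bounded (f g : R -> R) (M : R) :
  measurable_fun (`[0, 1]%classic : set R) g -> (forall x, 0 <= x <= 1 -> `|g x| <= M) ->
  mu.-integrable `[0, 1] (EFin \o f) -> mu.-integrable `[0, 1] (EFin \o (fun x => f x * g x)).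
Proof.
move=> mg gM fi; have mf : measurable_fun (`[0, 1]%classic : set R) f.
  by apply/measurable_EFinP; exact: (measurable_int mu fi).
have fa : mu.-integrable `[0, 1] (EFin \o (fun x => M * f x)) by exact: integrable_scale.
apply: le_integrable fa => //.
  by apply/measurable_EFinP; exact: measurable_funM.
move=> x; rewrite /= in_itv /= => x01; rewrite lee_fin !normrM mulrC ler_wpM2r //.
by rewrite (le_trans (gM x x01)) // ler_norm.
Qed.

Lemma Rintegral_oo01 (f : R -> R) : measurable_fun (`[0, 1]%classic : set R) f ->
  \int[mu]_(x in `[0, 1]) f x = \int[mu]_(x in `]0, 1[) f x.
Proof.
move=> mf; rewrite /Rintegral integral_itv_bndoo //.
apply/measurable_EFinP; apply: measurable_funS mf; first exact: measurable_itv.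
by move=> x; rewrite /= !in_itv /= => /andP[/ltW-> /ltW->].
Qed.

(** A quadratic remainder gives the derivative uniformly in the sign of the increment, in particular
    at 0, where [pos2] changes its formula. *)
Lemma is_derive_quadratic (f : R -> R) (t l : R) :
  (forall h, `|f (t + h) - f t - h * l| <= h ^+ 2) -> is_derive t 1 f l.
Proof.
move=> fh.
have cv : h^-1 *: ((f \o shift t) (h *: 1) - f t) @[h --> 0^'] --> l.
  apply/cvgrPdist_le => e e0; near=> h.
  have h0 : h != 0 by near: h; exact: nbhs_dnbhs_neq.
  have he : `|h| <= e.
    near: h; apply: nbhs_dnbhs; apply/nbhs_ballP; exists e => //= h.
    by rewrite /ball /= sub0r normrN => /ltW.
  rewrite /= /GRing.scale /= mulr1 distrC.
  have -> : h^-1 * (f (h + t) - f t) - l = h^-1 * (f (t + h) - f t - h * l).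
    by rewrite [h + t]addrC; field.
  rewrite normrM normfV ler_pdivrMl ?normr_gt0 //; apply: le_trans (fh h) _.
  by rewrite -(real_normK (num_real h)) expr2 ler_wpM2l.
by apply: DeriveDef; [apply/cvg_ex; exists l|exact: cvg_lim].
Unshelve. all: by end_near. Qed.

Let pos2 (t : R) : R := Num.max 0 t ^+ 2.

Let is_derive_pos2 (t : R) : is_derive t 1 pos2 (2 * Num.max 0 t).
Proof.
apply: is_derive_quadratic => h; rewrite /pos2 ler_norml.
by case: (leP 0 t) => ht; case: (leP 0 (t + h)) => hth; apply/andP; split; nra.
Qed.

(** Equal to 1 where [m x (1 - x) <= 1], hence near both endpoints, and tending to 0 inside. Thus
    [1 - cut m] is a cutoff of class C^1, which turns the sines into admissible test functions. *)
Let cut (m : nat) (x : R) : R := expR (- pos2 (m%:R * (x * (1 - x)) - 1)).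
Let slope (m : nat) (x : R) : R := Num.max 0 (m%:R * (x * (1 - x)) - 1).

Let is_derive_cut m (x : R) :
  is_derive x 1 (cut m) (- (2 * slope m x * (m%:R * (1 - 2 * x)) * cut m x)).
Proof.
pose q (y : R) := m%:R * (y * (1 - y)) - 1.
have d1 : is_derive x 1 q (m%:R * (1 - 2 * x)).
  by apply: is_derive_eq; rewrite /GRing.scale /=; ring.
have d2 := is_derive1_comp (f := pos2) (g := q) (is_derive_pos2 (q x)) d1.
have d3 := is_derive1_comp (f := expR) (g := - (pos2 \o q)) (is_derive_expR _) (is_deriveN d2).
by apply: (is_derive_eq d3); rewrite /cut /slope /q /=; ring.
Qed.

Let test (m k : nat) (x : R) : R := (1 - cut m x) * trig false k x.
Let dtest (m k : nat) (x : R) : R :=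
  2 * slope m x * (m%:R * (1 - 2 * x)) * cut m x * trig false k x +
  (1 - cut m x) * (k%:R * pi * trig true k x).

Let is_derive_test m k (x : R) : is_derive x 1 (test m k) (dtest m k x).
Proof.
have d := is_deriveM (is_deriveB (is_derive_cst (1 : R) x (1 : R)) (is_derive_cut m x)) (is_derive_trig false k x).
apply: (is_derive_eq d); rewrite /dtest /GRing.scale /=.
have -> : (cst 1 - cut m) x = 1 - cut m x by [].
by ring.
Qed.

Let continuous_slope m : continuous (slope m).
Proof.
have -> : slope m = (fun x => (m%:R * (x * (1 - x)) - 1 + `|m%:R * (x * (1 - x)) - 1|) / 2).
  apply/funext => x; rewrite /slope; case: (leP 0 (m%:R * (x * (1 - x)) - 1)) => h.
    by rewrite ger0_norm //; field.
  by rewrite ltr0_norm //; field.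
move=> x; apply: cvgMl; apply: cvgD; last apply: cvg_norm.
all: apply: cvgB; last exact: cvg_cst.
all: apply: cvgMr; apply: cvgM; first exact: cvg_id.
all: by apply: cvgB; [exact: cvg_cst|exact: cvg_id].
Qed.

Let continuous_cut m : continuous (cut m).
Proof.
move=> x; have [d _] := is_derive_cut m x.
by apply: differentiable_continuous; exact/derivable1_diffP.
Qed.

Let continuous_dtest m k : continuous (dtest m k).
Proof.
move=> x; apply: cvgD; last first.
  apply: cvgM; first by apply: cvgB; [exact: cvg_cst|exact: continuous_cut].
  by apply: cvgMr; exact: continuous_trig.
apply: cvgM; last exact: continuous_trig.
apply: cvgM; last exact: continuous_cut.
apply: cvgM; first by apply: cvgMr; exact: continuous_slope.
by apply: cvgMr; apply: cvgB; [exact: cvg_cst|apply: cvgMr; exact: cvg_id].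
Qed.

Let derive1_test m k : derive1 (test m k) = dtest m k.
Proof. by apply/funext => x; rewrite derive1E; case: (is_derive_test m k x). Qed.

Let test_functionP m k : (0 < m)%N -> test_function (test m k).
Proof.
move=> m0; have mR : 0 < m%:R :> R by rewrite ltr0n.
split.
- by move=> x; case: (is_derive_test m k x).
- by rewrite derive1_test; exact: continuous_dtest.
- exists m%:R^-1, (1 - m%:R^-1); rewrite invr_gt0 mR gtrBl invr_gt0 mR; split => // x.
  rewrite in_itv /= => h; rewrite /test /cut /pos2 (_ : Num.max 0 _ = 0).
    by rewrite expr0n /= oppr0 expR0 subrr mul0r.
  apply/max_idPl; rewrite subr_le0 leNgt; apply/negP => h1; move/negP: h; apply.
  have y0 : 0 < x * (1 - x).
    by rewrite -(pmulr_rgt0 _ mR); lra.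
  have x0 : 0 < x by case: (ltP 0 x) => // hx; nra.
  have x1 : x < 1 by case: (ltP x 1) => // hx; nra.
  have i : m%:R * m%:R^-1 = 1 :> R by rewrite divff // gt_eqF.
  have i0 : 0 < m%:R^-1 :> R by rewrite invr_gt0.
  by apply/andP; split; rewrite -(ler_pM2l mR) ?mulrBr i; nra.
Qed.

(** Chosen so that [cut m x <= rho m x ^+ 2]: one factor absorbs the square of the slope produced by
    differentiating the cutoff, the other tends to 0. *)
Let rho (m : nat) (x : R) : R := (1 + slope m x ^+ 2 / 2)^-1.

Let rho_gt0 m x : 0 < rho m x.
Proof. by rewrite invr_gt0 ltr_pwDl // divr_ge0 // sqr_ge0. Qed.

Let rho_le1 m x : rho m x <= 1.
Proof. by rewrite invf_le1 ?ltr_pwDl // ?divr_ge0 ?sqr_ge0 // lerDl divr_ge0 // sqr_ge0. Qed.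

Let cut_le m x : cut m x <= rho m x ^+ 2.
Proof.
rewrite /cut expRN /rho exprVn lef_pV2 ?posrE ?expR_gt0 ?exprn_gt0 //; last first.
  by rewrite ltr_pwDl // divr_ge0 // sqr_ge0.
have -> : expR (pos2 (m%:R * (x * (1 - x)) - 1)) = expR (slope m x ^+ 2 / 2) ^+ 2.
  by rewrite -expRM_natl; congr expR; rewrite /pos2 /slope; field.
by rewrite lerXn2r ?nnegrE ?expR_ge0 ?expR_ge1Dx // addr_ge0 // divr_ge0 // sqr_ge0.
Qed.

Let rho_cvg0 (x : R) : 0 < x < 1 -> rho m x @[m --> \oo] --> (0 : R).
Proof.
move=> /andP[x0 x1]; have y0 : 0 < x * (1 - x) by rewrite mulr_gt0 // subr_gt0.
have g : (fun m : nat => (x * (1 - x))^-1 * 4 * m.+1%:R^-1) @ \oo --> (0 : R).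
  rewrite -[X in _ --> X](mulr0 ((x * (1 - x))^-1 * 4)).
  by apply: cvgMr; exact: cvg_harmonic.
apply: (squeeze_cvgr _ (cvg_cst 0) g).
near=> m.
apply/andP; split; first exact: ltW.
have -> : (x * (1 - x))^-1 * 4 * m.+1%:R^-1 = (x * (1 - x) * 4^-1 * m.+1%:R)^-1.
  by rewrite [RHS]invfM [in RHS]invfM invrK.
have p1 : 0 < x * (1 - x) * 4^-1 * m.+1%:R.
  by apply: mulr_gt0; rewrite ?ltr0n //; apply: mulr_gt0.
have p2 : 0 < 1 + slope m x ^+ 2 / 2 by rewrite ltr_pwDl // divr_ge0 // sqr_ge0.
rewrite /rho lef_pV2 ?posrE // /slope.
set y := x * (1 - x); set s := m%:R * y - 1.
rewrite -[m.+1%:R]natr1; have ms : m%:R * y = s + 1 by rewrite /s subrK.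
have y1 : y <= 1 by rewrite /y; nra.
have : s <= Num.max 0 s by rewrite le_max lexx orbT.
set p := Num.max _ _; move=> sp; rewrite expr2.
have p0 : 0 <= p by rewrite le_max lexx.
have : y * 4^-1 * (m%:R + 1) = (s + 1 + y) / 4 by rewrite -ms; field.
by move=> ->; nra.
Unshelve. all: by end_near. Qed.

(** The derivative of the cutoff grows like [m], but [sin (k pi x)] vanishes at both ends like
    [x (1 - x)]. The product is bounded uniformly in [m] and tends to 0 with [rho]. *)
Let dtest_bound (m k : nat) (x : R) : 0 <= x <= 1 ->
  `|2 * slope m x * (m%:R * (1 - 2 * x)) * cut m x * trig false k x| <= 12 * k%:R * pi * rho m x.
Proof.
move=> /andP[x0 x1]; have P := pi_gt0 R.
have sg : `|trig false k x| <= k%:R * (2 * pi * (x * (1 - x))).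
  rewrite /trig -mulrA (le_trans (ler_norm_sinM _ _)) // ler_wpM2l //.
  have s0 : 0 <= sin (pi * x) by apply: sin_ge0_pi; rewrite mulr_ge0 ?(ltW P) //= ler_piMr // ltW.
  rewrite ger0_norm //.
  have h1 : sin (pi * x) <= pi * x by apply: sin_le_id; rewrite mulr_ge0 // ltW.
  have h2 : sin (pi * x) <= pi * (1 - x).
    have <- : sin (pi * (1 - x)) = sin (pi * x).
      by rewrite mulrBr mulr1 addrC sinDpi sinN opprK.
    by apply: sin_le_id; rewrite mulr_ge0 ?subr_ge0 // ltW.
  case: (leP x (1 / 2)) => hx.
    apply: le_trans h1 _; rewrite -mulrA mulrCA ler_wpM2l ?(ltW P) //; nra.
  apply: le_trans h2 _; rewrite -mulrA mulrCA ler_wpM2l ?(ltW P) //; nra.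
have c := cut_le m x; have c0 : 0 <= cut m x by exact: expR_ge0.
have s0 : 0 <= slope m x by rewrite le_max lexx.
(* Where the slope is positive, [m x (1 - x)] equals [slope m x + 1]. *)
have ss : m%:R * (x * (1 - x)) * slope m x <= slope m x ^+ 2 + slope m x.
  rewrite /slope; case: (leP 0 (m%:R * (x * (1 - x)) - 1)) => h; last by rewrite mulr0 expr0n /= add0r.
  by rewrite expr2; nra.
rewrite !normrM (ger0_norm s0) (ger0_norm c0) !normr_nat.
have h2x : `|1 - 2 * x| <= 1 by rewrite ler_norml; apply/andP; split; lra.
set A := slope m x in s0 ss *; set C := cut m x in c c0 *; set r := rho m x in c *.
have r0 : 0 < r by exact: rho_gt0.
have rA : r * (1 + A ^+ 2 / 2) = 1 by rewrite /r /rho -/A mulVf // gt_eqF // ltr_pwDl // divr_ge0 // sqr_ge0.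
set M : R := m%:R in ss *; have M0 : 0 <= M by rewrite /M.
set k' : R := k%:R in sg *; have k0 : 0 <= k' by rewrite /k'.
set y := x * (1 - x) in sg ss *; have y0 : 0 <= y by rewrite /y mulr_ge0 // subr_ge0.
apply: (@le_trans _ _ (2 * A * (M * 1) * r ^+ 2 * (k' * (2 * pi * y)))).
  apply: ler_pM => //; rewrite ?mulr_ge0 //.
  apply: ler_pM => //; rewrite ?mulr_ge0 //.
  by apply: ler_wpM2l; rewrite ?mulr_ge0 // ler_wpM2l.
have -> : 2 * A * (M * 1) * r ^+ 2 * (k' * (2 * pi * y)) = (4 * k' * pi * r ^+ 2) * (M * y * A).
  by set p := pi; ring.
have kp : 0 <= 4 * k' * pi * r ^+ 2 by rewrite !mulr_ge0 ?sqr_ge0 // ltW.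
apply: le_trans (ler_wpM2l kp ss) _.
have -> : 12 * k' * pi * r = (4 * k' * pi * r ^+ 2) * (3 * (1 + A ^+ 2 / 2)).
  have -> : forall p : R, 4 * k' * p * r ^+ 2 * (3 * (1 + A ^+ 2 / 2)) = 12 * k' * p * r * (r * (1 + A ^+ 2 / 2)) by move=> p; ring.
  by rewrite rA mulr1.
by apply: ler_wpM2l => //; rewrite expr2; nra.
Qed.

(** Sines vanish at 0 and 1 but are not compactly supported in the open interval. The identity is
    tested on their cut-off versions, and the cutoff is removed by dominated convergence. *)
Lemma weak_derivative_by_parts (f w : R -> R) (k : nat) :
  {within `[0, 1], continuous f} -> L2_weak_derivative f w ->
  \int[mu]_(x in `[0, 1]) (f x * (k%:R * pi * trig true k x)) =
  - \int[mu]_(x in `[0, 1]) (w x * trig false k x).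
Proof.
move=> cf [mw w2 fw]; have P := pi_gt0 R.
have [M M0 fM] := continuous_itv_bounded cf.
have mf := measurable_fun_within01 cf.
have iw := integrable_L2 mw w2.
have fi := integrable_continuous01 cf.
have cut0 m x : 0 <= cut m x <= 1.
  rewrite expR_ge0 /= (le_trans (cut_le m x)) // expr2.
  by have := rho_le1 m x; have := rho_gt0 m x; nra.
have mtrig b : measurable_fun (`[0, 1]%classic : set R) (trig b k).
  by apply: measurable_funTS; exact: measurable_trig.
have mtest m : measurable_fun (`[0, 1]%classic : set R) (test m k).
  apply: measurable_funTS; apply: measurable_funM; last exact: measurable_trig.
  by apply: measurable_funB; [exact: measurable_cst|apply: continuous_measurable_fun; exact: continuous_cut].
have mdtest m : measurable_fun (`[0, 1]%classic : set R) (dtest m k).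
  by apply: measurable_funTS; apply: continuous_measurable_fun; exact: continuous_dtest.
have btest m x : `|test m k x| <= 1.
  have /andP[c0 c1] := cut0 m x; rewrite normrM ger0_norm ?subr_ge0 //.
  by have := trig_max false k x; have := normr_ge0 (trig false k x); nra.
have kp : (0 : R) <= k%:R * pi by rewrite mulr_ge0 // ltW.
have tt (x : R) : `|k%:R * pi * trig true k x| <= k%:R * pi.
  by rewrite normrM (ger0_norm kp) ler_piMr // trig_max.
have bd m x : 0 <= x <= 1 -> `|dtest m k x| <= 13 * (k%:R * pi).
  move=> x01; rewrite /dtest (le_trans (ler_normD _ _)) //.
  have /andP[c0 c1] := cut0 m x.
  have h1 := dtest_bound m k x01.
  have h2 : `|(1 - cut m x) * (k%:R * pi * trig true k x)| <= k%:R * pi.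
    rewrite normrM ger0_norm ?subr_ge0 //.
    by have := tt x; have := normr_ge0 (k%:R * pi * trig true k x); nra.
  have h3 : 12 * k%:R * pi * rho m x <= 12 * (k%:R * pi).
    by rewrite -(mulrA 12) ler_piMr ?rho_le1 // mulr_ge0.
  apply: (le_trans (lerD (le_trans h1 h3) h2)).
  by move: (k%:R * pi) => t; lra.
pose F m x := f x * dtest m.+1 k x + w x * test m.+1 k x.
pose G x := f x * (k%:R * pi * trig true k x) + w x * trig false k x.
have mF m : measurable_fun (`[0, 1]%classic : set R) (F m).
  by apply: measurable_funD; apply: measurable_funM.
have mG : measurable_fun (`[0, 1]%classic : set R) G.
  apply: measurable_funD; apply: measurable_funM => //.
  by apply: measurable_funM => //; exact: measurable_cst.
have oo (h : R -> R) : measurable_fun (`[0, 1]%classic : set R) h ->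
    measurable_fun (`]0, 1[%classic : set R) h.
  apply: measurable_funS; first exact: measurable_itv.
  by move=> x; rewrite /= !in_itv /= => /andP[/ltW-> /ltW->].
have iF m : \int[mu]_(x in `[0, 1]) F m x = 0.
  rewrite RintegralD //; last 2 first.
  - by apply: (integrable_mul_bounded (M := 13 * (k%:R * pi))) => // x; exact: bd.
  - by apply: (integrable_mul_bounded (M := 1)).
  have := fw _ (@test_functionP m.+1 k isT); rewrite derive1_test /unit_itv => ->.
  by rewrite addNr.
(* At the endpoints [cut] stays equal to 1, so pointwise convergence is available only on the open
   interval. *)
have cv : \int[mu]_(x in `]0, 1[) F m x @[m --> \oo] --> \int[mu]_(x in `]0, 1[) G x.
  apply: (@Rintegral_dominated_cvg _ _ mu _ F G (fun x => M * (13 * (k%:R * pi)) + `|w x|)).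
  - exact: measurable_itv.
  - by move=> m; exact: oo.
  - exact: oo.
  - move=> x; rewrite /= in_itv /= => x01.
    have x01' : 0 <= x <= 1 by case/andP: x01 => /ltW-> /ltW->.
    apply: (cvg_dist_le (r := fun m => (`|f x| * (13 * (k%:R * pi)) + `|w x|) * rho m.+1 x)); last first.
      rewrite -[X in _ --> X](mulr0 (`|f x| * (13 * (k%:R * pi)) + `|w x|)).
      apply: cvgMr; have := rho_cvg0 x01 => h.
      by rewrite (@cvg_shiftS _ (fun m => rho m x)).
    move=> m; have /andP[c0 c1] := cut0 m.+1 x.
    have h1 : `|2 * slope m.+1 x * (m.+1%:R * (1 - 2 * x)) * cut m.+1 x * trig false k x| <= 12 * (k%:R * pi) * rho m.+1 x.
      by rewrite (mulrA 12); exact: dtest_bound.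
    have cr : cut m.+1 x <= rho m.+1 x.
      by have := cut_le m.+1 x; have := rho_le1 m.+1 x; have := rho_gt0 m.+1 x; rewrite expr2; nra.
    have -> : F m x - G x = f x * (2 * slope m.+1 x * (m.+1%:R * (1 - 2 * x)) * cut m.+1 x * trig false k x
        - cut m.+1 x * (k%:R * pi * trig true k x)) - w x * (cut m.+1 x * trig false k x).
      rewrite /F /G /dtest /test; move: (2 * slope _ _ * _ * _ * _) => A.
      by move: (k%:R * pi * trig true k x) => B; ring.
    rewrite (le_trans (ler_normB _ _)) // [X in _ <= X]mulrDl lerD //.
      rewrite normrM -[X in _ <= X]mulrA; apply: ler_wpM2l => //; apply: (le_trans (ler_normB _ _)).
      have h2 : `|cut m.+1 x * (k%:R * pi * trig true k x)| <= k%:R * pi * rho m.+1 x.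
        by rewrite normrM (ger0_norm c0) mulrC; apply: ler_pM.
      by move: h1 h2; move: (k%:R * pi) => t; lra.
    rewrite normrM ler_wpM2l // normrM (ger0_norm c0) -[X in _ <= X]mulr1.
    by apply: ler_pM => //; exact: trig_max.
  - have ic : mu.-integrable `[0, 1] (EFin \o (fun=> M * (13 * (k%:R * pi)) : R)).
      by apply: integrable_continuous01; apply: continuous_subspaceT => x; exact: cvg_cst.
    have : mu.-integrable `[0, 1] (EFin \o (fun x => M * (13 * (k%:R * pi)) + `|w x|)).
      apply: integrable_add => //; have := iw; apply: le_integrable => //.
        by apply/measurable_EFinP; apply: measurableT_comp.
      by move=> x _; rewrite /= normr_id.
    apply: integrableS => //; try exact: measurable_itv.
    by move=> x; rewrite /= !in_itv /= => /andP[/ltW-> /ltW->].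
  - move=> m x; rewrite /= in_itv /= => x01.
    have x01' : 0 <= x <= 1 by case/andP: x01 => /ltW-> /ltW->.
    rewrite /F (le_trans (ler_normD _ _)) // (normrM (f x)) (normrM (w x)) lerD //; last by rewrite ler_piMr.
    by apply: ler_pM => //; [exact: fM|exact: bd].
move: cv; under eq_fun do rewrite -Rintegral_oo01 // iF.
move=> /(cvg_unique _ (cvg_cst 0)) e0.
have : \int[mu]_(x in `[0, 1]) G x = 0 by rewrite Rintegral_oo01 // -e0.
rewrite RintegralD //.
- by move/eqP; rewrite addr_eq0 => /eqP.
- apply: (integrable_mul_bounded (M := k%:R * pi)) => //.
  by apply: measurable_funM => //; exact: measurable_cst.
- apply: (integrable_mul_bounded (M := 1)) => // x _; exact: trig_max.
Qed.

End WeakDerivative.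

(** * A summability kernel for cosine series *)

Section Bump.
Context {R : realType}.
Local Notation mu := (@lebesgue_measure R).
Implicit Types (x y u : R) (m n k : nat).

(* Powers of [q] are nonnegative cosine polynomials concentrating at 0. As
   summability kernels they give pointwise convergence at continuity points
   while every Fourier coefficient is multiplied by a factor in [-1, 1]. *)
Let q u : R := (1 + cos (pi * u)) / 2.

Let is_tpoly n (f : R -> R) := exists b, f = tpoly true n b.

Let is_tpoly_widen n n' f : (n <= n')%N -> is_tpoly n f -> is_tpoly n' f.
Proof.
move=> nn' [b ->]; exists (fun k => if (k < n)%N then b k else 0).
apply/funext => x; rewrite /tpoly (big_ord_widen n' (fun k => b k * trig true k x)) //.
by rewrite big_mkcond /=; apply: eq_bigr => k _; case: ifP => // _; rewrite mul0r.
Qed.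

Let is_tpolyD n f g : is_tpoly n f -> is_tpoly n g -> is_tpoly n (fun x => f x + g x).
Proof.
move=> [b ->] [c ->]; exists (fun k => b k + c k); apply/funext => x.
by rewrite /tpoly -big_split; apply: eq_bigr => k _; rewrite mulrDl.
Qed.

Let is_tpolyZ n t f : is_tpoly n f -> is_tpoly n (fun x => t * f x).
Proof.
move=> [b ->]; exists (fun k => t * b k); apply/funext => x.
by rewrite /tpoly mulr_sumr; apply: eq_bigr => k _; rewrite mulrA.
Qed.

Let is_tpoly_trig k : is_tpoly k.+1 (trig true k).
Proof.
exists (fun l => (l == k)%:R); apply/funext => x.
rewrite /tpoly (bigD1 ord_max) //= eqxx mul1r big1 ?addr0 // => i ik.
by rewrite (_ : (i == k :> nat) = false) ?mul0r //; apply/negP => /eqP e; case/negP: ik; apply/eqP/val_inj.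
Qed.

Let is_tpoly_mulcos n f : is_tpoly n f -> is_tpoly n.+1 (fun x => f x * cos (pi * x)).
Proof.
move=> [b ->]; rewrite (_ : (fun x => _) = fun x => \sum_(k < n) b k * (trig true k x * cos (pi * x))); last first.
  by apply/funext => x; rewrite mulr_suml; apply: eq_bigr => k _; rewrite mulrA.
suff H j : (j <= n)%N -> is_tpoly n.+1 (fun x => \sum_(k < j) b k * (trig true k x * cos (pi * x))) by exact: H.
elim: j => [_|j IH jn].
  by exists (fun=> 0); apply/funext => x; rewrite big_ord0 /tpoly big1 // => *; rewrite mul0r.
rewrite (_ : (fun x => _) = fun x => \sum_(k < j) b k * (trig true k x * cos (pi * x)) +
  b j * (trig true j x * cos (pi * x))); last by apply/funext => x; rewrite big_ord_recr.
apply: is_tpolyD; first by apply: IH; exact: ltnW.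
apply: is_tpolyZ; case: j jn {IH} => [|j] jn.
  rewrite (_ : (fun x => _) = trig true 1); last by apply/funext => x; rewrite /trig !mul0r cos0 !mul1r.
  by apply: is_tpoly_widen (is_tpoly_trig 1).
rewrite (_ : (fun x => _) = fun x => 2^-1 * (trig true j x + trig true j.+2 x)); last first.
  apply/funext => x; rewrite /trig.
  rewrite (_ : j%:R * pi * x = j.+1%:R * pi * x - pi * x); last by rewrite -natr1; ring.
  rewrite (_ : j.+2%:R * pi * x = j.+1%:R * pi * x + pi * x); last by rewrite -(natr1 j.+1); ring.
  by rewrite cosB cosD; field.
apply: is_tpolyZ; apply: is_tpolyD; last by apply: is_tpoly_widen (is_tpoly_trig j.+2).
by apply: is_tpoly_widen (is_tpoly_trig j); lia.
Qed.

Let is_tpoly_q m : is_tpoly m.+1 (fun u => q u ^+ m).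
Proof.
elim: m => [|m IH].
  exists (fun=> 1); apply/funext => x.
  by rewrite expr0 /tpoly big_ord1 /trig !mul0r cos0 mulr1.
rewrite (_ : (fun u => _) = fun u => 2^-1 * (q u ^+ m + q u ^+ m * cos (pi * u))); last first.
  by apply/funext => u; rewrite exprS /q; field.
apply: is_tpolyZ; apply: is_tpolyD; first exact: is_tpoly_widen IH.
exact: is_tpoly_mulcos.
Qed.

Let bc m : nat -> R := projT1 (cid (is_tpoly_q m)).

Let qE m u : q u ^+ m = \sum_(k < m.+1) bc m k * trig true k u.
Proof. by rewrite /bc; case: cid => b e /=; have := congr1 (@^~ u) e. Qed.

Let q01 u : 0 <= q u <= 1.
Proof. by rewrite /q; have := cos_geN1 (pi * u); have := cos_le1 (pi * u); move=> h1 h2; apply/andP; split; lra. Qed.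

Let qm_ge0 m u : 0 <= q u ^+ m.
Proof. by apply: exprn_ge0; case/andP: (q01 u). Qed.

Let continuous_qm m : continuous (fun u => q u ^+ m).
Proof.
elim: m => [|m IH] u; first by rewrite (_ : (fun _ => _) = cst 1) //; exact: cvg_cst.
rewrite (_ : (fun u => _) = fun u => q u * q u ^+ m); last by apply/funext => x; rewrite exprS.
apply: cvgM; last exact: IH.
apply: cvgMl; apply: cvgD; first exact: cvg_cst.
apply: continuous_comp; last exact: continuous_cos.
by apply: cvgMr; exact: cvg_id.
Qed.

Let int_qm_trig m k : (k <= m)%N ->
  \int[mu]_(x in `[0, 1]) (q x ^+ m * trig true k x) = bc m k * (if k == 0%N then 1 else 2^-1).
Proof.
move=> km.
transitivity (\int[mu]_(x in `[0, 1]) (tpoly true m.+1 (bc m) x * tpoly true m.+1 (fun l => (l == k)%:R) x)).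
  apply: eq_Rintegral => x _; rewrite qE; congr (_ * _).
  rewrite /tpoly (bigD1 (Ordinal (km : (k < m.+1)%N))) //= eqxx mul1r big1 ?addr0 // => i ik.
  by rewrite (_ : (i == k :> nat) = false) ?mul0r //; apply/negP => /eqP e; case/negP: ik; apply/eqP/val_inj.
rewrite Rintegral_tpoly_mul (bigD1 (Ordinal (km : (k < m.+1)%N))) //= eqxx mulr1 big1 ?addr0.
  by rewrite /parity; case: eqP => _; congr (_ * _); field.
move=> i ik; rewrite (_ : (i == k :> nat) = false) ?mulr0 ?mul0r //.
by apply/negP => /eqP e; case/negP: ik; apply/eqP/val_inj.
Qed.

Let integrable_cont (f : R -> R) : continuous f -> mu.-integrable `[0, 1] (EFin \o f).
Proof. by move=> cf; apply: integrable_continuous01; exact: continuous_subspaceT. Qed.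

Let int_qm m : \int[mu]_(x in `[0, 1]) q x ^+ m = bc m 0.
Proof.
rewrite -[RHS]mulr1 -(int_qm_trig (leq0n m)); apply: eq_Rintegral => x _.
by rewrite /trig !mul0r cos0 mulr1.
Qed.

Let bc_le m k : (k <= m)%N -> k != 0%N -> `|bc m k| <= 2 * bc m 0.
Proof.
move=> km k0; have := int_qm_trig km; rewrite (negbTE k0) => e.
have -> : bc m k = 2 * \int[mu]_(x in `[0, 1]) (q x ^+ m * trig true k x) by rewrite e; field.
have ci : continuous (fun x => q x ^+ m * trig true k x).
  by move=> x; apply: cvgM; [exact: continuous_qm|exact: continuous_trig].
rewrite normrM ger0_norm // ler_wpM2l // -int_qm.
apply: (le_trans (le_normr_Rintegral _ (integrable_cont ci))); first exact: measurable_itv.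
apply: le_Rintegral => //.
- by apply: integrable_cont => x; apply: cvg_norm; exact: ci.
- by apply: integrable_cont; exact: continuous_qm.
- by move=> x _; rewrite normrM (ger0_norm (qm_ge0 m x)) ler_piMr // trig_max.
Qed.

Let cos_anti x y : 0 <= x -> x < y -> y <= 1 -> q y < q x.
Proof.
move=> x0 xy y1; have P := pi_gt0 R.
rewrite /q ltr_pM2r ?invr_gt0 // ltrD2l ltr_cos ?in_itv /=.
- by rewrite ltr_pM2l.
- by rewrite mulr_ge0 ?(ltW P) //= ler_piMr ?(ltW P) // (le_trans (ltW xy)).
- by rewrite mulr_ge0 ?(ltW P) ?(le_trans x0 (ltW xy)) //= ler_piMr ?(ltW P).
Qed.

Let qN u : q (- u) = q u.
Proof. by rewrite /q mulrN cosN. Qed.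

(** The mass of [q ^+ m] on [[0, h]] alone, as [q] decreases on [[0, 1]]. *)
Let bc0_ge m h : 0 < h -> h <= 1 -> h * q h ^+ m <= bc m 0.
Proof.
move=> h0 h1; rewrite -int_qm.
have ci := integrable_cont (@continuous_qm m).
rewrite (Rintegral_itv_cat (ltW h0) h1 ci).
have pos : 0 <= \int[mu]_(x in `[h, 1]) q x ^+ m by apply: Rintegral_ge0 => x _.
apply: (@le_trans _ _ (\int[mu]_(x in `[0, h]) q x ^+ m)); last by rewrite lerDl.
have ih : mu.-integrable `[0, h] (EFin \o (fun x => q x ^+ m)).
  apply: integrableS ci => // x; rewrite /= !in_itv /= => /andP[-> xh]; exact: le_trans xh h1.
have -> : h * q h ^+ m = \int[mu]_(x in `[0, h]) (q h ^+ m).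
  have mh : fine (mu `[0, h]%classic) = h.
    by rewrite lebesgue_measure_itv /= lte_fin h0 oppr0 adde0.
  by rewrite Rintegral_cst ?mh 1?mulrC //; exact: measurable_itv.
apply: le_Rintegral => //.
  have : mu.-integrable `[0, 1] (EFin \o (fun=> q h ^+ m)) by apply: integrable_cont => x; exact: cvg_cst.
  apply: integrableS => // x; rewrite /= !in_itv /= => /andP[-> xh]; exact: le_trans xh h1.
move=> x; rewrite /= in_itv /= => /andP[x0 xh].
rewrite lerXn2r ?nnegrE //; try by case/andP: (q01 x); case/andP: (q01 h).
by move: xh; rewrite le_eqVlt => /predU1P[->//|xh]; apply/ltW/cos_anti.
Qed.

Let bc0_gt0 m : 0 < bc m 0.
Proof.
have h2 : 0 < 2^-1 :> R by rewrite invr_gt0.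
have h21 : 2^-1 <= 1 :> R by rewrite invf_le1 // ler1n.
apply: (lt_le_trans _ (bc0_ge m h2 h21)).
rewrite mulr_gt0 ?invr_gt0 // exprn_gt0 //.
have h : q 1 < q 2^-1 by apply: cos_anti => //; rewrite invf_lt1 // ltr1n.
by apply: le_lt_trans h; case/andP: (q01 1).
Qed.

Definition fcoef (f : R -> R) k : R := \int[mu]_(x in `[0, 1]) (f x * phi k x).

(** The cosine coefficient of [q ^+ m] divided by its mass; the 2 is there because
    [cos (k pi x) ^ 2] has mean 1/2 for [k > 0]. *)
Let theta m k : R := if k == 0%N then 1 else if (k <= m)%N then bc m k / (2 * bc m 0) else 0.

Let theta_le1 m k : `|theta m k| <= 1.
Proof.
rewrite /theta; case: eqP => [_|/eqP k0]; first by rewrite normr1.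
case: ifP => km; last by rewrite normr0.
have h : 0 < 2 * bc m 0 by rewrite mulr_gt0.
by rewrite normrM normfV (gtr0_norm h) ler_pdivrMr // mul1r bc_le.
Qed.

(** Adding the reflected kernel cancels the sine products of the addition formula, so the kernel
    becomes diagonal in the [phi k]. *)
Let W m y x : R := q (x - y) ^+ m + q (x + y) ^+ m.

Let WE m y x : W m y x = 2 * bc m 0 * \sum_(k < m.+1) theta m k * phi k x * phi k y.
Proof.
rewrite /W !qE -big_split mulr_sumr /=; apply: eq_bigr => -[[|k] km] _ /=.
  rewrite /theta /phi /trig /= !mul0r cos0; ring.
rewrite -mulrDr (mulrBr (k.+1%:R * pi)) (mulrDr (k.+1%:R * pi)) cosB cosD /theta /= -ltnS km.
rewrite !phiE /phi_scale /= /trig.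
have s2 : Num.sqrt 2 * Num.sqrt 2 = 2 :> R by rewrite -expr2 sqr_sqrtr.
set w := Num.sqrt 2 in s2 *; set A := cos _; set B := cos _; set S := sin _; set S' := sin _.
transitivity (bc m k.+1 * (w * w) * A * B); first by rewrite s2; ring.
by field; exact: lt0r_neq0.
Qed.

Let continuous_W m y : continuous (W m y).
Proof.
move=> x; apply: cvgD.
  apply: (@continuous_comp _ _ _ (fun x : R => x - y) (fun u => q u ^+ m)); last exact: continuous_qm.
  by apply: cvgB; [exact: cvg_id|exact: cvg_cst].
apply: (@continuous_comp _ _ _ (fun x : R => x + y) (fun u => q u ^+ m)); last exact: continuous_qm.
by apply: cvgD; [exact: cvg_id|exact: cvg_cst].
Qed.

Let continuous_phi k : continuous (phi k : R -> R).
Proof.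
move=> x; rewrite (_ : phi k = fun x => phi_scale k * trig true k x); last by apply/funext => z; rewrite phiE.
by apply: cvgMr; exact: continuous_trig.
Qed.

Let int_W m y (f : R -> R) : {within `[0, 1], continuous f} ->
  \int[mu]_(x in `[0, 1]) (f x * W m y x) =
  2 * bc m 0 * cos_series m.+1 (fun k => theta m k * fcoef f k) y.
Proof.
move=> cf.
have ip k : mu.-integrable `[0, 1] (EFin \o (fun x => f x * phi k x)).
  by apply: integrable_continuous01 => x; apply: cvgM; [exact: cf|apply: continuous_subspaceT; exact: continuous_phi].
transitivity (\int[mu]_(x in `[0, 1]) (\sum_(k < m.+1) 2 * bc m 0 * theta m k * phi k y * (f x * phi k x))).
  apply: eq_Rintegral => x _; rewrite WE mulrCA !mulr_sumr; apply: eq_bigr => k _; ring.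
rewrite Rintegral_sum //; last by move=> k; exact: integrable_scale.
rewrite /cos_series mulr_sumr; apply: eq_bigr => k _.
by rewrite RintegralZl // -/(fcoef f k); ring.
Qed.

Let fcoef1 k : fcoef (fun=> 1) k = (k == 0%N)%:R.
Proof.
transitivity (\int[mu]_(x in `[0, 1]) cos_series k.+1 (fun l => (l == k)%:R) x).
  apply: eq_Rintegral => x _; rewrite /cos_series (bigD1 ord_max) //= eqxx mul1r big1 ?addr0 // => i ik.
  by rewrite (_ : (i == k :> nat) = false) ?mul0r //; apply/negP => /eqP e; case/negP: ik; apply/eqP/val_inj.
by rewrite Rintegral_cos_series // eq_sym.
Qed.

Let int_W1 m y : \int[mu]_(x in `[0, 1]) W m y x = 2 * bc m 0.
Proof.
transitivity (\int[mu]_(x in `[0, 1]) ((fun=> 1) x * W m y x)).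
  by apply: eq_Rintegral => x _; rewrite mul1r.
rewrite int_W; last by apply: continuous_subspaceT => x; exact: cvg_cst.
rewrite /cos_series big_ord_recl big1 ?addr0 => [|k _]; rewrite fcoef1 /=.
  by rewrite /theta /phi /= !mulr1.
by rewrite mulr0 mul0r.
Qed.

Let W_ge0 m y x : 0 <= W m y x.
Proof. by rewrite addr_ge0. Qed.

(** The reflected term is dominated by the direct one: [cos (pi (x + y)) <= cos (pi (x - y))]
    because both sines are nonnegative on [[0, 1]]. *)
Let W_far m y x h : 0 < h -> h <= `|x - y| -> 0 <= x <= 1 -> 0 <= y <= 1 -> W m y x <= 2 * q h ^+ m.
Proof.
move=> h0 hx /andP[x0 x1] /andP[y0 y1].
have P := pi_gt0 R.
have d1 : `|x - y| <= 1 by rewrite ler_norml; apply/andP; split; lra.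
have e1 : q (x - y) = q `|x - y|.
  by have [s|s] := leP 0 (x - y); [rewrite ger0_norm|rewrite ltr0_norm // qN].
have q1 : q (x - y) <= q h.
  rewrite e1; move: hx; rewrite le_eqVlt => /predU1P[->//|hx].
  by apply/ltW/cos_anti => //; exact: ltW.
have q2 : q (x + y) <= q (x - y).
  rewrite /q ler_pM2r ?invr_gt0 // lerD2l mulrDr mulrBr cosD cosB.
  have s1 : 0 <= sin (pi * x) by apply: sin_ge0_pi; rewrite mulr_ge0 ?(ltW P) //= ler_piMr // ltW.
  have s2 : 0 <= sin (pi * y) by apply: sin_ge0_pi; rewrite mulr_ge0 ?(ltW P) //= ler_piMr // ltW.
  by nra.
have /andP[a0 _] := q01 (x - y); have /andP[b0 _] := q01 (x + y); have /andP[c0 _] := q01 h.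
rewrite mulr_natl mulr2n lerD // lerXn2r ?nnegrE //.
exact: le_trans q1.
Qed.

Lemma bump_approx : exists t : nat -> nat -> R,
  [/\ forall m k, `|t m k| <= 1, forall m, t m 0%N = 1 &
   forall f : R -> R, {within `[0, 1], continuous f} -> forall y, 0 <= y <= 1 ->
    cos_series m.+1 (fun k => t m k * fcoef f k) y @[m --> \oo] --> f y].
Proof.
exists theta; split => // f cf y y01.
have [M M0 fM] := continuous_itv_bounded cf.
apply/cvgrPdist_le => e e0.
have [h [h0 h1 fh]] : exists h, [/\ 0 < h, h <= 1 & forall x, 0 <= x <= 1 -> `|x - y| < h -> `|f x - f y| <= e / 2].
  have e20 : 0 < e / 2 by rewrite divr_gt0.
  have Iy : `[0, 1]%classic y by rewrite /= in_itv.
  have /subspace_continuousP /(_ y Iy) /cvgrPdist_le /(_ _ e20) := cf.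
  move=> /nbhs_ballP[h /= h0 fh].
  exists (Num.min h 1); rewrite lt_min h0 ltr01 ge_min lexx orbT; split => // x x01 xy.
  rewrite distrC; apply: fh; last by rewrite /= in_itv.
  by rewrite /ball /= distrC (lt_le_trans xy) // ge_min lexx.
have h20 : 0 < h / 2 by rewrite divr_gt0.
have h21 : h / 2 <= 1 by lra.
(* At distance [h] from [y] the kernel is at most [2 q(h)^m], while its total mass [2 bc m 0] is at
   least [h q(h/2)^m]; the ratio decays geometrically. *)
pose r := q h / q (h / 2).
have qh : q h < q (h / 2) by apply: cos_anti; lra.
have /andP[qh0 _] := q01 h.
have q20 : 0 < q (h / 2) by exact: le_lt_trans qh.
have r01 : `|r| < 1 by rewrite ger0_norm ?divr_ge0 ?(ltW q20) // ltr_pdivrMr // mul1r.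
have main m : `|f y - cos_series m.+1 (fun k => theta m k * fcoef f k) y| <= e / 2 + 4 * M / h * r ^+ m.
  have b0 : 0 < 2 * bc m 0 by rewrite mulr_gt0.
  rewrite distrC -(ler_pM2l b0) -{1}(gtr0_norm b0) -normrM mulrBr -int_W // -{1}(int_W1 m y).
  have iW := integrable_cont (@continuous_W m y).
  have iyW : mu.-integrable `[0, 1] (EFin \o (fun x => f y * W m y x)) by exact: integrable_scale.
  have ifW : mu.-integrable `[0, 1] (EFin \o (fun x => f x * W m y x)).
    by apply: integrable_continuous01 => x; apply: cvgM; [exact: cf|apply: continuous_subspaceT; exact: continuous_W].
  rewrite [X in _ - X]mulrC -RintegralZl // -RintegralB //.
  have idW : mu.-integrable `[0, 1] (EFin \o (fun x => f x * W m y x - f y * W m y x)).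
    rewrite (_ : (fun x => _) = fun x => f x * W m y x + (-1) * (f y * W m y x)).
      by apply: integrable_add => //; exact: integrable_scale.
    by apply/funext => x; rewrite mulN1r.
  have ic : mu.-integrable `[0, 1] (EFin \o (fun x => 1 : R)) by apply: integrable_cont => x; exact: cvg_cst.
  have L := Rintegral_lin2 (e / 2) (4 * M * q h ^+ m) iW ic.
  have le1 : \int[mu]_(x in `[0, 1]) `|f x * W m y x - f y * W m y x| <=
    \int[mu]_(x in `[0, 1]) (e / 2 * W m y x + 4 * M * q h ^+ m * 1).
    apply: le_Rintegral => //.
    - have := idW; apply: le_integrable => //.
        apply/measurable_EFinP; apply: measurableT_comp => //.
        by apply/measurable_EFinP; exact: (measurable_int mu idW).
      by move=> x _; rewrite /= normr_id.
    - exact: L.1.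
    - move=> x; rewrite /= in_itv /= => x01.
      rewrite -mulrBl normrM (ger0_norm (W_ge0 m y x)) mulr1.
      have p0 : 0 <= 4 * M * q h ^+ m by rewrite !mulr_ge0.
      have [xy|xy] := ltP `|x - y| h.
        rewrite -[X in X <= _]addr0 lerD // ler_wpM2r // fh //.
      have p1 : 0 <= e / 2 * W m y x by rewrite mulr_ge0 // divr_ge0 // ltW.
      rewrite -[X in X <= _]add0r lerD //.
      rewrite (_ : 4 * M * q h ^+ m = (2 * M) * (2 * q h ^+ m)); last by ring.
      apply: ler_pM => //; last exact: W_far.
      rewrite (le_trans (ler_normB _ _)) // mulr_natl mulr2n lerD // fM //.
  apply: (le_trans (le_normr_Rintegral _ idW)) => //; apply: (le_trans le1).
  rewrite L.2 int_W1 Rintegral_cst ?mul1r ?lebesgue_measure_unit //.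
  rewrite mulr1 [X in _ <= X]mulrDr [X in X + _]mulrC lerD //.
  have bg := bc0_ge m h20 h21.
  have -> : 4 * M * q h ^+ m = 2 * (h / 2 * q (h / 2) ^+ m) * (4 * M / h * r ^+ m).
    have a0 : q (h / 2) ^+ m != 0 by rewrite expf_neq0 // gt_eqF.
    have -> : r ^+ m = q h ^+ m / q (h / 2) ^+ m by rewrite /r exprMn exprVn.
    move: a0; move: (q (h / 2) ^+ m) (q h ^+ m) => a b a0.
    by field; rewrite a0 (gt_eqF h0).
  apply: ler_wpM2r; last by rewrite ler_wpM2l.
  rewrite !mulr_ge0 ?invr_ge0 ?(ltW h0) //.
  by rewrite exprn_ge0 // divr_ge0 // ltW.
have K : 4 * M / h * r ^+ m @[m --> \oo] --> (0 : R).
  by rewrite -[X in _ --> X](mulr0 (4 * M / h)); apply: cvgMr; exact: cvg_expr.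
have e20 : 0 < e / 2 by rewrite divr_gt0.
near=> m.
apply: (le_trans (main m)); rewrite -[X in _ <= X](subrK (e / 2)) addrC lerD2r.
have -> : e - e / 2 = e / 2 by field.
apply: le_trans (ler_norm _) _.
rewrite -normrN -[- _]sub0r; near: m.
by have /cvgrPdist_le /(_ _ e20) := K.
Unshelve. all: by end_near. Qed.

End Bump.

(** * Multipliers of positive semidefinite kernels *)

Section Schur.
Context {R : realType}.

Definition psd N (B : 'I_N -> 'I_N -> R) :=
  forall c : 'I_N -> R, 0 <= \sum_i \sum_j c i * c j * B i j.

(* Kernels whose entrywise product with every positive semidefinite kernel is
   positive semidefinite; closure under products is then immediate. *)
Definition schur N (A : 'I_N -> 'I_N -> R) :=
  forall B, psd B -> psd (fun i j => A i j * B i j).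

Variable N : nat.
Implicit Types A B D E : 'I_N -> 'I_N -> R.

Lemma eq_schur A B : (forall i j, A i j = B i j) -> schur A -> schur B.
Proof.
by move=> AB; have -> : A = B by apply/funext => i; apply/funext => j.
Qed.

Lemma schur_cst1 : schur (fun _ _ : 'I_N => 1).
Proof. by move=> B pB c; under eq_bigr do under eq_bigr do rewrite mul1r; exact: pB. Qed.

Lemma schur_psd A : schur A -> psd A.
Proof.
move=> sA c; have p1 : psd (fun _ _ : 'I_N => 1).
  move=> c'; rewrite (_ : \sum_i _ = (\sum_i c' i) ^+ 2) ?sqr_ge0 //.
  rewrite expr2 mulr_suml; apply: eq_bigr => i _; rewrite mulr_sumr.
  by apply: eq_bigr => j _; rewrite mulr1.
have := sA _ p1 c; by under eq_bigr do under eq_bigr do rewrite mulr1.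
Qed.

Lemma schur_mul A B : schur A -> schur B -> schur (fun i j => A i j * B i j).
Proof.
move=> sA sB C pC c; have := sA _ (sB _ pC) c.
by under eq_bigr do under eq_bigr do rewrite [A _ _ * _]mulrA.
Qed.

Lemma schur_rank1 (u : 'I_N -> R) : schur (fun i j => u i * u j).
Proof.
move=> B pB c; have := pB (fun i => c i * u i).
rewrite [X in 0 <= X -> _](_ : _ = \sum_i \sum_j c i * c j * (u i * u j * B i j)) //.
by apply: eq_bigr => i _; apply: eq_bigr => j _; ring.
Qed.

Lemma schurD A B : schur A -> schur B -> schur (fun i j => A i j + B i j).
Proof.
move=> sA sB C pC c; have := addr_ge0 (sA _ pC c) (sB _ pC c).
rewrite -big_split /=; under eq_bigr do rewrite -big_split /=.
by under eq_bigr do under eq_bigr do rewrite -mulrDr -mulrDl.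
Qed.

Lemma schur_scale (t : R) A : 0 <= t -> schur A -> schur (fun i j => t * A i j).
Proof.
move=> t0 sA B pB c; have := mulr_ge0 t0 (sA _ pB c).
rewrite mulr_sumr; under eq_bigr do rewrite mulr_sumr.
by under eq_bigr do under eq_bigr do rewrite mulrCA (mulrA t).
Qed.

Lemma schur_sum I (s : seq I) (A : I -> 'I_N -> 'I_N -> R) :
  (forall k, schur (A k)) -> schur (fun i j => \sum_(k <- s) A k i j).
Proof.
move=> sA; elim: s => [|k s IH].
  apply: (eq_schur (A := fun i j => 0 * 1)).
    by move=> i j; rewrite big_nil mul0r.
  exact: schur_scale schur_cst1.
apply: (eq_schur (A := fun i j => A k i j + \sum_(k <- s) A k i j)).
  by move=> i j; rewrite big_cons.
exact: schurD.
Qed.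

Lemma schur_prod d (A : 'I_d -> 'I_N -> 'I_N -> R) :
  (forall l, schur (A l)) -> schur (fun i j => \prod_(l < d) A l i j).
Proof.
elim: d A => [|d IH] A sA.
  by apply: (eq_schur _ schur_cst1) => i j; rewrite big_ord0.
apply: (eq_schur (A := fun i j => (\prod_(l < d) A (widen_ord (leqnSn d) l) i j) * A ord_max i j)).
  by move=> i j; rewrite big_ord_recr.
by apply: schur_mul => //; apply: IH.
Qed.

(** Telescoping over the coordinates writes the difference as a sum of products of multipliers. This
    is how a one-dimensional domination reaches the tensor product. *)
Lemma schur_prod_sub d (D E : 'I_d -> 'I_N -> 'I_N -> R) :
  (forall l, schur (D l)) -> (forall l, schur (E l)) ->
  schur (fun i j => \prod_(l < d) (D l i j + E l i j) - \prod_(l < d) D l i j).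
Proof.
elim: d D E => [|d IH] D E sD sE.
  apply: (eq_schur (A := fun i j => 0 * 1)); last exact: schur_scale schur_cst1.
  by move=> i j; rewrite !big_ord0 mul0r subrr.
pose w := widen_ord (leqnSn d).
apply: (eq_schur (A := fun i j =>
   (\prod_(l < d) (D (w l) i j + E (w l) i j) - \prod_(l < d) D (w l) i j) * (D ord_max i j + E ord_max i j) +
   (\prod_(l < d) D (w l) i j) * E ord_max i j)).
  by move=> i j; rewrite !big_ord_recr /=; ring.
apply: schurD; apply: schur_mul.
- by apply: (IH (fun l => D (w l)) (fun l => E (w l))).
- exact: schurD.
- exact: (schur_prod (fun l => sD (w l))).
- exact: sE.
Qed.

(** A Gram matrix of functions is an integral of rank-one kernels. *)
Lemma schur_Rintegral dd (T : measurableType dd) (m : {measure set T -> \bar R})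
    (X : set T) (u : 'I_N -> T -> R) : measurable X ->
  (forall i j, m.-integrable X (EFin \o (fun x => u i x * u j x))) ->
  schur (fun i j => \int[m]_(x in X) (u i x * u j x)).
Proof.
move=> mX iu B pB c.
rewrite (_ : \sum_i _ = \int[m]_(x in X) (\sum_i \sum_j c i * c j * B i j * (u i x * u j x))); last first.
  have ii i j : m.-integrable X (EFin \o (fun x => c i * c j * B i j * (u i x * u j x))).
    exact: integrable_scale.
  rewrite Rintegral_sum //; last by move=> i; exact: integrable_bigsum.
  apply: eq_bigr => i _; rewrite Rintegral_sum //; apply: eq_bigr => j _.
  by rewrite RintegralZl //; ring.
apply: Rintegral_ge0 => x _; have := schur_rank1 (fun i => u i x) pB c.
rewrite [X in 0 <= X -> _](_ : _ = \sum_i \sum_j c i * c j * B i j * (u i x * u j x)) //.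
by apply: eq_bigr => i _; apply: eq_bigr => j _; ring.
Qed.

End Schur.

(** * Convergence of inner products along Cauchy sequences *)

Section InnerProductCauchy.
Context {R : realType} {E : choiceType}.
Variables (V : set E) (ip : E -> E -> R).
Hypothesis ipC : forall u v, V u -> V v -> ip u v = ip v u.
(** Positivity of the form on combinations of three elements, expressed through its values: [E]
    carries no vector space structure. *)
Hypothesis ip3 : forall x y z a b c, V x -> V y -> V z ->
  0 <= a ^+ 2 * ip x x + b ^+ 2 * ip y y + c ^+ 2 * ip z z +
       2 * (a * b * ip x y + a * c * ip x z + b * c * ip y z).

Let ip_ge0 x : V x -> 0 <= ip x x.
Proof. by move=> Vx; have := ip3 1 0 0 Vx Vx Vx; rewrite !expr2; lra. Qed.

(** Cauchy-Schwarz in arithmetic-geometric form, read off from the positivity of the squared norms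
    of [x - y + s z] and [x - y - s z]. *)
Let ip_diff x y z s : V x -> V y -> V z -> 0 < s ->
  `|ip x z - ip y z| <= (sq_dist ip x y / s + s * ip z z) / 2.
Proof.
move=> Vx Vy Vz s0.
have e : sq_dist ip x y = s * (sq_dist ip x y / s) by field; rewrite gt_eqF.
have h1 := ip3 1 (-1) s Vx Vy Vz; have h2 := ip3 1 (-1) (- s) Vx Vy Vz.
have d : ip x x + ip y y - 2 * ip x y = s * (sq_dist ip x y / s).
  by rewrite -e /sq_dist (ipC Vy Vx); ring.
set q := _ / s in d e *.
rewrite ler_norml; apply/andP; split; rewrite -(ler_pM2l s0).
  by move: h1 d; rewrite !expr2; lra.
by move: h2 d; rewrite !expr2; lra.
Qed.

Let ip_bounded u : (forall m, V (u m)) -> ip_cauchy ip u ->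
  exists (C : R) (m0 : nat), 0 < C /\ forall m, (m0 <= m)%N -> ip (u m) (u m) <= C.
Proof.
(* Positivity at [u m - 2 u m0], together with squared distance below 1, gives a squared norm of
   [u m] below [2 ip (u m0) (u m0) + 2]. *)
move=> Vu /(_ 1 ltr01)[m0 cu]; exists (2 * (ip (u m0) (u m0)) + 3), m0.
have h0 := ip_ge0 (Vu m0); split; first by lra.
move=> m m0m; have := cu m m0 m0m (leqnn _).
have := ip3 1 (-2) 0 (Vu m) (Vu m0) (Vu m0).
by rewrite /sq_dist (ipC (Vu m0) (Vu m)) !expr2; lra.
Qed.

Lemma ip_cauchy_cvg u v : (forall m, V (u m)) -> (forall m, V (v m)) ->
  ip_cauchy ip u -> ip_cauchy ip v ->
  ip (u m) (v m) @[m --> \oo] --> limn (fun m => ip (u m) (v m)).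
Proof.
move=> Vu Vv cu cv.
have [C [m1 [C0 uC]]] := ip_bounded Vu cu; have [C' [m2 [C0' vC]]] := ip_bounded Vv cv.
apply: (@cauchy_cvg R^o); apply: cauchy_exP => e e0.
(* The norm terms then add up to [s (C + C') = e / 2] and each distance term stays below [e / 2];
   half of the total is below [e]. *)
pose s := e / (2 * (C + C')).
have CC : 0 < 2 * (C + C') by lra.
have s0 : 0 < s by rewrite divr_gt0.
have d0 : 0 < s * (e / 2) by rewrite mulr_gt0 // divr_gt0.
have [m3 c3] := cu _ d0; have [m4 c4] := cv _ d0.
pose m0 := maxn (maxn m1 m2) (maxn m3 m4).
exists (ip (u m0) (v m0)); exists m0 => // m /= m0m.
have := leq_trans (leq_maxl _ _) m0m; rewrite geq_max => /andP[m1m m2m].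
have := leq_trans (leq_maxr _ _) m0m; rewrite geq_max => /andP[m3m m4m].
have := leq_maxl (maxn m1 m2) (maxn m3 m4); rewrite -/m0 geq_max => /andP[m1m0 m2m0].
have := leq_maxr (maxn m1 m2) (maxn m3 m4); rewrite -/m0 geq_max => /andP[m3m0 m4m0].
have h1 := ip_diff (Vu m0) (Vu m) (Vv m0) s0.
have h2 := ip_diff (Vv m0) (Vv m) (Vu m) s0.
rewrite (ipC (Vv m0) (Vu m)) (ipC (Vv m) (Vu m)) in h2.
have D1 : sq_dist ip (u m0) (u m) / s < e / 2 by rewrite ltr_pdivrMr // mulrC; exact: c3.
have D2 : sq_dist ip (v m0) (v m) / s < e / 2 by rewrite ltr_pdivrMr // mulrC; exact: c4.
have N1 : s * ip (v m0) (v m0) <= s * C' by rewrite ler_pM2l // vC.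
have N2 : s * ip (u m) (u m) <= s * C by rewrite ler_pM2l // uC.
have sC : s * C + s * C' = e / 2 by rewrite -mulrDr /s; field; rewrite gt_eqF //; lra.
rewrite /ball /= (_ : _ - _ = (ip (u m0) (v m0) - ip (u m) (v m0)) + (ip (u m) (v m0) - ip (u m) (v m))); last by ring.
by rewrite (le_lt_trans (ler_normD _ _)) //; lra.
Qed.

End InnerProductCauchy.

(** * Cosine approximation away from order one *)

Section CosineApproximation.
Context {R : realType}.
Local Notation mu := (@lebesgue_measure R).

(* The Gram matrix of the u i is a limit of Gram matrices of cosine polynomials
   for the target norm, up to kernels that only increase it. *)
Definition cos_approx (alpha gamma : R) N (u : 'I_N -> R -> R) :=
  exists (n : nat -> nat) (a : nat -> 'I_N -> nat -> R) (E : nat -> 'I_N -> 'I_N -> R),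
  [/\ forall m, schur (E m),
      forall i y, 0 <= y <= 1 -> cos_series (n m) (a m i) y @[m --> \oo] --> u i y &
      forall i j, \sum_(k < n m) r_wt alpha (kappa alpha `^ (- 2^-1) * gamma) k ^+ 2 *
          (a m i k * a m j k) + E m i j @[m --> \oo] --> sob_ip1 alpha gamma (u i) (u j)].

Lemma pcos_pad (f : R -> R) : pcos f ->
  exists n0, forall n, (n0 <= n)%N -> exists a, f = cos_series n a.
Proof.
move=> [n0 [a ->]]; exists n0 => n n0n; exists (fun k => if (k < n0)%N then a k else 0).
apply/funext => x; rewrite /cos_series (big_ord_widen n (fun k => a k * phi k x)) //.
by rewrite big_mkcond /=; apply: eq_bigr => k _; case: ifP => // _; rewrite mul0r.
Qed.

Lemma pcos_family N (f : 'I_N -> R -> R) : (forall i, pcos (f i)) ->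
  exists n (a : 'I_N -> nat -> R), (0 < n)%N /\ forall i, f i = cos_series n (a i).
Proof.
move=> pf; pose n0 i := projT1 (cid (pcos_pad (pf i))).
pose n := (\max_i n0 i).+1.
have H i : exists a, f i = cos_series n a.
  by rewrite /n; have := projT2 (cid (pcos_pad (pf i))); apply; apply: leqW; exact: leq_bigmax.
by exists n, (fun i => projT1 (cid (H i))); split => // i; exact: projT2 (cid (H i)).
Qed.

Lemma uniform_cvg_point (T : choiceType) (D : set T) (F : nat -> T -> R) (f : T -> R) y :
  {uniform D, F @ \oo --> f} -> D y -> F m y @[m --> \oo] --> f y.
Proof.
move=> cF Dy.
have sD : [set y] `<=` D by move=> z /= ->.
have := uniform_subset_cvg _ sD cF; rewrite uniform_set1; exact.
Qed.

Variables (alpha gamma : R).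
Hypothesis ha : 2^-1 < alpha < 2.

Let r k := r_wt alpha (kappa alpha `^ (- 2^-1) * gamma) k.

Section Fractional.
Hypothesis an : alpha != 1.

Let eigen_ge0 k : 0 <= eigen alpha gamma k.
Proof. by apply: le_trans (r_wt_sqr_le_eigen _ _ ha an); rewrite sqr_ge0. Qed.

(** Symmetry, like the positivity that follows, is read off from the diagonal form after writing the
    functions with a common degree. *)
Lemma sob_formC f g : pcos f -> pcos g ->
  sob_form alpha gamma f g = sob_form alpha gamma g f.
Proof.
move=> pf pg; have pF (i : 'I_2) : pcos (if i == ord0 then f else g) by case: ifP.
have [n [a [n0 e]]] := pcos_family pF.
have -> : f = cos_series n (a ord0) by have := e ord0.
have -> : g = cos_series n (a ord_max) by have := e ord_max.
by rewrite !sob_form_diag //; apply: eq_bigr => k _; rewrite [a _ _ * _]mulrC.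
Qed.

Lemma sob_form3 x y z a b c : pcos x -> pcos y -> pcos z ->
  0 <= a ^+ 2 * sob_form alpha gamma x x + b ^+ 2 * sob_form alpha gamma y y +
       c ^+ 2 * sob_form alpha gamma z z + 2 * (a * b * sob_form alpha gamma x y +
       a * c * sob_form alpha gamma x z + b * c * sob_form alpha gamma y z).
Proof.
move=> px py pz.
pose f (i : 'I_3) := if i == 0%N :> nat then x else if i == 1%N :> nat then y else z.
have pf i : pcos (f i) by rewrite /f; do 2 case: ifP => _ //.
have [n [t [n0 e]]] := pcos_family pf.
have -> : x = cos_series n (t ord0) by have := e ord0.
have -> : y = cos_series n (t (Ordinal (isT : (1 < 3)%N))) by have := e (Ordinal (isT : (1 < 3)%N)).
have -> : z = cos_series n (t ord_max) by have := e ord_max.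
rewrite !sob_form_diag //; set X := t _; set Y := t _; set Z := t _.
rewrite [X in 0 <= X](_ : _ = \sum_(k < n) eigen alpha gamma k * (a * X k + b * Y k + c * Z k) ^+ 2).
  by apply: sumr_ge0 => k _; rewrite mulr_ge0 ?sqr_ge0.
by rewrite !mulr_sumr -!big_split /= mulr_sumr -big_split /=; apply: eq_bigr => k _; ring.
Qed.

Lemma fractional_approx N (u : 'I_N -> R -> R) :
  (forall i, sob_space1 alpha gamma (u i)) -> cos_approx alpha gamma u.
Proof.
rewrite /sob_space1 (negbTE an) => hu.
pose U i := repr_seq pcos (sob_form alpha gamma) (unit_itv R) id (fun=> 0) (u i).
have HU i : represents pcos (sob_form alpha gamma) (unit_itv R) id (U i) (u i).
  exact: (@xgetPex _ (fun _ _ => 0) [set w | represents _ _ _ _ w (u i)] (hu i)).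
have pU m i : pcos (U i m) by have [] := HU i.
pose n m := projT1 (cid (pcos_family (pU m))).
pose a m := projT1 (cid (projT2 (cid (pcos_family (pU m))))).
have H m : (0 < n m)%N /\ forall i, U i m = cos_series (n m) (a m i).
  exact: projT2 (cid (projT2 (cid (pcos_family (pU m))))).
(* The approximants are the very representing sequences that define [sob_ip1]; the defect consists
   of the nonnegative gaps between eigenvalues and squared weights. *)
exists n, a, (fun m i j => \sum_(k < n m) (eigen alpha gamma k - r k ^+ 2) * (a m i k * a m j k)); split.
- move=> m; apply: (schur_sum _ (A := fun (k : 'I_(n m)) i j => (eigen alpha gamma k - r k ^+ 2) * (a m i k * a m j k))) => k.
  apply: schur_scale; first by rewrite subr_ge0 r_wt_sqr_le_eigen.
  exact: (schur_rank1 (fun i => a m i k)).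
- move=> i y y01; have [_ _ cU] := HU i.
  have Dy : unit_itv R y by rewrite /unit_itv /= in_itv.
  have := uniform_cvg_point cU Dy.
  by under eq_fun do rewrite /= (H _).2.
- move=> i j; rewrite /sob_ip1 (negbTE an) /completion_ip.
  have cv : sob_form alpha gamma (U i m) (U j m) @[m --> \oo] -->
      limn (fun m => sob_form alpha gamma (U i m) (U j m)).
    have ci l : ip_cauchy (sob_form alpha gamma) (U l) by have [] := HU l.
    exact: (ip_cauchy_cvg sob_formC sob_form3 (fun m => pU m i) (fun m => pU m j) (ci i) (ci j)).
  rewrite [X in X @ \oo](_ : _ = fun m => sob_form alpha gamma (U i m) (U j m)) //.
  apply/funext => m; have [n0 e] := H m; rewrite !e sob_form_diag // -big_split /=.
  by apply: eq_bigr => k _; rewrite -mulrDl subrKC.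
Qed.

End Fractional.
End CosineApproximation.

(** * Cosine approximation at order one *)

Section OrderOne.
Context {R : realType}.
Local Notation mu := (@lebesgue_measure R).

Lemma integrable_mul_L2 (v w : R -> R) :
  measurable_fun (`[0, 1]%classic : set R) v -> measurable_fun (`[0, 1]%classic : set R) w ->
  mu.-integrable `[0, 1] (fun x => (v x ^+ 2)%:E) ->
  mu.-integrable `[0, 1] (fun x => (w x ^+ 2)%:E) ->
  mu.-integrable `[0, 1] (EFin \o (fun x => v x * w x)).
Proof.
move=> mv mw iv iw.
have i2 : mu.-integrable `[0, 1] (EFin \o (fun x => v x ^+ 2 + w x ^+ 2)) by exact: integrable_add.
apply: le_integrable i2 => //; first by apply/measurable_EFinP; exact: measurable_funM.
move=> x _; rewrite /= lee_fin [X in _ <= X]ger0_norm ?addr_ge0 ?sqr_ge0 //.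
rewrite normrM -(real_normK (num_real (v x))) -(real_normK (num_real (w x))).
by have := normr_ge0 (v x); have := normr_ge0 (w x); rewrite !expr2; nra.
Qed.

Variable gamma : R.

Section Pair.
Variables (v w : R -> R).
Hypotheses (mv : measurable_fun (`[0, 1]%classic : set R) v)
  (mw : measurable_fun (`[0, 1]%classic : set R) w)
  (iv : mu.-integrable `[0, 1] (fun x => (v x ^+ 2)%:E))
  (iw : mu.-integrable `[0, 1] (fun x => (w x ^+ 2)%:E)).

Definition scoef (f : R -> R) (k : nat) : R :=
  Num.sqrt 2 * \int[mu]_(x in `[0, 1]) (f x * trig false k x).

Definition sin_part (f : R -> R) (n : nat) : R -> R :=
  tpoly false n (fun k => Num.sqrt 2 * scoef f k).

Lemma scoef0 f : scoef f 0 = 0.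
Proof.
rewrite /scoef (_ : Rintegral _ _ _ = 0) ?mulr0 //.
under eq_Rintegral do rewrite /trig !mul0r sin0 mulr0.
by rewrite Rintegral_cst // mul0r.
Qed.

Lemma continuous_tpoly b n (a : nat -> R) : continuous (tpoly b n a).
Proof.
elim: n => [|n IH] x.
  by rewrite (_ : tpoly b 0 a = cst 0); [exact: cvg_cst|apply/funext => y; rewrite /tpoly big_ord0].
rewrite (_ : tpoly b n.+1 a = fun y => tpoly b n a y + a n * trig b n y); last first.
  by apply/funext => y; rewrite /tpoly big_ord_recr.
by apply: cvgD; [exact: IH|apply: cvgMr; exact: continuous_trig].
Qed.

Lemma tpoly_bounded b n a : exists2 M : R, 0 <= M & forall x : R, `|tpoly b n a x| <= M.
Proof.
exists (\sum_(k < n) `|a k|); first by apply: sumr_ge0.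
move=> x; rewrite (le_trans (ler_norm_sum _ _ _)) // ler_sum // => k _.
by rewrite normrM ler_piMr // trig_max.
Qed.

Lemma integrable_mul_tpoly f b n a : mu.-integrable `[0, 1] (EFin \o f) ->
  mu.-integrable `[0, 1] (EFin \o (fun x => f x * tpoly b n a x)).
Proof.
move=> fi; have [M _ hM] := tpoly_bounded b n a.
apply: (integrable_mul_bounded (M := M)) => //.
by apply: measurable_funTS; exact: measurable_tpoly.
Qed.

Lemma Rintegral_mul_sin_part f g n : mu.-integrable `[0, 1] (EFin \o f) ->
  \int[mu]_(x in `[0, 1]) (f x * sin_part g n x) = \sum_(k < n) scoef f k * scoef g k.
Proof.
move=> fi.
have ik (k : 'I_n) : mu.-integrable `[0, 1] (EFin \o (fun x => f x * trig false k x)).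
  apply: (integrable_mul_bounded (M := 1)) => //; last by move=> x _; exact: trig_max.
  by apply: measurable_funTS; exact: measurable_trig.
transitivity (\int[mu]_(x in `[0, 1]) (\sum_(k < n) (Num.sqrt 2 * scoef g k) * (f x * trig false k x))).
  by apply: eq_Rintegral => x _; rewrite /sin_part /tpoly mulr_sumr; apply: eq_bigr => k _; ring.
rewrite Rintegral_sum //; last by move=> k; exact: integrable_scale.
by apply: eq_bigr => k _; rewrite RintegralZl // {2}/scoef; ring.
Qed.

(** Polarized Bessel identity: the functions [sqrt 2 sin (k pi x)] with [k > 0] are orthonormal, so
    the cross terms cancel one copy of the coefficient sum. *)
Lemma Rintegral_sin_residual n :
  mu.-integrable `[0, 1] (EFin \o (fun x => (v x - sin_part v n x) * (w x - sin_part w n x))) /\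
  \int[mu]_(x in `[0, 1]) ((v x - sin_part v n x) * (w x - sin_part w n x)) =
  \int[mu]_(x in `[0, 1]) (v x * w x) - \sum_(k < n) scoef v k * scoef w k.
Proof.
have vi := integrable_L2 mv iv; have wi := integrable_L2 mw iw.
have i1 := integrable_mul_L2 mv mw iv iw.
have i2 : mu.-integrable `[0, 1] (EFin \o (fun x => v x * sin_part w n x)) by exact: integrable_mul_tpoly.
have i3 : mu.-integrable `[0, 1] (EFin \o (fun x => w x * sin_part v n x)) by exact: integrable_mul_tpoly.
have i4 : mu.-integrable `[0, 1] (EFin \o (fun x => sin_part v n x * sin_part w n x)).
  apply: integrable_mul_tpoly; apply: integrable_continuous01.
  by apply: continuous_subspaceT; exact: continuous_tpoly.
have L1 := Rintegral_lin2 1 (-1) i1 i2; have L2 := Rintegral_lin2 (-1) 1 i3 i4.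
have L := Rintegral_lin2 1 1 L1.1 L2.1.
have E : (fun x => (v x - sin_part v n x) * (w x - sin_part w n x)) =
  (fun x => 1 * (1 * (v x * w x) + -1 * (v x * sin_part w n x)) +
     1 * (-1 * (w x * sin_part v n x) + 1 * (sin_part v n x * sin_part w n x))).
  by apply/funext => x; ring.
rewrite E; split; first exact: L.1.
rewrite L.2 L1.2 L2.2 (Rintegral_mul_sin_part w n vi) (Rintegral_mul_sin_part v n wi).
have -> : \int[mu]_(x in `[0, 1]) (sin_part v n x * sin_part w n x) = \sum_(k < n) scoef v k * scoef w k.
  rewrite Rintegral_tpoly_mul; apply: eq_bigr => -[[|k] kn] _ /=.
    by rewrite !scoef0 !mulr0 mul0r.
  have s2 : Num.sqrt 2 * Num.sqrt 2 = 2 :> R by rewrite -expr2 sqr_sqrtr.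
  transitivity (Num.sqrt 2 * Num.sqrt 2 * (scoef v k.+1 * scoef w k.+1) / 2); first by ring.
  by rewrite s2; field.
have -> : \sum_(k < n) scoef w k * scoef v k = \sum_(k < n) scoef v k * scoef w k.
  by apply: eq_bigr => k _; rewrite mulrC.
by ring.
Qed.

End Pair.

Lemma fcoef0 f : fcoef f 0 = \int[mu]_(x in `[0, 1]) f x.
Proof. by apply: eq_Rintegral => x _; rewrite /phi /= mulr1. Qed.

Lemma order_one_approx N (u : 'I_N -> R -> R) :
  (forall i, sob_space1 1 gamma (u i)) -> cos_approx 1 gamma u.
Proof.
rewrite /sob_space1 eqxx => hu.
have ha : 2^-1 < (1 : R) < 2 by apply/andP; split; lra.
pose w i := weak_derivative (u i).
have cu i : {within `[0, 1], continuous u i} by have [] := hu i.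
have hw i : L2_weak_derivative (u i) (w i).
  have [_ ex] := hu i.
  exact: (@xgetPex _ (fun=> 0) [set g | L2_weak_derivative (u i) g] ex).
have mw i : measurable_fun (`[0, 1]%classic : set R) (w i) by have [] := hw i.
have iw i : mu.-integrable `[0, 1] (fun x => (w i x ^+ 2)%:E) by have [] := hw i.
have [t [t1 t0 tc]] := @bump_approx R.
(* Integration by parts links the cosine coefficients of [u i] to the sine coefficients of its weak
   derivative; the sign cancels in products. *)
have wc i k : k%:R * pi * fcoef (u i) k = - scoef (w i) k.
  have ik : mu.-integrable `[0, 1] (EFin \o (fun x => u i x * phi k x)).
    have cp : {within `[0, 1], continuous (phi k : R -> R)}.
      rewrite (_ : phi k = fun x => phi_scale k * trig true k x); last by apply/funext => z; rewrite phiE.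
      by apply: continuous_subspaceT => y; apply: cvgMr; exact: continuous_trig.
    by apply: integrable_continuous01 => x; apply: cvgM; [exact: cu|exact: cp].
  case: k ik => [|k] ik; first by rewrite !mul0r scoef0 oppr0.
  have := @weak_derivative_by_parts R (u i) (w i) k.+1 (cu i) (hw i) => e.
  rewrite /scoef -mulrN -e.
  have iu : mu.-integrable `[0, 1] (EFin \o (fun x => u i x * (k.+1%:R * pi * trig true k.+1 x))).
    have ct : {within `[0, 1], continuous (fun x : R => k.+1%:R * pi * trig true k.+1 x)}.
      by apply: continuous_subspaceT => y; apply: cvgMr; exact: continuous_trig.
    by apply: integrable_continuous01 => x; apply: cvgM; [exact: cu|exact: ct].
  rewrite /fcoef -!RintegralZl //; apply: eq_Rintegral => x _.
  by rewrite phiE /phi_scale /=; ring.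
(* Two losses: the part of the derivatives beyond the first sines, and the damping of the
   coefficients by [t m k], whose weight [1 - t m k ^+ 2] is nonnegative. *)
pose E m i j := (gamma ^+ 2)^-1 *
  (\int[mu]_(x in `[0, 1]) ((w i x - sin_part (w i) m.+1 x) * (w j x - sin_part (w j) m.+1 x)) +
   \sum_(k < m.+1) (1 - t m k ^+ 2) * (scoef (w i) k * scoef (w j) k)).
exists (fun m => m.+1), (fun m i k => t m k * fcoef (u i) k), E; split.
- move=> m; apply: schur_scale; first by rewrite invr_ge0 sqr_ge0.
  apply: schurD.
    apply: (@schur_Rintegral _ _ _ _ mu _ (fun i x => w i x - sin_part (w i) m.+1 x)) => // i j.
    exact: (Rintegral_sin_residual (mw i) (mw j) (iw i) (iw j) m.+1).1.
  apply: (schur_sum _ (A := fun (k : 'I_m.+1) i j => (1 - t m k ^+ 2) * (scoef (w i) k * scoef (w j) k))) => k.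
  apply: schur_scale; last exact: (schur_rank1 (fun i => scoef (w i) k)).
  by rewrite subr_ge0 -(real_normK (num_real _)) expr_le1.
- by move=> i y y01; exact: tc.
(* Here the identity is exact for every [m]: [t m 0 = 1] preserves the means, and
   [kappa 1 = pi ^+ 2] matches the weights to the derivatives. *)
- move=> i j; rewrite [X in X @ \oo](_ : _ = fun=> sob_ip1 1 gamma (u i) (u j)); first exact: cvg_cst.
  apply/funext => m; rewrite /sob_ip1 eqxx /unit_itv -/(w i) -/(w j) -(fcoef0 (u i)) -(fcoef0 (u j)).
  rewrite /E (Rintegral_sin_residual (mw i) (mw j) (iw i) (iw j) m.+1).2.
  rewrite [X in X + _ = _](_ : _ = fcoef (u i) 0 * fcoef (u j) 0 +
     (gamma ^+ 2)^-1 * \sum_(k < m.+1) t m k ^+ 2 * (scoef (w i) k * scoef (w j) k)).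
    have -> : \sum_(k < m.+1) (1 - t m k ^+ 2) * (scoef (w i) k * scoef (w j) k) =
      \sum_(k < m.+1) scoef (w i) k * scoef (w j) k -
      \sum_(k < m.+1) t m k ^+ 2 * (scoef (w i) k * scoef (w j) k).
      by rewrite -sumrB; apply: eq_bigr => k _; rewrite mulrBl mul1r.
    move: (\sum_(k < m.+1) scoef (w i) k * scoef (w j) k) => A.
    move: (\sum_(k < m.+1) t m k ^+ 2 * _) (Rintegral _ _ _) => B I.
    move: (fcoef _ _ * _) (gamma ^+ 2)^-1 => F g; ring.
  rewrite big_ord_recl [in RHS]big_ord_recl /= !scoef0 !mulr0 add0r t0 !mul1r.
  rewrite /r_wt /= expr1n mul1r; congr (_ + _); rewrite mulr_sumr.
  apply: eq_bigr => k _; rewrite /bump leq0n add1n.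
  have := r_wt_sqr gamma ha (isT : (0 < k.+1)%N); rewrite /r_wt => ->.
  have e : scoef (w i) k.+1 * scoef (w j) k.+1 =
    (k.+1%:R * pi * fcoef (u i) k.+1) * (k.+1%:R * pi * fcoef (u j) k.+1).
    by rewrite (wc i k.+1) (wc j k.+1) mulrNN.
  rewrite e /kappa ltxx eqxx mulr1.
  have -> : k.+1%:R `^ 2 = k.+1%:R ^+ 2 :> R by apply: powR_mulrn; exact: ler0n.
  move: (fcoef (u i) _) (fcoef (u j) _) (t m _) (pi) (gamma ^+ 2)^-1 => x y z p g; ring.
Qed.

End OrderOne.

Lemma sob_approx (R : realType) (alpha gamma : R) N (u : 'I_N -> R -> R) :
  2^-1 < alpha < 2 -> (forall i, sob_space1 alpha gamma (u i)) -> cos_approx alpha gamma u.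
Proof.
move=> ha; have [->|an] := eqVneq alpha 1; first exact: order_one_approx.
exact: fractional_approx.
Qed.

Lemma sob_ip1C (R : realType) (alpha gamma : R) (f g : R -> R) : 2^-1 < alpha < 2 ->
  sob_space1 alpha gamma f -> sob_space1 alpha gamma g ->
  sob_ip1 alpha gamma f g = sob_ip1 alpha gamma g f.
Proof.
move=> ha hf hg.
have [a1|an] := eqVneq alpha 1.
  rewrite /sob_ip1 a1 eqxx.
  have -> : \int[lebesgue_measure]_(x in unit_itv R) (weak_derivative f x * weak_derivative g x) =
    \int[lebesgue_measure]_(x in unit_itv R) (weak_derivative g x * weak_derivative f x).
    by apply: eq_Rintegral => x _; exact: mulrC.
  by congr (_ + _); exact: mulrC.
rewrite /sob_ip1 (negbTE an); move: hf hg; rewrite /sob_space1 (negbTE an) => hf hg.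
have pr h : completion pcos (sob_form alpha gamma) (unit_itv R) id h ->
    forall m, pcos (repr_seq pcos (sob_form alpha gamma) (unit_itv R) id (fun=> 0) h m).
  move=> hh; have [+ _ _] := @xgetPex _ (fun _ _ => 0) [set w | represents pcos (sob_form alpha gamma) (unit_itv R) id w h] hh.
  exact.
pose r h := repr_seq pcos (sob_form alpha gamma) (unit_itv R) id (fun=> 0) h.
have E : (fun m => sob_form alpha gamma (r f m) (r g m)) = (fun m => sob_form alpha gamma (r g m) (r f m)).
  by apply/funext => m; exact: (sob_formC gamma ha an (pr f hf m) (pr g hg m)).
exact: (congr1 (fun s : nat -> R => limn s) E).
Qed.

(** * Character sums over a rank-one lattice *)

Section LatticeCharacters.
Context {R : realType}.
Local Open Scope complex_scope.

Lemma cexpiD (s t : R) : cexpi (s + t) = cexpi s * cexpi t.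
Proof. by rewrite /cexpi cosD sinD; simpc; congr (_ +i* _); ring. Qed.

Lemma cexpi0 : cexpi (0 : R) = 1.
Proof. by rewrite /cexpi cos0 sin0. Qed.

Lemma cexpi_nat (t : R) (m : nat) : cexpi (t * m%:R) = cexpi t ^+ m.
Proof.
elim: m => [|m IH]; first by rewrite mulr0 cexpi0 expr0.
by rewrite -natr1 mulrDr mulr1 cexpiD IH exprSr.
Qed.

Lemma cexpi_int (m : int) : cexpi (2 * pi * m%:~R : R) = 1.
Proof.
have e : cexpi (2 * pi : R) = 1.
  by rewrite /cexpi mulr_natl cos2pi sin2pi.
have eN : cexpi (- (2 * pi) : R) = 1.
  by rewrite /cexpi cosN sinN mulr_natl cos2pi sin2pi oppr0.
case: m => m.
  by rewrite -pmulrn cexpi_nat e expr1n.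
by rewrite NegzE mulrNz mulrN -mulNr -pmulrn cexpi_nat eN expr1n.
Qed.

(** A remainder [0 < r < n] would give [cos (2 pi r / n) = 1], that is [sin (pi r / n) = 0], whereas
    that sine is positive. *)
Lemma cexpi_eq1 (n : nat) (D : int) : (0 < n)%N ->
  cexpi (2 * pi * (D%:~R / n%:R) : R) = 1 -> (D = 0 %[mod n%:Z])%Z.
Proof.
move=> n0 e.
have nz : n%:Z != 0 by rewrite -lt0n.
have nR : n%:R != 0 :> R by rewrite pnatr_eq0 -lt0n.
set q := (D %/ n%:Z)%Z; set r := (D %% n%:Z)%Z.
have r0 : 0 <= r by exact: modz_ge0.
have rn : r < n%:Z by rewrite ltz_mod.
have De : D = q * n%:Z + r by exact: divz_eq.
rewrite mod0z -/r; apply/eqP; rewrite eq_le r0 andbT leNgt; apply/negP => rp.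
have Dr : D%:~R / n%:R = q%:~R + r%:~R / n%:R :> R.
  by rewrite {1}De rmorphD rmorphM /= -pmulrn mulrDl mulfK.
have : cexpi (2 * pi * (r%:~R / n%:R) : R) = 1.
  by rewrite -e Dr (mulrDr (2 * pi)) cexpiD cexpi_int mul1r.
move=> [c1 _].
have P := pi_gt0 R.
have nR0 : 0 < n%:R :> R by rewrite ltr0n.
have rR : 0 < r%:~R :> R by rewrite ltr0z.
have rnR : r%:~R / n%:R < 1 :> R.
  by rewrite ltr_pdivrMr // mul1r pmulrn ltr_int.
have s0 : 0 < sin (pi * (r%:~R / n%:R) : R).
  by apply: sin_gt0_pi; rewrite mulr_gt0 ?divr_gt0 //= -[X in _ < X]mulr1 ltr_pM2l.
have := cos2Dsin2 (pi * (r%:~R / n%:R) : R); move: c1.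
rewrite (_ : 2 * pi * (r%:~R / n%:R) = (pi * (r%:~R / n%:R)) *+ 2 :> R); last by rewrite mulr2n; ring.
by rewrite cos_mulr2n mulr2n; move: s0; rewrite !expr2; nra.
Qed.

Lemma char_sum (n : nat) (D : int) : (0 < n)%N ->
  (n%:R)^-1 * \sum_(i < n) cexpi (2 * pi * (D%:~R / n%:R) * i%:R : R) =
  (D == 0 %[mod n%:Z])%Z%:R :> R[i].
Proof.
move=> n0; have nz : n%:R != 0 :> R[i] by rewrite pnatr_eq0 -lt0n.
under eq_bigr do rewrite cexpi_nat.
set w := cexpi _; case: eqP => [D0|Dn].
  pose q := (D %/ n%:Z)%Z.
  have De : D = q * n%:Z by rewrite {1}(divz_eq D n%:Z) D0 mod0z addr0.
  have w1 : w = 1.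
    by rewrite /w De rmorphM /= -pmulrn mulfK ?cexpi_int // pnatr_eq0 -lt0n.
  rewrite (eq_bigr (fun=> 1)); last by move=> i _; rewrite w1 expr1n.
  by rewrite sumr_const card_ord mulVf.
have w1 : w - 1 != 0 by rewrite subr_eq0; apply/eqP => /(cexpi_eq1 n0).
apply/eqP; rewrite mulf_eq0 invr_eq0 (negbTE nz) /=.
rewrite -(inj_eq (mulfI w1)) mulr0 -subrX1 /w -cexpi_nat.
rewrite -mulrA divfK; last by rewrite pnatr_eq0 -lt0n.
by rewrite cexpi_int subrr.
Qed.

(** The integer parts removed by [frac_part] contribute integer multiples of [2 pi], because [h] is
    integral. *)
Lemma cexpi_lattice d n (z : 'rV['I_n]_d) (h : 'rV[int]_d) (i : nat) : (0 < n)%N ->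
  cexpi (2 * pi * \sum_(j < d) (h ord0 j)%:~R * lattice_point z i ord0 j) =
  cexpi (2 * pi * ((dotz h z)%:~R / n%:R) * i%:R : R).
Proof.
move=> n0.
pose fl j : int := Num.floor (i%:R * (nat_of_ord (z ord0 j))%:R / n%:R : R).
have -> : \sum_(j < d) (h ord0 j)%:~R * (lattice_point z i ord0 j : R) =
   (dotz h z)%:~R / n%:R * i%:R - (\sum_(j < d) h ord0 j * fl j)%:~R.
  rewrite /dotz !rmorph_sum /= !mulr_suml -sumrB; apply: eq_bigr => j _.
  by rewrite mxE /frac_part -/(fl j) !intrM -pmulrn; ring.
rewrite mulrBr -mulrN -mulrNz cexpiD cexpi_int mulr1 mulrA; congr (cexpi _).
Qed.

(** Aliasing: the characters with frequencies [h] and [k] coincide on the lattice generated by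
    [z]. *)
Definition hdist n d (h k : 'rV[int]_d) (z : 'rV['I_n]_d) : bool :=
  (dotz h z == dotz k z %[mod n%:Z])%Z.

Lemma lattice_coeffE d n (z : 'rV['I_n]_d) (k : 'rV[int]_d) (I : finType)
    (c : I -> R) (h : I -> 'rV[int]_d) (T : 'rV[R]_d -> R) : (0 < n)%N ->
  (forall i : nat, (T (map_mx tent (lattice_point z i)))%:C =
     \sum_e (c e)%:C * cexpi (2 * pi * \sum_(j < d) (h e ord0 j)%:~R * lattice_point z i ord0 j)) ->
  lattice_coeff z T k = \sum_e (c e)%:C * (hdist (h e) k z)%:R.
Proof.
move=> n0 hT; rewrite /lattice_coeff.
under eq_bigr do rewrite hT mulr_suml.
rewrite exchange_big mulr_sumr /=; apply: eq_bigr => e _.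
rewrite (eq_bigr (fun i : 'I_n => (c e)%:C * cexpi (2 * pi * ((dotz (h e) z - dotz k z)%:~R / n%:R) * i%:R))); last first.
  move=> i _; rewrite -mulrA -mulrN cexpi_lattice //; congr (_ * _).
  have -> : - (\sum_(j < d) (k ord0 j)%:~R * (lattice_point z i ord0 j : R)) =
     \sum_(j < d) ((- k) ord0 j)%:~R * lattice_point z i ord0 j.
    by rewrite -sumrN; apply: eq_bigr => j _; rewrite [(- k) _ _]mxE rmorphN mulNr.
  rewrite cexpi_lattice // -cexpiD; congr (cexpi _).
  have -> : dotz (- k) z = - dotz k z.
    by rewrite /dotz -sumrN; apply: eq_bigr => j _; rewrite [(- k) _ _]mxE mulNr.
  by rewrite intrD mulrNz; ring.
rewrite -mulr_sumr mulrCA char_sum //; congr (_ * _%:R).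
by rewrite /hdist [in RHS]eqz_mod_dvd [in LHS]eqz_mod_dvd subr0.
Qed.

End LatticeCharacters.

(** * Error of the algorithm on finite cosine sums *)

Section LatticeError.
Context {R : realType}.
Local Open Scope complex_scope.

Definition cos_prod d (k : 'rV[int]_d) (x : 'rV[R]_d) : R :=
  \prod_(j < d) cos ((k ord0 j)%:~R * pi * x ord0 j).

Lemma cos_prod_max d (k : 'rV[int]_d) x : `|cos_prod k x| <= 1.
Proof. by rewrite normr_prod; apply: prodr_ile1 => j _; rewrite normr_ge0 cos_max. Qed.

Lemma cos_abs (h : int) (t : R) : cos (`|h|%:R * pi * t) = cos (h%:~R * pi * t).
Proof.
case: h => m; first by rewrite -pmulrn.
by rewrite NegzE abszN mulrNz !mulNr cosN -pmulrn.
Qed.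

(** The power of 2 cancels the normalization in [A_mult], leaving a pure product of cosines. *)
Lemma phi_vec_abs d (k : 'rV[int]_d) (x : 'rV[R]_d) :
  phi_vec (abs_vec k) x = 2 `^ ((nnz k)%:R / 2) * cos_prod k x.
Proof.
rewrite /phi_vec /cos_prod.
rewrite (eq_bigr (fun j => (if k ord0 j != 0 then Num.sqrt 2 else 1) * cos ((k ord0 j)%:~R * pi * x ord0 j))); last first.
  move=> j _; rewrite mxE phiE /phi_scale absz_eq0 if_neg /trig cos_abs.
  by case: eqP.
rewrite big_split /=; congr (_ * _).
by rewrite -big_mkcond /= prodr_const /nnz mulrC powRrM powR12_sqrt // powR_mulrn ?sqrtr_ge0 //.
Qed.

Section Error.
Variables (d n L : nat) (A : set 'rV[int]_d) (z : 'I_L -> 'rV['I_n]_d).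
Hypotheses (n0 : (0 < n)%N) (finA : finite_set A) (covA : covers A z).
Variables (I : finType) (c : I -> R) (h : I -> 'rV[int]_d) (T : 'rV[R]_d -> R).
Hypothesis hT : forall t (i : nat), (T (map_mx tent (lattice_point (z t) i)))%:C =
  \sum_e (c e)%:C * cexpi (2 * pi * \sum_(j < d) (h e ord0 j)%:~R * lattice_point (z t) i ord0 j).
Variable x : 'rV[R]_d.
Hypothesis hx : T x = \sum_e c e * cos_prod (h e) x.

Let At t := fset_set (alias_free A (z t)).

Let finAt t : finite_set (alias_free A (z t)).
Proof. by apply: sub_finite_set finA => k []. Qed.

Let inAt t k : (k \in At t) = (k \in alias_free A (z t)).
Proof. exact: in_fset_set. Qed.

(** What lattice [t] contributes to the image of the cosine product with frequency [g]. *)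
Let part t (g : 'rV[int]_d) : R :=
  \sum_(k <- At t) (hdist g k (z t))%:R * (cos_prod k x / (multiplicity A z k)%:R).

Lemma A_multE : A_mult A z T x = (\sum_e c e * \sum_(t < L) part t (h e))%:C.
Proof.
rewrite /A_mult.
transitivity (\sum_(t < L) \sum_(k <- At t) \sum_e
    (c e * ((hdist (h e) k (z t))%:R * (cos_prod k x / (multiplicity A z k)%:R)))%:C).
  apply: eq_bigr => t _; rewrite fsbig_finite //=; apply: eq_bigr => k _.
  rewrite (lattice_coeffE k n0 (hT t)) phi_vec_abs -mulrA mulr_suml; apply: eq_bigr => e _.
  have p0 : 2 `^ ((nnz k)%:R / 2) != 0 :> R by rewrite gt_eqF // powR_gt0.
  set P := 2 `^ _ in p0 *; set U : R := (multiplicity A z k)%:R.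
  have -> : cos_prod k x / U = (U * P)^-1 * (P * cos_prod k x).
    by rewrite invfM -mulrA mulKf // mulrC.
  rewrite -[LHS]mulrA [RHS]rmorphM [X in _ = _ * X]rmorphM [X in _ = _ * (_ * X)]rmorphM fmorphV.
  congr (_ * (_ * _)); by case: hdist.
under eq_bigr do rewrite exchange_big /=.
rewrite exchange_big /= rmorph_sum; apply: eq_bigr => e _.
rewrite mulr_sumr rmorph_sum; apply: eq_bigr => t _.
by rewrite /part mulr_sumr rmorph_sum.
Qed.

(** Alias-free frequencies lie in distinct classes modulo [n], so [g] aliases with at most one of
    them. *)
Let part_one t (g k : 'rV[int]_d) : k \in At t -> hdist g k (z t) ->
  part t g = cos_prod k x / (multiplicity A z k)%:R.
Proof.
move=> kA gk; rewrite /part (bigD1_seq k) ?fset_uniq //= gk mul1r big1_seq ?addr0 //.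
move=> l /andP[lk lA]; rewrite /hdist; case: eqP; last by rewrite mul0r.
move=> gl; have := kA; rewrite inAt inE => -[_ /(_ l)].
have := lA; rewrite inAt inE => -[Al _] /(_ Al (elimN eqP lk)).
by move/eqP: gk => gk; rewrite -gk gl eqxx.
Qed.

Let part_zero t g : (forall k, k \in At t -> ~~ hdist g k (z t)) -> part t g = 0.
Proof. by move=> H; rewrite /part big1_seq // => k /andP[_ /H/negbTE->]; rewrite mul0r. Qed.

Let mult_gt0 t k : k \in At t -> (0 < multiplicity A z k)%N.
Proof. by rewrite inAt => kA; apply/card_gt0P; exists t. Qed.

Let part_in g : A g -> \sum_(t < L) part t g = cos_prod g x.
Proof.
move=> Ag; have [t0 _ gt0] : (\bigcup_(t in [set: 'I_L]) alias_free A (z t)) g by rewrite covA.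
have U0 : (multiplicity A z g)%:R != 0 :> R.
  by rewrite pnatr_eq0 -lt0n (@mult_gt0 t0) // inAt inE.
rewrite (eq_bigr (fun t => if g \in alias_free A (z t) then cos_prod g x / (multiplicity A z g)%:R else 0)).
  rewrite -big_mkcond /= sumr_const -[LHS]mulr_natr (_ : #|_| = multiplicity A z g) ?divfK //.
move=> t _; case: ifP => gA.
  by apply: part_one; rewrite ?inAt // /hdist eqxx.
(* A [k] aliasing with [g], which lies in [A] and differs from [k], would itself fail to be
   alias-free. *)
apply: part_zero => k kA; apply/negP => gk.
have := kA; rewrite inAt inE => -[_ /(_ g Ag)] H.
have gk' : g <> k by move=> e; move: kA; rewrite inAt -e gA.
by have := H gk'; rewrite /hdist in gk; move/eqP: gk => ->; rewrite eqxx.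
Qed.

Let part_le t g : `|part t g| <= 1.
Proof.
have [|H] := pselect (exists2 k, k \in At t & hdist g k (z t)).
  move=> [k kA gk]; rewrite (part_one kA gk) normrM normfV normr_nat.
  have U1 : 1 <= (multiplicity A z k)%:R :> R by rewrite ler1n (mult_gt0 kA).
  rewrite ler_pdivrMr ?(lt_le_trans ltr01) // mul1r (le_trans _ U1) //.
  exact: cos_prod_max.
rewrite part_zero ?normr0 // => k kA; apply/negP => gk.
by apply: H; exists k.
Qed.

(** For a frequency in [A] the covering condition makes the averaged contributions add up to its
    cosine. Any other frequency leaves its own value and at most one aliased cosine per lattice. *)
Lemma lattice_error_le : ComplexField.Normc.normc ((T x)%:C - A_mult A z T x) <=
  (1 + L%:R) * \sum_(e | h e \notin A) `|c e|.
Proof.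
rewrite A_multE hx -rmorphB -sumrB.
have -> : forall r : R, ComplexField.Normc.normc (r%:C) = `|r|.
  by move=> r; rewrite /ComplexField.Normc.normc /= expr0n /= addr0 sqrtr_sqr.
rewrite (le_trans (ler_norm_sum _ _ _)) // mulr_sumr [X in _ <= X]big_mkcond /=.
apply: ler_sum => e _; rewrite -mulrBr normrM.
case: ifP => [_|/negbFE]; last first.
  by rewrite inE => /part_in->; rewrite subrr normr0 mulr0.
rewrite mulrC ler_wpM2r // (le_trans (ler_normB _ _)) // lerD //.
  exact: cos_prod_max.
rewrite (le_trans (ler_norm_sum _ _ _)) //.
rewrite -[X in _ <= X%:R]card_ord -sumr_const; apply: ler_sum => t _; exact: part_le.
Qed.

End Error.
End LatticeError.

(** * Passage of the error to pointwise limits *)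

Section ErrorLimit.
Context {R : realType} {d : nat}.
Local Open Scope complex_scope.
Local Notation normc := ComplexField.Normc.normc.

(** Functionals using finitely many point values in the cube. The error at a point is one of them,
    so pointwise convergence of the functions suffices. *)
Let quadrature (Phi : ('rV[R]_d -> R) -> R[i]) := exists S : seq ('rV[R]_d * R[i]),
  (forall s, s \in S -> unit_cube R d s.1) /\ forall f, Phi f = \sum_(s <- S) (f s.1)%:C * s.2.

Let quadrature_sum (J : eqType) (r : seq J) (P : J -> ('rV[R]_d -> R) -> R[i]) :
  (forall j, j \in r -> quadrature (P j)) -> quadrature (fun f => \sum_(j <- r) P j f).
Proof.
elim: r => [|j r IH] H.
  by exists [::]; split => // f; rewrite !big_nil.
have [S [Sc SE]] := H j (mem_head _ _).
have [S' [Sc' SE']] := IH (fun k kr => H k (mem_behead (s := j :: r) kr)).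
exists (S ++ S'); split=> [s|f]; first by rewrite mem_cat => /orP[/Sc|/Sc'].
by rewrite big_cons big_cat /= SE SE'.
Qed.

Let quadrature_mul P w : quadrature P -> quadrature (fun f => P f * w).
Proof.
move=> [S [Sc SE]]; exists [seq (s.1, s.2 * w) | s <- S]; split=> [s|f].
  by move=> /mapP[s' s'S ->]; exact: (Sc _ s'S).
by rewrite big_map SE mulr_suml; apply: eq_bigr => s _; rewrite mulrA.
Qed.

Let quadrature_point y : unit_cube R d y -> quadrature (fun f => (f y)%:C).
Proof.
move=> yc; exists [:: (y, 1)]; split=> [s|f]; first by rewrite inE => /eqP->.
by rewrite big_seq1 mulr1.
Qed.

Lemma tent_itv (t : R) : 0 <= t <= 1 -> 0 <= tent t <= 1.
Proof.
move=> /andP[t0 t1]; rewrite /tent; case: (leP 0 (2 * t - 1)) => h.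
  by rewrite ger0_norm //; apply/andP; split; lra.
by rewrite ltr0_norm //; apply/andP; split; lra.
Qed.

Lemma lattice_point_itv n (z : 'rV['I_n]_d) i j : 0 <= (lattice_point z i ord0 j : R) <= 1.
Proof.
rewrite mxE /frac_part; set u := _ / _.
have := floor_le u; have := floorD1_gt u; rewrite intrD /= => h1 h2.
by apply/andP; split; lra.
Qed.

Let quadrature_A_mult A n L (z : 'I_L -> 'rV['I_n]_d) (x : 'rV[R]_d) :
  finite_set A -> quadrature (fun f => A_mult A z f x).
Proof.
move=> finA; apply: quadrature_sum => t _.
have fint : finite_set (alias_free A (z t)) by apply: sub_finite_set finA => k [].
rewrite (_ : (fun f => _) = fun f => \sum_(k <- fset_set (alias_free A (z t)))
    lattice_coeff (z t) f k / ((multiplicity A z k)%:R * 2 `^ ((nnz k)%:R / 2))%:C *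
    (phi_vec (abs_vec k) x)%:C); last by apply/funext => f; rewrite fsbig_finite.
apply: quadrature_sum => k _.
apply: quadrature_mul; apply: quadrature_mul.
have -> : (fun f : 'rV[R]_d -> R => lattice_coeff (z t) f k) = (fun f : 'rV[R]_d -> R => (\sum_(i < n)
    (f (map_mx tent (lattice_point (z t) i)))%:C *
    cexpi (- (2 * pi * \sum_(j < d) (k ord0 j)%:~R * lattice_point (z t) i ord0 j))) * (n%:R)^-1).
  by apply/funext => f; rewrite mulrC.
apply: quadrature_mul; apply: quadrature_sum => i _; apply: quadrature_mul.
by apply: quadrature_point => j; rewrite mxE; apply: tent_itv; exact: lattice_point_itv.
Qed.

Lemma error_cvg A n L (z : 'I_L -> 'rV['I_n]_d) (x : 'rV[R]_d)
    (F : nat -> 'rV[R]_d -> R) (f : 'rV[R]_d -> R) : finite_set A -> unit_cube R d x ->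
  (forall y, unit_cube R d y -> F m y @[m --> \oo] --> f y) ->
  normc ((F m x)%:C - A_mult A z (F m) x) @[m --> \oo] -->
  (normc ((f x)%:C - A_mult A z f x) : R).
Proof.
move=> finA xc cF.
have : quadrature (fun f => (f x)%:C - A_mult A z f x).
  have [S [Sc SE]] := quadrature_A_mult z x finA.
  have [S1 [S1c S1E]] := quadrature_point xc.
  have [S2 [S2c S2E]] := quadrature_mul (-1) (quadrature_A_mult z x finA).
  exists (S1 ++ S2); split=> [s|g]; first by rewrite mem_cat => /orP[/S1c|/S2c].
  by rewrite big_cat /= -S1E -S2E mulrN1.
move=> [S [Sc SE]].
have RE (g : 'rV[R]_d -> R) : normc ((g x)%:C - A_mult A z g x) =
   Num.sqrt ((\sum_(s <- S) g s.1 * complex.Re s.2) ^+ 2 + (\sum_(s <- S) g s.1 * complex.Im s.2) ^+ 2).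
  rewrite SE; have -> : \sum_(s <- S) (g s.1)%:C * s.2 =
     (\sum_(s <- S) g s.1 * complex.Re s.2) +i* (\sum_(s <- S) g s.1 * complex.Im s.2).
    elim: (S) => [|s S' IH]; first by rewrite !big_nil.
    rewrite !big_cons IH; case: s => y [a b] /=; simpc.
    by [].
  by [].
under eq_fun do rewrite RE.
rewrite RE; apply: (@continuous_cvg _ _ _ _ _ _ (@Num.sqrt R)); first exact: sqrt_continuous.
have cs (h : R[i] -> R) : \sum_(s <- S) F m s.1 * h s.2 @[m --> \oo] --> \sum_(s <- S) f s.1 * h s.2.
  elim: (S) Sc => [_|s S' IH Sc'].
    by under eq_fun do rewrite big_nil; rewrite big_nil; exact: cvg_cst.
  under eq_fun do rewrite big_cons; rewrite big_cons; apply: cvgD.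
    by apply: cvgMl; apply: cF; apply: Sc'; exact: mem_head.
  by apply: IH => s' s'S; apply: Sc'; rewrite inE s'S orbT.
by apply: cvgD; under eq_fun do rewrite expr2; rewrite expr2; apply: cvgM; exact: cs.
Qed.

End ErrorLimit.

(** * Two-sided expansions and the tent transformation *)

Section BoxExpansion.
Context {R : realType}.
Local Open Scope complex_scope.

Lemma sum_signed (V : zmodType) (n : nat) (F : int -> V) :
  \sum_(i < n.*2.+1) F (i%:Z - n%:Z) = F 0 + \sum_(k < n) (F k.+1%:Z + F (- k.+1%:Z)).
Proof.
elim: n => [|n IH]; first by rewrite big_ord0 addr0 double0 big_ord1; congr F.
rewrite doubleS big_ord_recl big_ord_recr /= [in RHS]big_ord_recr /= !addrA -IH.
have -> : \sum_(i < n.*2.+1) F ((bump 0 i)%:Z - n.+1%:Z) = \sum_(i < n.*2.+1) F (i%:Z - n%:Z).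
  apply: eq_bigr => i _; congr F; rewrite /bump leq0n add1n.
  by rewrite -!natz -!natr1 opprD addrACA subrr addr0.
have -> : F (0%:Z - n.+1%:Z) = F (- n.+1%:Z) by rewrite sub0r.
have -> : F ((bump 0 n.*2.+1)%:Z - n.+1%:Z) = F n.+1%:Z by congr F; apply/eqP; rewrite /bump leq0n add1n subr_eq -PoszD; apply/eqP; congr Posz; rewrite -addnn; lia.
by rewrite [F (- _) + _]addrC -addrA [F (- _) + _]addrC addrA.
Qed.

(** Splits a term evenly between [k] and [- k]: [a k sqrt 2 cos] is twice [(a k / sqrt 2) cos].
    Since the two squares add up to [a k ^+ 2], energies are preserved as well. *)
Definition signed_coef (a : nat -> R) (h : int) : R := a `|h|%N / phi_scale `|h|%N.

Lemma signed_coefN a h : signed_coef a (- h) = signed_coef a h.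
Proof. by rewrite /signed_coef abszN. Qed.

Lemma cos_series_signed n a (x : R) : cos_series n.+1 a x =
  \sum_(i < n.*2.+1) signed_coef a (i%:Z - n%:Z) * cos ((i%:Z - n%:Z)%:~R * pi * x).
Proof.
rewrite (sum_signed n (fun h => signed_coef a h * cos (h%:~R * pi * x))).
rewrite /cos_series big_ord_recl /signed_coef /= /phi /phi_scale /= divr1 !mul0r cos0; congr (_ + _).
apply: eq_bigr => k _; rewrite /bump leq0n add1n mulrNz !mulNr cosN -pmulrn -mulr2n -[RHS]mulr_natl.
have s2 : Num.sqrt 2 * Num.sqrt 2 = 2 :> R by rewrite -expr2 sqr_sqrtr.
have s0 : Num.sqrt 2 != 0 :> R by rewrite gt_eqF // sqrtr_gt0.
by rewrite -{2}s2 !mulrA; congr (_ * _); field.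
Qed.

(** On the folded half [tent y = 2 - 2 y], and the cosine is even with period [2 pi]. *)
Lemma cos_tent (k : nat) (y : R) : 0 <= y <= 1 -> cos (k%:R * pi * tent y) = cos (2 * pi * (k%:R * y)).
Proof.
move=> /andP[y0 y1]; rewrite /tent; case: (leP 0 (2 * y - 1)) => h.
  rewrite ger0_norm // (_ : k%:R * pi * (1 - (2 * y - 1)) = - (2 * pi * (k%:R * y)) + 2 * pi * k%:~R).
    have := cexpi_int (R := R) k%:Z; rewrite -pmulrn => -[c s].
    by rewrite cosD c s mulr1 mulr0 subr0 cosN.
  by rewrite -pmulrn; set p := pi; ring.
by rewrite ltr0_norm //; congr cos; set p := pi; ring.
Qed.

Lemma cos_series_tent n a (y : R) : 0 <= y <= 1 -> (cos_series n.+1 a (tent y))%:C =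
  \sum_(i < n.*2.+1) (signed_coef a (i%:Z - n%:Z))%:C * cexpi (2 * pi * ((i%:Z - n%:Z)%:~R * y)).
Proof.
move=> y01.
rewrite (sum_signed n (fun h => (signed_coef a h)%:C * cexpi (2 * pi * (h%:~R * y)))).
rewrite /cos_series big_ord_recl rmorphD rmorph_sum /=; congr (_ + _).
  by rewrite /signed_coef /phi /phi_scale /= divr1 mulr1 mul0r mulr0 cexpi0 mulr1.
apply: eq_bigr => k _; rewrite signed_coefN -mulrDr /bump leq0n add1n.
have -> : cexpi (2 * pi * ((k.+1%:Z)%:~R * y)) + cexpi (2 * pi * ((- k.+1%:Z)%:~R * y)) =
   (2 * cos (2 * pi * (k.+1%:R * y)))%:C.
  rewrite mulrNz -pmulrn mulNr mulrN /cexpi cosN sinN.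
  by apply/eqP; rewrite eq_complex /=; apply/andP; split; apply/eqP; ring.
rewrite -rmorphM; congr (_%:C).
rewrite /phi /signed_coef /phi_scale /= cos_tent //.
have s2 : Num.sqrt 2 * Num.sqrt 2 = 2 :> R by rewrite -expr2 sqr_sqrtr.
have s0 : Num.sqrt 2 != 0 :> R by rewrite gt_eqF // sqrtr_gt0.
move: s2 s0; move: (Num.sqrt 2) (cos _) (a _) => w c b s2 s0.
by rewrite -s2; field.
Qed.

Lemma energy_signed n (r a a' : nat -> R) :
  \sum_(k < n.+1) r k ^+ 2 * (a k * a' k) =
  \sum_(i < n.*2.+1) r `|i%:Z - n%:Z|%N ^+ 2 *
     (signed_coef a (i%:Z - n%:Z) * signed_coef a' (i%:Z - n%:Z)).
Proof.
rewrite (sum_signed n (fun h => r `|h|%N ^+ 2 * (signed_coef a h * signed_coef a' h))).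
rewrite big_ord_recl /signed_coef /phi_scale /= !divr1; congr (_ + _).
apply: eq_bigr => k _; rewrite /bump leq0n add1n /=.
have s2 : Num.sqrt 2 ^+ 2 = 2 :> R by rewrite sqr_sqrtr.
have s0 : Num.sqrt 2 != 0 :> R by rewrite gt_eqF // sqrtr_gt0.
rewrite -mulr2n -[RHS]mulr_natl; move: s2 s0; move: (Num.sqrt 2) => w s2 s0.
by rewrite -[2%:R in RHS]s2; field; rewrite ?s0.
Qed.

End BoxExpansion.

(** * Zeta sums and rearrangement of the tail *)

Section TailSum.
Context {R : realType}.

(** The discrete integral comparison: for [q = m / (m + 1)], [ln q <= - 1 / (m + 1)] yields
    [q ^ (1 - s) >= 1 + (s - 1) / (m + 1)]. *)
Lemma powR_step (s : R) (m : nat) : 1 < s -> (0 < m)%N ->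
  m.+1%:R `^ (- s) <= (m%:R `^ (1 - s) - m.+1%:R `^ (1 - s)) / (s - 1).
Proof.
move=> s1 m0; have m1 : 0 < m.+1%:R :> R by rewrite ltr0n.
have mR : 0 < m%:R :> R by rewrite ltr0n.
have s0 : 0 < s - 1 by rewrite subr_gt0.
rewrite ler_pdivlMr //.
have e1 : m.+1%:R `^ (- s) = m.+1%:R `^ (1 - s) * m.+1%:R^-1 :> R.
  by rewrite -powR_inv1 ?ltW // -powRD ?(gt_eqF m1) ?implybT //; congr (_ `^ _); ring.
set q : R := m%:R / m.+1%:R; have q0 : 0 < q by rewrite divr_gt0.
have e2 : m%:R `^ (1 - s) = m.+1%:R `^ (1 - s) * q `^ (1 - s) :> R.
  by rewrite -powRM ?ltW // /q mulrCA mulfV ?mulr1 // gt_eqF.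
have hq : 1 + (s - 1) / m.+1%:R <= q `^ (1 - s).
  rewrite /powR gt_eqF //; apply: le_trans (expR_ge1Dx _); rewrite lerD2l.
  have lq : ln q <= - m.+1%:R^-1.
    have := expR_ge1Dx (ln q); rewrite lnK ?posrE // => lq.
    have qe : q = 1 - m.+1%:R^-1 by rewrite /q -[m.+1%:R]natr1; field; rewrite natr1 gt_eqF.
    by rewrite -(lerD2l 1) -qe.
  by have := ler_wpM2l (ltW s0) lq; rewrite mulrN lerNr -mulNr opprB.
rewrite e1 e2; move: (m.+1%:R `^ (1 - s)) (powR_ge0 m.+1%:R (1 - s)) => X X0.
rewrite -mulrA lerBrDr addrC.
by have := ler_wpM2l X0 hq; rewrite mulrDr mulr1 [_^-1 * _]mulrC.
Qed.

Lemma powR_tail (s : R) (a b : nat) : 1 < s -> (0 < a)%N ->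
  \sum_(k < b) (a + k).+1%:R `^ (- s) <= (a%:R `^ (1 - s) - (a + b)%:R `^ (1 - s)) / (s - 1).
Proof.
move=> s1 a0; elim: b => [|b IH]; first by rewrite big_ord0 addn0 subrr mul0r.
rewrite big_ord_recr /= addnS.
have := powR_step s1 (ltn_addr b a0); move: IH; rewrite !mulrBl; lra.
Qed.

(** Boundedness of the partial sums ensures that the [limn] in [zeta] is a true limit, hence their
    upper bound. *)
Lemma zeta_partial_le (s : R) (n : nat) : 1 < s ->
  \sum_(k < n) k.+1%:R `^ (- s) <= zeta s.
Proof.
move=> s1.
pose u : nat -> R := series (fun k : nat => k.+1%:R `^ (- s)).
have uE m : u m = \sum_(k < m) k.+1%:R `^ (- s) by rewrite /u /series /= big_mkord.
have nd : nondecreasing_seq u.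
  by apply/nondecreasing_seqP => m; rewrite !uE big_ord_recr /= lerDl powR_ge0.
have bd m : u m <= 1 + (s - 1)^-1.
  rewrite uE; case: m => [|m]; first by rewrite big_ord0 addr_ge0 // invr_ge0 subr_ge0 ltW.
  rewrite big_ord_recl /= powR1 lerD2l.
  have := powR_tail m s1 (ltn0Sn 0); rewrite powR1.
  rewrite (eq_bigr (fun k : 'I_m => (bump 0 k).+1%:R `^ (- s))); last by move=> k _; rewrite /bump leq0n.
  move/le_trans; apply; rewrite -[X in _ <= X]mul1r ler_wpM2r ?invr_ge0 ?subr_ge0 ?ltW //.
have cu : cvgn u.
  apply: nondecreasing_is_cvgn => //; exists (1 + (s - 1)^-1) => _ [m _ <-]; exact: bd.
by rewrite -uE; exact: nondecreasing_cvgn_le.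
Qed.

Section Rearrangement.
Variables (T : eqType) (r : T -> R) (lambda V : R) (A : seq T).
Hypotheses (hl : 2^-1 < lambda) (A0 : (0 < size A)%N) (r0 : forall h, 0 < r h).
Hypothesis sumV : forall X : seq T, uniq X -> \sum_(h <- X) r h `^ (- lambda^-1) <= V.

Let exists_max (s : seq T) : (0 < size s)%N -> exists2 h, h \in s & forall g, g \in s -> r g <= r h.
Proof.
elim: s => // a [|b s] IH _; first by exists a; rewrite ?mem_head // => g; rewrite inE => /eqP->.
have [//|h hs hm] := IH; case: (leP (r h) (r a)) => ha.
  exists a; first exact: mem_head.
  by move=> g; rewrite inE => /predU1P[->//|/hm/le_trans]; apply.
exists h; first by rewrite inE hs orbT.
by move=> g; rewrite inE => /predU1P[->|/hm//]; exact: ltW.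
Qed.

(* With m elements of smaller or equal weight, the bound on the sum forces
   [r h `^ (-2) <= (V / m) `^ (2 * lambda)]. *)
Lemma tail_energy_le (B : seq T) : uniq (A ++ B) ->
  (forall a b, a \in A -> b \in B -> r a <= r b) ->
  \sum_(h <- B) (r h ^+ 2)^-1 <=
  V `^ (2 * lambda) * ((size A)%:R `^ (1 - 2 * lambda) / (2 * lambda - 1)).
Proof.
move=> uAB AB; have l0 : 0 < lambda by rewrite (lt_trans _ hl).
have s1 : 1 < 2 * lambda by move: hl; lra.
have V0 : 0 <= V by have := sumV (X := [::]) isT; rewrite big_nil.
suff : \sum_(h <- B) (r h ^+ 2)^-1 <=
    V `^ (2 * lambda) * \sum_(k < size B) (size A + k).+1%:R `^ (- (2 * lambda)).
  move/le_trans; apply; rewrite ler_wpM2l ?powR_ge0 //.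
  apply: le_trans (powR_tail _ s1 A0) _.
  by rewrite ler_wpM2r ?invr_ge0 ?subr_ge0 ?(ltW s1) // gerBl powR_ge0.
(* The heaviest element of [B] is split off: all [size A + n + 1] elements present have at most its
   weight, which gives the last term of the sum. *)
elim: {B}(size B) {-2}B (erefl (size B)) uAB AB => [|n IH] B sB uAB AB.
  by rewrite (size0nil sB) big_nil big_ord0 mulr0.
have B0 : (0 < size B)%N by rewrite sB.
have [h hB hm] := exists_max B0.
have uB : uniq B by move: uAB; rewrite cat_uniq => /and3P[].
have pB := perm_to_rem hB.
rewrite (perm_big _ pB) big_cons /= sB big_ord_recr /= mulrDr addrC.
have sB' : size (rem h B) = n by rewrite size_rem // sB.
apply: lerD.
  rewrite -sB'; apply: IH => //.
    move: uAB; rewrite !cat_uniq => /and3P[-> /= hAB _]; rewrite rem_uniq // andbT.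
    by apply: contra hAB => /hasP[x xB xA]; apply/hasP; exists x => //; exact: mem_rem xB.
  by move=> a b aA /mem_rem bB; exact: AB.
have key : (size A + n).+1%:R * r h `^ (- lambda^-1) <= V.
  apply: le_trans (sumV uAB).
  have -> : (size A + n).+1 = size (A ++ B) by rewrite size_cat sB addnS.
  have sz (X : seq T) (c : R) (F : T -> R) : (forall g, g \in X -> c <= F g) ->
      (size X)%:R * c <= \sum_(g <- X) F g.
    elim: X => [|g X IHX] H; first by rewrite big_nil mul0r.
    rewrite big_cons /= -natr1 mulrDl mul1r addrC lerD ?H ?mem_head //.
    by apply: IHX => g' g'X; apply: H; rewrite inE g'X orbT.
  apply: sz => g; rewrite mem_cat => gX.
  have gh : r g <= r h by case/orP: gX => [gA|/hm//]; exact: AB.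
  rewrite !powRN lef_pV2 ?posrE ?powR_gt0 //.
  by apply: ge0_ler_powR; rewrite ?nnegrE ?invr_ge0 ?(ltW l0) ?(ltW (r0 _)).
have m0 : 0 < (size A + n).+1%:R :> R by rewrite ltr0n.
have rl : r h `^ (- lambda^-1) <= V / (size A + n).+1%:R by rewrite ler_pdivlMr // mulrC.
have -> : (r h ^+ 2)^-1 = (r h `^ (- lambda^-1)) `^ (2 * lambda).
  rewrite -powRrM (_ : - lambda^-1 * (2 * lambda) = - 2%:R); last by field; rewrite gt_eqF.
  by rewrite powRN powR_mulrn // ltW.
apply: (@le_trans _ _ ((V / (size A + n).+1%:R) `^ (2 * lambda))).
  by apply: ge0_ler_powR; rewrite ?nnegrE ?powR_ge0 ?divr_ge0 // ?(ltW m0) ?mulr_ge0 // ltW.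
rewrite powRM ?invr_ge0 ?(ltW m0) //.
by rewrite -powR_inv1 ?(ltW m0) // -powRrM mulN1r.
Qed.

End Rearrangement.
End TailSum.

(** * Weight sums over boxes of frequencies *)

Section HyperbolicCross.
Context {R : realType}.

Definition box_vec d N (e : {ffun 'I_d -> 'I_(N.*2.+1)}) : 'rV[int]_d :=
  \row_j ((e j)%:Z - N%:Z).

Lemma box_vec_inj d N : injective (@box_vec d N).
Proof.
move=> e e' /rowP he; apply/ffunP => j; apply/val_inj.
by have := he j; rewrite !mxE => /addIr[].
Qed.

Lemma box_vec_onto d N (k : 'rV[int]_d) : (forall j, (`|k ord0 j| <= N)%N) ->
  exists e : {ffun 'I_d -> 'I_(N.*2.+1)}, box_vec e = k.
Proof.
move=> hk; exists [ffun j => inord (absz (k ord0 j + N%:Z)) : 'I_(N.*2.+1)].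
apply/rowP => j; rewrite !mxE ffunE (ord1 0).
by have := hk j; move: (k ord0 j) => v hv; rewrite inordK -?addnn; lia.
Qed.

Lemma r_wt_gt0 (alpha gamma : R) k : 0 < gamma -> 0 < r_wt alpha gamma k.
Proof.
by move=> g0; rewrite /r_wt; case: posnP => // k0; rewrite mulr_gt0 ?invr_gt0 ?powR_gt0 ?ltr0n.
Qed.

Lemma prod_powR (I : Type) (s : seq I) (F : I -> R) (a : R) : (forall i, 0 <= F i) ->
  (\prod_(i <- s) F i) `^ a = \prod_(i <- s) F i `^ a.
Proof.
move=> F0; elim: s => [|i s IH]; first by rewrite !big_nil powR1.
by rewrite !big_cons powRM ?IH // prodr_ge0.
Qed.

Lemma line_sum_le (alpha lambda g : R) N : 0 < lambda -> lambda < alpha -> 0 < g ->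
  \sum_(i < N.*2.+1) r_wt alpha g `|i%:Z - N%:Z|%N `^ (- lambda^-1) <=
  1 + 2 * g `^ lambda^-1 * zeta (alpha / lambda).
Proof.
move=> l0 la g0; rewrite (sum_signed N (fun h => r_wt alpha g `|h|%N `^ (- lambda^-1))).
rewrite {1}/r_wt /= powR1 lerD2l.
have s1 : 1 < alpha / lambda by rewrite ltr_pdivlMr // mul1r.
have h (k : nat) : r_wt alpha g k.+1 `^ (- lambda^-1) = g `^ lambda^-1 * k.+1%:R `^ (- (alpha / lambda)).
  rewrite /r_wt /= powRM ?invr_ge0 ?powR_ge0 ?(ltW g0) //.
  by rewrite -powR_inv1 ?(ltW g0) // -!powRrM mulrNN mul1r mulrN.
rewrite (eq_bigr (fun k : 'I_N => 2 * g `^ lambda^-1 * k.+1%:R `^ (- (alpha / lambda)))).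
  by rewrite -mulr_sumr ler_wpM2l ?mulr_ge0 ?powR_ge0 // zeta_partial_le.
by move=> k _; rewrite !h -mulrA mulr_natl.
Qed.

(** A finite family lies in a symmetric box, over which the sum of products factors into
    one-dimensional sums. *)
Lemma cross_sum_le d (alpha lambda : R) (g : 'I_d -> R) (X : seq 'rV[int]_d) :
  0 < lambda -> lambda < alpha -> (forall j, 0 < g j) -> uniq X ->
  \sum_(h <- X) r_wt_vec alpha g (abs_vec h) `^ (- lambda^-1) <=
  \prod_(j < d) (1 + 2 * g j `^ lambda^-1 * zeta (alpha / lambda)).
Proof.
move=> l0 la g0 uX.
pose N := (\max_(h <- X) \max_(j < d) `|h ord0 j|)%N.
have XN h : h \in X -> exists e : {ffun 'I_d -> 'I_(N.*2.+1)}, box_vec e = h.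
  move=> hX; apply: box_vec_onto => j.
  apply: (@leq_trans (\max_(j < d) `|h ord0 j|)%N).
    exact: (@leq_bigmax _ (fun j : 'I_d => `|h ord0 j|%N)).
  exact: (leq_bigmax_seq (F := fun h : 'rV[int]_d => \max_(j < d) `|h ord0 j|%N) h hX isT).
pose F (h : 'rV[int]_d) := r_wt_vec alpha g (abs_vec h) `^ (- lambda^-1).
have F0 h : 0 <= F h by exact: powR_ge0.
apply: (@le_trans _ _ (\sum_(e : {ffun 'I_d -> 'I_(N.*2.+1)}) F (box_vec e))).
  rewrite -(big_map (@box_vec d N) xpredT F) [leRHS](bigID [in X]) /=.
  rewrite ler_wpDr ?sumr_ge0 //.
  rewrite -[leRHS]big_filter le_eqVlt; apply/orP; left.
  apply/eqP; apply: perm_big; apply: uniq_perm => //; first by rewrite filter_uniq // (map_inj_uniq (@box_vec_inj d N)) index_enum_uniq.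
  move=> h; rewrite mem_filter; case: (boolP (h \in X)) => //= /XN[e <-].
  by rewrite map_f // mem_index_enum.
have FE e : F (@box_vec d N e) = \prod_(j < d) r_wt alpha (g j) `|(e j)%:Z - N%:Z|%N `^ (- lambda^-1).
  rewrite /F /r_wt_vec prod_powR => [|j]; last exact/ltW/r_wt_gt0.
  by apply: eq_bigr => j _; rewrite !mxE.
rewrite (eq_bigr _ (fun e _ => FE e)).
rewrite -(bigA_distr_bigA (fun (j : 'I_d) (i : 'I_(N.*2.+1)) => r_wt alpha (g j) `|i%:Z - N%:Z|%N `^ (- lambda^-1))).
apply: ler_prod => j _; rewrite sumr_ge0 //=; first exact: line_sum_le.
by move=> i _; exact: powR_ge0.
Qed.

End HyperbolicCross.

(** * Tensor products of cosine polynomials on a box *)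

Section BoxPolynomials.
Context {R : realType} {d P : nat}.
Local Open Scope complex_scope.
Variables (N : nat) (w : 'I_P -> R) (a : 'I_d -> 'I_P -> nat -> R).

Definition box_coef (h : 'rV[int]_d) : R :=
  \sum_p w p * \prod_(j < d) signed_coef (a j p) (h ord0 j).

Definition cos_tensor (x : 'rV[R]_d) : R :=
  \sum_p w p * \prod_(j < d) cos_series N.+1 (a j p) (x ord0 j).

Local Notation box := {ffun 'I_d -> 'I_(N.*2.+1)}.

Lemma cos_tensorE x : cos_tensor x = \sum_(e : box) box_coef (box_vec e) * cos_prod (box_vec e) x.
Proof.
rewrite /cos_tensor; under eq_bigr do under eq_bigr do rewrite cos_series_signed.
under eq_bigr do rewrite bigA_distr_bigA mulr_sumr.
rewrite exchange_big /=; apply: eq_bigr => e _; rewrite mulr_suml; apply: eq_bigr => p _.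
rewrite -mulrA; congr (_ * _); rewrite -big_split /=; apply: eq_bigr => j _.
by rewrite mxE.
Qed.

Lemma cexpi_sum (I : finType) (F : I -> R) : cexpi (\sum_i F i) = \prod_i cexpi (F i).
Proof. exact: (big_morph _ (@cexpiD R) (@cexpi0 R)). Qed.

Lemma cos_tensor_tent (y : 'rV[R]_d) : unit_cube R d y ->
  (cos_tensor (map_mx tent y))%:C = \sum_(e : box) (box_coef (box_vec e))%:C *
    cexpi (2 * pi * \sum_(j < d) (box_vec e ord0 j)%:~R * y ord0 j).
Proof.
move=> yc; rewrite /cos_tensor rmorph_sum /=.
have H p : (w p * \prod_(j < d) cos_series N.+1 (a j p) (map_mx tent y ord0 j))%:C =
  \sum_(e : box) (w p * \prod_(j < d) signed_coef (a j p) (box_vec e ord0 j))%:C *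
    cexpi (2 * pi * \sum_(j < d) (box_vec e ord0 j)%:~R * y ord0 j).
  rewrite rmorphM rmorph_prod /=.
  under eq_bigr do rewrite mxE cos_series_tent ?yc //.
  rewrite bigA_distr_bigA mulr_sumr; apply: eq_bigr => e _.
  rewrite rmorphM rmorph_prod /= -[RHS]mulrA; congr (_ * _).
  rewrite mulr_sumr cexpi_sum -big_split /=; apply: eq_bigr => j _.
  by rewrite mxE.
under eq_bigr do rewrite H.
rewrite exchange_big /=; apply: eq_bigr => e _; rewrite -mulr_suml; congr (_ * _).
by rewrite rmorph_sum.
Qed.

(** Parseval's identity: Gram products that factor over the coordinates become weighted squares of
    box coefficients. *)
Lemma box_energy (r : 'I_d -> nat -> R) :
  \sum_p \sum_q w p * w q * \prod_(j < d) (\sum_(k < N.+1) r j k ^+ 2 * (a j p k * a j q k)) =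
  \sum_(e : box) (\prod_(j < d) r j `|box_vec e ord0 j|%N * box_coef (box_vec e)) ^+ 2.
Proof.
under eq_bigr do under eq_bigr do under eq_bigr do rewrite energy_signed.
under eq_bigr do under eq_bigr do rewrite bigA_distr_bigA mulr_sumr.
under eq_bigr do rewrite exchange_big.
rewrite exchange_big /=; apply: eq_bigr => e _.
rewrite exprMn [X in _ * X]expr2 /box_coef mulr_suml mulr_sumr; apply: eq_bigr => p _.
rewrite mulr_sumr mulr_sumr; apply: eq_bigr => q _.
transitivity (w p * w q * ((\prod_(j < d) r j `|box_vec e ord0 j|%N) ^+ 2 *
    ((\prod_(j < d) signed_coef (a j p) (box_vec e ord0 j)) *
     \prod_(j < d) signed_coef (a j q) (box_vec e ord0 j)))).
  by rewrite -prodrXl -!big_split /=; congr (_ * _); apply: eq_bigr => j _; rewrite mxE.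
by move: (\prod_(j < d) _) (\prod_(j < d) _) (\prod_(j < d) _) => x y z; ring.
Qed.

End BoxPolynomials.

(** * Simultaneous approximation in all coordinates *)

Section TensorApproximation.
Context {R : realType} {d : nat}.

Lemma sum_pad (n m : nat) (F : nat -> R) : (n <= m)%N ->
  \sum_(k < m) (if (k < n)%N then F k else 0) = \sum_(k < n) F k.
Proof. by move=> nm; rewrite (big_ord_widen m) // [RHS]big_mkcond. Qed.

(** Padding with zero coefficients gives all coordinates a common degree, with the positive length
    required by the two-sided expansion. *)
Lemma family_approx (alpha : R) (gamma : 'I_d -> R) P (u : 'I_P -> 'I_d -> R -> R) :
  2^-1 < alpha < 2 -> (forall i j, sob_space1 alpha (gamma j) (u i j)) ->
  exists (N : nat -> nat) (a : nat -> 'I_d -> 'I_P -> nat -> R)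
    (E : nat -> 'I_d -> 'I_P -> 'I_P -> R),
  [/\ forall m j, schur (E m j),
      forall i j y, 0 <= y <= 1 -> cos_series (N m).+1 (a m j i) y @[m --> \oo] --> u i j y &
      forall j p q, \sum_(k < (N m).+1) r_wt alpha (Gamma_wt alpha gamma j) k ^+ 2 *
          (a m j p k * a m j q k) + E m j p q @[m --> \oo] -->
          sob_ip1 alpha (gamma j) (u p j) (u q j)].
Proof.
move=> ha hu.
have hj j : cos_approx alpha (gamma j) (fun i => u i j) by apply: sob_approx => // i; exact: hu.
have [n /choice[a /choice[E H]]] := choice hj.
pose N m := (\max_(j < d) n j m)%N.
have nN j m : (n j m <= (N m).+1)%N.
  by apply: leqW; exact: (@leq_bigmax _ (fun j : 'I_d => n j m)).
exists N, (fun m j i k => if (k < n j m)%N then a j m i k else 0), (fun m j => E j m).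
split=> [m j|i j y y01|j p q]; have [H1 H2 H3] := H j; first exact: H1.
  rewrite [X in X @ _ --> _](_ : _ = fun m => cos_series (n j m) (a j m i) y); first exact: H2.
  apply/funext => m; rewrite /cos_series -(sum_pad (fun k => a j m i k * phi k y) (nN j m)).
  by apply: eq_bigr => k _; case: ifP => // _; rewrite mul0r.
rewrite [X in X @ _ --> _](_ : _ = fun m =>
  \sum_(k < n j m) r_wt alpha (Gamma_wt alpha gamma j) k ^+ 2 * (a j m p k * a j m q k) + E j m p q).
  exact: H3.
apply/funext => m; congr (_ + _).
rewrite -(sum_pad (fun k => r_wt alpha (Gamma_wt alpha gamma j) k ^+ 2 * (a j m p k * a j m q k)) (nN j m)).
by apply: eq_bigr => k _; case: ifP => // _; rewrite mul0r mulr0.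
Qed.

End TensorApproximation.

(** * Error of the algorithm on cosine tensors *)

Section TensorError.
Context {R : realType} {d : nat}.
Local Open Scope complex_scope.
Local Notation normc := ComplexField.Normc.normc.
Variables (alpha : R) (gamma : 'I_d -> R).
Hypothesis ha : 2^-1 < alpha < 2.

Lemma cauchy_schwarz_sum (I : Type) (s : seq I) (F G : I -> R) :
  (\sum_(i <- s) F i * G i) ^+ 2 <= (\sum_(i <- s) F i ^+ 2) * \sum_(i <- s) G i ^+ 2.
Proof.
have : 0 <= \sum_(i <- s) \sum_(j <- s) (F i * G j - F j * G i) ^+ 2.
  by apply: sumr_ge0 => i _; apply: sumr_ge0 => j _; exact: sqr_ge0.
rewrite (eq_bigr (fun i => F i ^+ 2 * (\sum_(j <- s) G j ^+ 2) +
  (G i ^+ 2 * (\sum_(j <- s) F j ^+ 2) - 2 * (F i * G i) * \sum_(j <- s) F j * G j))).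
  rewrite big_split sumrB -!mulr_suml -mulr_sumr /=.
  by move: (\sum_(i <- s) _) (\sum_(i <- s) _) (\sum_(i <- s) _) => x y w; nra.
move=> i _; rewrite !mulr_sumr -sumrB -big_split /=; apply: eq_bigr => j _; ring.
Qed.

Let r (h : 'rV[int]_d) : R := r_wt_vec alpha (Gamma_wt alpha gamma) (abs_vec h).

Section Algorithm.
Variables (n L : nat) (A : set 'rV[int]_d) (z : 'I_L -> 'rV['I_n]_d) (tail : R).
Hypotheses (n0 : (0 < n)%N) (finA : finite_set A) (covA : covers A z).
Hypothesis r0 : forall h, 0 < r h.
Hypothesis tail_le : forall X, uniq X -> (forall h, h \in X -> ~ A h) ->
  \sum_(h <- X) (r h ^+ 2)^-1 <= tail.

(** The energy is kept as a double sum of coordinatewise Gram products, the form in which it can be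
    compared with [tensor_ip]. *)
Lemma cos_tensor_error P N (w : 'I_P -> R) a x : unit_cube R d x ->
  normc ((cos_tensor N w a x)%:C - A_mult A z (cos_tensor N w a) x) <=
  (1 + L%:R) * (Num.sqrt tail * Num.sqrt (\sum_p \sum_q w p * w q *
    \prod_(j < d) (\sum_(k < N.+1) r_wt alpha (Gamma_wt alpha gamma j) k ^+ 2 * (a j p k * a j q k)))).
Proof.
move=> xc; apply: le_trans (lattice_error_le (h := @box_vec d N)
  (c := fun e => box_coef w a (box_vec e)) n0 finA covA _ (cos_tensorE N w a x)) _.
  move=> t i; rewrite cos_tensor_tent // => j; exact: lattice_point_itv.
rewrite ler_wpM2l ?addr_ge0 //.
rewrite (box_energy N w a (fun j k => r_wt alpha (Gamma_wt alpha gamma j) k)).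
pose c e := box_coef w a (@box_vec d N e).
rewrite (_ : \sum_e _ ^+ 2 = \sum_e (r (box_vec e) * c e) ^+ 2); last first.
  apply: eq_bigr => e _; congr ((_ * _) ^+ 2).
  by apply: eq_bigr => j _; rewrite [in RHS]mxE.
have tail0 : 0 <= tail.
  by have := tail_le (X := [::]) isT; rewrite big_nil; apply.
rewrite -sqrtrM // -[leLHS]ger0_norm ?sumr_ge0 // -sqrtr_sqr ler_sqrt; last first.
  by rewrite mulr_ge0 ?sumr_ge0 // => e _; exact: sqr_ge0.
rewrite -big_filter.
rewrite (eq_bigr (fun e => (r (box_vec e))^-1 * (r (box_vec e) * `|c e|))); last first.
  by move=> e _; rewrite mulKf // gt_eqF.
apply: le_trans (cauchy_schwarz_sum _ _ _) _.
apply: ler_pM; try by apply: sumr_ge0 => e _; exact: sqr_ge0.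
  rewrite (eq_bigr (fun e => (r (box_vec e) ^+ 2)^-1)); last by move=> e _; rewrite exprVn.
  rewrite -(big_map (@box_vec d N) xpredT (fun h => (r h ^+ 2)^-1)).
  apply: tail_le.
    by rewrite (map_inj_uniq (@box_vec_inj d N)) filter_uniq // index_enum_uniq.
  by move=> h /mapP[e]; rewrite mem_filter => /andP[+ _] -> /mem_set hA; rewrite hA.
rewrite big_filter [leRHS](bigID (fun e => box_vec e \notin A)) /=.
rewrite ler_wpDr ?sumr_ge0 //; first by move=> e _; exact: sqr_ge0.
by apply: ler_sum => e _; rewrite !exprMn real_normK ?num_real.
Qed.

End Algorithm.
End TensorError.

(** * Error on algebraic tensors and on their completion *)

Section TensorLimit.
Context {R : realType} {d : nat}.
Local Open Scope complex_scope.
Local Notation normc := ComplexField.Normc.normc.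
Variables (alpha : R) (gamma : 'I_d -> R).
Hypothesis ha : 2^-1 < alpha < 2.
Local Notation tensor := (seq (R * ('I_d -> R -> R))).

Definition cos_energy P N (w : 'I_P -> R) (a : 'I_d -> 'I_P -> nat -> R) : R :=
  \sum_p \sum_q w p * w q * \prod_(j < d) (\sum_(k < N.+1)
    r_wt alpha (Gamma_wt alpha gamma j) k ^+ 2 * (a j p k * a j q k)).

Lemma cos_energy_ge0 P N (w : 'I_P -> R) a : 0 <= cos_energy N w a.
Proof.
rewrite /cos_energy (box_energy N w a (fun j k => r_wt alpha (Gamma_wt alpha gamma j) k)).
by apply: sumr_ge0 => e _; exact: sqr_ge0.
Qed.

Lemma cvg_bigsum (I : Type) (s : seq I) (F : I -> nat -> R) (l : I -> R) :
  (forall i, F i m @[m --> \oo] --> l i) -> \sum_(i <- s) F i m @[m --> \oo] --> \sum_(i <- s) l i.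
Proof. by move=> H; apply: cvg_big => //; exact: add_continuous. Qed.

Lemma cvg_bigprod (I : Type) (s : seq I) (F : I -> nat -> R) (l : I -> R) :
  (forall i, F i m @[m --> \oo] --> l i) -> \prod_(i <- s) F i m @[m --> \oo] --> \prod_(i <- s) l i.
Proof. by move=> H; apply: cvg_big => //; exact: mul_continuous. Qed.

(** Completing each coordinate factor by its defect gives [K], which converges factor by factor to
    the tensor inner product; [schur_prod_sub] shows that this only increases the energy. *)
Lemma tensor_approx (S : tensor) : tensor_space alpha gamma S ->
  exists (N : nat -> nat) (w : 'I_(size S) -> R) (a : nat -> 'I_d -> 'I_(size S) -> nat -> R) (K : nat -> R),
  [/\ forall y, unit_cube R d y -> cos_tensor (N m) w (a m) y @[m --> \oo] --> tensor_fun S y,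
      forall m, cos_energy (N m) w (a m) <= K m &
      K m @[m --> \oo] --> tensor_ip alpha gamma S S].
Proof.
move=> hS; pose t := in_tuple S; pose w p := (tnth t p).1; pose u p := (tnth t p).2.
have [N [a [E [sE cA cK]]]] := @family_approx R d alpha gamma _ u ha (fun p j => hS _ (mem_tnth p t) j).
pose D m j p q := \sum_(k < (N m).+1) r_wt alpha (Gamma_wt alpha gamma j) k ^+ 2 * (a m j p k * a m j q k).
exists N, w, a, (fun m => \sum_p \sum_q w p * w q * \prod_(j < d) (D m j p q + E m j p q)).
split=> [y yc|m|].
- rewrite /tensor_fun big_tnth; apply: cvg_bigsum => p; apply: cvgMl_tmp; apply: cvg_bigprod => j.
  exact: cA (yc j).
- rewrite -subr_ge0 /cos_energy -sumrB; under eq_bigr do rewrite -sumrB.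
  under eq_bigr do under eq_bigr do rewrite -mulrBr.
  apply: (schur_psd (schur_prod_sub (D := D m) _ (sE m))) => j.
  apply: schur_sum => k; apply: schur_scale; first exact: sqr_ge0.
  exact: schur_rank1.
rewrite /tensor_ip big_tnth; under [X in _ --> X]eq_bigr do rewrite big_tnth.
apply: cvg_bigsum => p; apply: cvg_bigsum => q; apply: cvgMl_tmp; apply: cvg_bigprod => j.
exact: cK.
Qed.

(** Inherited in the limit from the energies of cosine tensors, which are sums of squares. *)
Lemma tensor_ip_ge0 (S : tensor) : tensor_space alpha gamma S -> 0 <= tensor_ip alpha gamma S S.
Proof.
move=> /tensor_approx[N [w [a [K [_ hK cK]]]]].
apply: (cvgr_to_ge cK); apply: nearW => m; apply: le_trans (hK m); exact: cos_energy_ge0.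
Qed.

Lemma tensor_ipC (S S' : tensor) : tensor_space alpha gamma S -> tensor_space alpha gamma S' ->
  tensor_ip alpha gamma S S' = tensor_ip alpha gamma S' S.
Proof.
move=> hS hS'; rewrite /tensor_ip exchange_big /=.
apply: eq_big_seq => q qS; apply: eq_big_seq => p pS; rewrite [p.1 * q.1]mulrC.
have E j : sob_ip1 alpha (gamma j) (p.2 j) (q.2 j) = sob_ip1 alpha (gamma j) (q.2 j) (p.2 j).
  exact: sob_ip1C ha (hS p pS j) (hS' q qS j).
exact: (f_equal (fun F : 'I_d -> R => q.1 * p.1 * \prod_(j < d) F j) (funext E)).
Qed.

Let scale (c : R) (S : tensor) : tensor := [seq (c * p.1, p.2) | p <- S].

Let scale_space c S : tensor_space alpha gamma S -> tensor_space alpha gamma (scale c S).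
Proof. by move=> hS p /mapP[q qS ->] j; exact: (hS q qS j). Qed.

Let cat_space S S' : tensor_space alpha gamma S -> tensor_space alpha gamma S' ->
  tensor_space alpha gamma (S ++ S').
Proof. by move=> hS hS' p; rewrite mem_cat => /orP[/hS|/hS']. Qed.

Let ip_scale a b S S' : tensor_ip alpha gamma (scale a S) (scale b S') = a * b * tensor_ip alpha gamma S S'.
Proof.
rewrite /tensor_ip big_map mulr_sumr; apply: eq_bigr => p _; rewrite big_map mulr_sumr.
by apply: eq_bigr => q _ /=; ring.
Qed.

Let ip_catl S1 S2 S : tensor_ip alpha gamma (S1 ++ S2) S = tensor_ip alpha gamma S1 S + tensor_ip alpha gamma S2 S.
Proof. by rewrite /tensor_ip big_cat. Qed.

Let ip_catr S1 S2 S : tensor_ip alpha gamma S (S1 ++ S2) = tensor_ip alpha gamma S S1 + tensor_ip alpha gamma S S2.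
Proof. by rewrite /tensor_ip -big_split; apply: eq_bigr => p _; rewrite big_cat. Qed.

(** Concatenating rescaled lists realizes the linear combination of three formal tensors. *)
Lemma tensor_ip3 (S1 S2 S3 : tensor) (a b c : R) : tensor_space alpha gamma S1 ->
  tensor_space alpha gamma S2 -> tensor_space alpha gamma S3 ->
  0 <= a ^+ 2 * tensor_ip alpha gamma S1 S1 + b ^+ 2 * tensor_ip alpha gamma S2 S2 +
       c ^+ 2 * tensor_ip alpha gamma S3 S3 +
       2 * (a * b * tensor_ip alpha gamma S1 S2 + a * c * tensor_ip alpha gamma S1 S3 +
            b * c * tensor_ip alpha gamma S2 S3).
Proof.
move=> h1 h2 h3.
have := tensor_ip_ge0 (cat_space (@scale_space a _ h1) (cat_space (@scale_space b _ h2) (@scale_space c _ h3))).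
rewrite !ip_catl !ip_catr !ip_scale (tensor_ipC h2 h1) (tensor_ipC h3 h1) (tensor_ipC h3 h2).
move: (tensor_ip _ _ S1 S1) (tensor_ip _ _ S2 S2) (tensor_ip _ _ S3 S3).
move: (tensor_ip _ _ S1 S2) (tensor_ip _ _ S1 S3) (tensor_ip _ _ S2 S3) => x1 x2 x3 x4 x5 x6.
by move=> H; apply: le_trans H _; rewrite le_eqVlt; apply/orP; left; apply/eqP; ring.
Qed.

Variables (n L : nat) (A : set 'rV[int]_d) (z : 'I_L -> 'rV['I_n]_d) (tail : R).
Hypotheses (n0 : (0 < n)%N) (finA : finite_set A) (covA : covers A z).
Hypothesis r0 : forall h, 0 < r_wt_vec alpha (Gamma_wt alpha gamma) (@abs_vec d h).
Hypothesis tail_le : forall X, uniq X -> (forall h, h \in X -> ~ A h) ->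
  \sum_(h <- X) (r_wt_vec alpha (Gamma_wt alpha gamma) (abs_vec h) ^+ 2)^-1 <= tail.

Lemma tensor_error (S : tensor) x : tensor_space alpha gamma S -> unit_cube R d x ->
  normc ((tensor_fun S x)%:C - A_mult A z (tensor_fun S) x) <=
  (1 + L%:R) * (Num.sqrt tail * Num.sqrt (tensor_ip alpha gamma S S)).
Proof.
move=> hS xc; have [N [w [a [K [cS hK cK]]]]] := tensor_approx hS.
have lim1 := error_cvg (z := z) finA xc cS.
have lim2 : (1 + L%:R) * (Num.sqrt tail * Num.sqrt (K m)) @[m --> \oo] -->
    (1 + L%:R) * (Num.sqrt tail * Num.sqrt (tensor_ip alpha gamma S S)).
  by apply: cvgMl_tmp; apply: cvgMl_tmp; exact: (continuous_cvg _ (@sqrt_continuous R _) cK).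
apply: (ler_cvg_to lim1 lim2); apply: nearW => m.
apply: le_trans (cos_tensor_error n0 finA covA r0 tail_le _ _ _ xc) _.
by rewrite ler_wpM2l ?addr_ge0 // ler_wpM2l ?sqrtr_ge0 // ler_wsqrtr // hK.
Qed.

(** A second passage to the limit: the error converges through point values, the norm by
    [ip_cauchy_cvg], and the constant is the same along the sequence. *)
Lemma sob_error (f : 'rV[R]_d -> R) x : sob_space alpha gamma f -> unit_cube R d x ->
  normc ((f x)%:C - A_mult A z f x) <=
  (1 + L%:R) * (Num.sqrt tail * sob_norm alpha gamma f).
Proof.
move=> hf xc; pose u := repr_seq (tensor_space alpha gamma) (tensor_ip alpha gamma)
  (unit_cube R d) tensor_fun [::] f.
have [hu cu uu] : represents (tensor_space alpha gamma) (tensor_ip alpha gamma)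
  (unit_cube R d) tensor_fun u f by exact: (xgetPex _ hf).
have cip := ip_cauchy_cvg tensor_ipC (fun x y z a b c hx hy hz => tensor_ip3 a b c hx hy hz) hu hu cu cu.
have cS y : unit_cube R d y -> tensor_fun (u m) y @[m --> \oo] --> f y.
  by move=> yc; exact: (uniform_cvg_point uu yc).
have lim1 := error_cvg (z := z) finA xc cS.
have lim2 : (1 + L%:R) * (Num.sqrt tail * Num.sqrt (tensor_ip alpha gamma (u m) (u m))) @[m --> \oo] -->
    (1 + L%:R) * (Num.sqrt tail * sob_norm alpha gamma f).
  by apply: cvgMl_tmp; apply: cvgMl_tmp; exact: (continuous_cvg _ (@sqrt_continuous R _) cip).
by apply: (ler_cvg_to lim1 lim2); apply: nearW => m; exact: tensor_error.
Qed.

End TensorLimit.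

(** * Extent of the hyperbolic cross in terms of its cardinality *)

Section IndexSetSize.
Context {R : realType} {d : nat}.
Variables (alpha M : R) (g : 'I_d -> R).
Hypotheses (alpha0 : 0 < alpha) (g0 : forall j, 0 < g j).
Let A := Asym alpha g M.

(** [fset_set] is empty by default on an infinite set, so a positive [cardA] certifies
    finiteness. *)
Lemma cardA_finite (B : set 'rV[int]_d) : (0 < cardA B)%N -> finite_set B.
Proof. by rewrite /cardA /fset_set; case: pselect. Qed.

Lemma r_wt_le a c (i k : nat) : 0 < a -> 0 < c -> (0 < i)%N -> (i <= k)%N -> r_wt a c i <= r_wt a c k :> R.
Proof.
move=> a0 c0 i0 ik; rewrite /r_wt !gtn_eqF ?(leq_trans i0) // ler_wpM2l ?invr_ge0 ?(ltW c0) //.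
by apply: ge0_ler_powR; rewrite ?nnegrE ?ler_nat // ltW.
Qed.

(** Replacing coordinate [j] by [1, ..., |k j|] stays inside the cross and yields that many distinct
    elements. The value 0 is left out because [r_wt] may be larger at 0 than at 1. *)
Lemma Asym_coord_le (k : 'rV[int]_d) j : finite_set A -> A k -> (`|k ord0 j| <= cardA A)%N.
Proof.
move=> finA Ak; pose v := `|k ord0 j|%N.
pose w (i : nat) : 'rV[int]_d := \row_l (if l == j then i%:Z else k ord0 l).
have winj : injective w.
  by move=> i i' /rowP/(_ j); rewrite !mxE eqxx => -[].
have uw : uniq [seq w i | i <- iota 1 v] by rewrite (map_inj_uniq winj) iota_uniq.
have sub : all (fun y => y \in fset_set A) [seq w i | i <- iota 1 v].
  rewrite all_map; apply/allP => i; rewrite mem_iota add1n ltnS => /andP[i0 iv] /=.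
  rewrite in_fset_set // inE; apply: le_trans Ak; rewrite /r_wt_vec; apply: ler_prod => l _.
  rewrite ltW ?r_wt_gt0 //= !mxE; case: eqP => // ->.
  by rewrite r_wt_le.
by have := uniq_leq_size uw (allP sub); rewrite size_map size_iota.
Qed.

Lemma spread_le : finite_set A -> spread A <= (cardA A).*2%:Z.
Proof.
move=> finA; have H k j : k \in fset_set A -> (`|k ord0 j| <= cardA A)%N.
  by rewrite in_fset_set // inE => Ak; exact: Asym_coord_le.
apply: bigmax_le => // j _; rewrite -addnn PoszD -[X in _ <= _ + X]opprK; apply: lerB.
  rewrite big_seq; apply: bigmax_le => // k kA; have := H k j kA; lia.
rewrite big_seq; apply: le_bigmin => [|k kA]; first by rewrite oppr_le0.
by have := H k j kA; lia.
Qed.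

End IndexSetSize.

(** * Bounds for the number of lattices and for the prime *)

Section Sizes.
Context {R : realType}.

Lemma ln_le_powR (x e : R) : 0 < e -> 0 < x -> ln x <= e^-1 * x `^ e.
Proof.
move=> e0 x0; rewrite -(ler_pM2l e0) mulVKf ?gt_eqF // -ln_powR.
by apply/ltW/ln_sublinear; rewrite powR_gt0.
Qed.

Lemma num_lattices_le d (A : set 'rV[int]_d) (c delta e : R) (L : nat) :
  1 < c -> 0 < delta < 1 -> (2 <= cardA A)%N -> 0 < e -> L%:Z = num_lattices A c delta ->
  (0 < L)%N /\ L%:R <= ((c / (c - 1)) ^+ 2 * (e^-1 - ln delta) / 2 + 1) * (cardA A)%:R `^ e.
Proof.
move=> c1 /andP[d0 d1] a2 e0 hL.
set a : R := (cardA A)%:R; have a1 : 1 < a by rewrite ltr1n.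
have ld : ln delta < 0 by rewrite ln_lt0 // d0.
have la : 0 < ln a by rewrite ln_gt0.
have cc : c <= c_adj A c by rewrite /c_adj le_max lexx.
set q := c_adj A c / (c_adj A c - 1).
have q1 : 0 < c - 1 by rewrite subr_gt0.
have q2 : 0 < c_adj A c - 1 by rewrite subr_gt0 (lt_le_trans c1).
have q0 : 0 < q by rewrite divr_gt0 // (lt_trans _ (lt_le_trans c1 cc)).
(* The function [x / (x - 1)] decreases on [x > 1], and [c_adj >= c]. *)
have qc : q <= c / (c - 1).
  by rewrite ler_pdivrMr // mulrAC ler_pdivlMr // !mulrBr !mulr1; lra.
have X0 : 0 < q ^+ 2 * ((ln a - ln delta) / 2).
  by rewrite mulr_gt0 ?exprn_gt0 // divr_gt0 // subr_gt0 (lt_trans ld).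
have hc : L%:R - 1 < q ^+ 2 * ((ln a - ln delta) / 2).
  by have := ceilB1_lt (q ^+ 2 * ((ln a - ln delta) / 2)); rewrite -[Num.ceil _]hL intrD.
split.
  by rewrite -(ltr0n R) (lt_le_trans X0) // -[L%:R]/((L%:Z)%:~R) hL; exact: ceil_ge.
have ae : 1 <= a `^ e by rewrite -[leLHS](powRr0 a) ler_powR // ltW.
have laa := ln_le_powR e0 (lt_trans ltr01 a1).
have q22 : q ^+ 2 <= (c / (c - 1)) ^+ 2 by rewrite ler_sqr ?nnegrE ?(ltW q0) // (le_trans (ltW q0)).
have b1 : ln a - ln delta <= (e^-1 - ln delta) * a `^ e.
  have : - ln delta * 1 <= - ln delta * a `^ e by rewrite ler_wpM2l // oppr_ge0 ltW.
  by rewrite mulrDl; lra.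
have b2 : q ^+ 2 * (ln a - ln delta) <= (c / (c - 1)) ^+ 2 * ((e^-1 - ln delta) * a `^ e).
  by rewrite ler_pM // ?sqr_ge0 // subr_ge0 ltW // (lt_trans ld).
move: hc b2 ae; move: ((c / (c - 1)) ^+ 2) (e^-1) (a `^ e) (q ^+ 2) (ln a) (ln delta) => x1 x2 x3 x4 x5 x6.
lra.
Qed.

(** The bound [16 m l] of [prime_gap] with [m <= (c + 5) a] and [l <= 1 + log_2 m], where [a] is the
    cardinality and the logarithm is bounded by a multiple of [a ^ e]. *)
Definition lattice_size_const (c e : R) : R :=
  16 * (c + 5) * (1 + (ln 2)^-1 * (e^-1 * (c + 5) `^ e)).

Lemma smallest_prime_le d (A : set 'rV[int]_d) (c e : R) (n : nat) :
  1 < c -> (2 <= cardA A)%N -> spread A <= (cardA A).*2%:Z -> 0 < e ->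
  smallest_prime_above (tau A c) n ->
  n%:R <= lattice_size_const c e * ((cardA A)%:R * (cardA A)%:R `^ e).
Proof.
move=> c1 a2 sA e0 [pn tn nmin].
set a : R := (cardA A)%:R; have a2R : 2 <= a by rewrite ler_nat.
(* As [a >= 2], the quotient of the spread by [a - 1] is at most [2 a / (a - 1) <= 4]. *)
have cadj : c_adj A c <= c + 4.
  rewrite /c_adj ge_max; apply/andP; split; first lra.
  rewrite ler_pdivrMr; last by rewrite subr_gt0 ltr1n.
  apply: (@le_trans _ _ (a * 2)).
    by have := sA; rewrite -(ler_int R) => /le_trans; apply; rewrite -pmulrn -muln2 natrM.
  by rewrite -/a; nra.
have t_le : tau A c <= (c + 4) * a by rewrite /tau -/a; have := c1; move: cadj; nra.
have t0 : 0 <= tau A c.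
  by rewrite mulr_ge0 ?subr_ge0 ?ler1n ?(leq_trans _ a2) // /c_adj le_max (le_trans ler01) // ltW.
(* An integer above [tau]; the added 1 is at most [a], which turns [c + 4] into [c + 5]. *)
pose m := (Num.trunc (tau A c)).+1; pose l := (trunc_log 2 m).+1.
have /andP[lm ml] := trunc_log_bounds (isT : (1 < 2)%N) (isT : (0 < m)%N).
have [p [pp mp ple]] := prime_gap (isT : (0 < m)%N) ml.
have np : (n <= p)%N by apply: nmin => //; apply: (lt_trans (truncnS_gt _)); rewrite ltr_nat.
have mR : m%:R <= (c + 5) * a.
  have := truncn_itv t0 => /andP[h _].
  rewrite /m -natr1; move: h t_le a2R; move: (tau A c) (_%:R) a => t T a' h1 h2 h3.
  have -> : (c + 5) * a' = (c + 4) * a' + a' by ring.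
  by lra.
have ln20 : 0 < ln (2 : R) by rewrite ln_gt0 // ltr1n.
have c5 : 0 < c + 5 by lra.
have a0 : 0 < a by lra.
have ae : 1 <= a `^ e by rewrite -[leLHS](powRr0 a) ler_powR // ?(ltW e0) //; lra.
have lR : l%:R <= (1 + (ln 2)^-1 * (e^-1 * (c + 5) `^ e)) * a `^ e.
  have h1 : (trunc_log 2 m)%:R * ln 2 <= e^-1 * ((c + 5) `^ e * a `^ e).
    rewrite -powRM ?(ltW c5) ?(ltW a0) //; apply: le_trans _ (ln_le_powR e0 _); last by rewrite mulr_gt0.
    rewrite -ln_powR powR_mulrn // ler_ln ?posrE ?exprn_gt0 ?mulr_gt0 //.
    by apply: le_trans mR; rewrite -natrX ler_nat.
  rewrite /l -[leLHS]natr1 mulrDl mul1r addrC; apply: lerD => //.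
  by rewrite -[leRHS]mulrA [leRHS]mulrC ler_pdivlMr // -[leRHS]mulrA.
apply: (@le_trans _ _ (16 * m * l)%N%:R); first by rewrite ler_nat (leq_trans np).
rewrite !natrM /lattice_size_const.
rewrite [leRHS](_ : _ = 16 * ((c + 5) * a) * ((1 + (ln 2)^-1 * (e^-1 * (c + 5) `^ e)) * a `^ e)); last first.
  by move: (1 + _) => x; rewrite -!mulrA; congr (_ * (_ * _)); rewrite mulrCA.
by rewrite ler_pM // ?mulr_ge0 // ler_wpM2l.
Qed.

End Sizes.

(** * From cardinalities to the number of function evaluations *)

Section ErrorBound.
Context {R : realType}.

(** The product [n L] costs [a ^ (1 + 2 eps)], raised to the power [e], and the factor [1 + L] costs
    another [a ^ eps]. *)
Lemma size_absorb (a L n C1 C2 e eps s : R) : 1 <= a -> 1 <= L -> 0 < n -> 0 < C1 -> 0 < C2 ->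
  0 < e -> L <= C1 * a `^ eps -> n <= C2 * (a * a `^ eps) -> eps + (1 + 2 * eps) * e = s ->
  (1 + L) * (n * L) `^ e <= 2 * C1 * (C1 * C2) `^ e * a `^ s.
Proof.
move=> a1 L1 n0 C10 C20 e0 hL hn <-.
have a0 : 0 < a by lra. have L0 : 0 < L by lra.
have h1 : 1 + L <= 2 * (C1 * a `^ eps) by lra.
have h2 : n * L <= C1 * C2 * a `^ (1 + 2 * eps).
  rewrite (_ : C1 * C2 * _ = C2 * (a * a `^ eps) * (C1 * a `^ eps)).
    by rewrite ler_pM // ltW.
  rewrite (_ : 1 + 2 * eps = 1 + eps + eps); last by ring.
  by rewrite !powRD ?(gt_eqF a0) ?implybT // powRr1 ?(ltW a0) //; ring.
have h3 : (n * L) `^ e <= (C1 * C2) `^ e * a `^ ((1 + 2 * eps) * e).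
  rewrite powRrM -powRM ?powR_ge0 ?(ltW (mulr_gt0 C10 C20)) //.
  by apply: ge0_ler_powR; rewrite ?nnegrE ?mulr_ge0 ?powR_ge0 ?(ltW e0) ?(ltW n0) ?(ltW L0) ?(ltW C10) ?(ltW C20).
rewrite powRD ?(gt_eqF a0) ?implybT //.
apply: le_trans (ler_pM _ _ h1 h3) _; rewrite ?powR_ge0 //; first lra.
by rewrite le_eqVlt; apply/orP; left; apply/eqP; ring.
Qed.

Lemma asym_tail_le d (alpha lambda M : R) (g : 'I_d -> R) (X : seq 'rV[int]_d) :
  let A := Asym alpha g M in
  2^-1 < lambda -> lambda < alpha -> (forall j, 0 < g j) -> (0 < cardA A)%N -> uniq X ->
  (forall h, h \in X -> ~ A h) ->
  \sum_(h <- X) (r_wt_vec alpha g (abs_vec h) ^+ 2)^-1 <=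
  (\prod_(j < d) (1 + 2 * g j `^ lambda^-1 * zeta (alpha / lambda))) `^ (2 * lambda) *
  ((cardA A)%:R `^ (1 - 2 * lambda) / (2 * lambda - 1)).
Proof.
move=> A hl la g0 A0 uX XA.
have finA := cardA_finite A0.
have l0 : 0 < lambda by rewrite (lt_trans _ hl).
apply: (tail_energy_le (A := fset_set A) hl A0).
- by move=> h; apply: prodr_gt0 => j _; exact: r_wt_gt0.
- by move=> Y uY; exact: cross_sum_le.
- rewrite cat_uniq fset_uniq uX andbT; apply/hasPn => h /XA hA.
  by rewrite in_fset_set // notin_setE.
move=> h h'; rewrite in_fset_set // inE => Ah /XA/negP; rewrite -ltNge => /ltW; exact: le_trans.
Qed.

Lemma sqrt_tail (V a lambda : R) : 0 <= V -> 0 < a -> 2^-1 < lambda ->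
  Num.sqrt (V `^ (2 * lambda) * (a `^ (1 - 2 * lambda) / (2 * lambda - 1))) =
  V `^ lambda * (a `^ (2^-1 - lambda) / Num.sqrt (2 * lambda - 1)).
Proof.
move=> V0 a0 hl; rewrite !sqrtrM ?powR_ge0 // sqrtrV; last by lra.
rewrite -!powR12_sqrt ?powR_ge0 //; last by lra.
by rewrite -!powRrM; congr (_ `^ _ * (_ `^ _ * _)); lra.
Qed.

End ErrorBound.

Theorem theorem5p4 (R : realType) (c delta beta lambda : R)
    (hc : 1 < c) (hdelta : 0 < delta < 1) (hlambda : 2^-1 < lambda)
    (hbeta : 0 < beta < Num.min 1 (2 * lambda - 1)) :
  exists2 C : R, 0 < C &
    forall alpha : R, 2^-1 < alpha < 2 -> lambda < alpha ->
    forall d : nat, (0 < d)%N ->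
    forall gamma : 'I_d -> R, (forall j, 0 < gamma j) ->
    forall M : R, 1 <= M ->
    let A := Asym alpha (Gamma_wt alpha gamma) M in
    (2 <= cardA A)%N ->
    forall L n : nat,
    L%:Z = num_lattices A c delta ->
    smallest_prime_above (tau A c) n ->
    forall z : 'I_L -> 'rV['I_n]_d, covers A z ->
    (wor_error alpha gamma (A_mult A z) <=
       (C * (V_const alpha lambda gamma `^ lambda /
             (n * L)%:R `^ (lambda / (1 + beta) - 2^-1)))%:E)%E.
Proof.
have [b0 bmin] := andP hbeta; have [d0 d1] := andP hdelta.
move: bmin; rewrite lt_min => /andP[b1 b2].
set e := lambda / (1 + beta) - 2^-1.
(* Equivalent to [beta < 2 lambda - 1]. *)
have e0 : 0 < e by rewrite /e subr_gt0 ltr_pdivlMr; lra.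
have el : e < lambda - 2^-1.
  by rewrite ltrD2r ltr_pdivrMr ?ltr_pMr; lra.
(* The solution of [eps + (1 + 2 eps) e = lambda - 1/2]; it is positive because [beta > 0], and it
   is the exponent granted to each logarithm. *)
pose eps := (lambda - 2^-1 - e) / (1 + 2 * e).
have eps0 : 0 < eps by rewrite divr_gt0; lra.
have epsE : eps + (1 + 2 * eps) * e = lambda - 2^-1.
  have -> : eps + (1 + 2 * eps) * e = eps * (1 + 2 * e) + e by ring.
  by rewrite /eps divfK ?subrK // gt_eqF //; lra.
pose C1 := (c / (c - 1)) ^+ 2 * (eps^-1 - ln delta) / 2 + 1.
pose C2 := lattice_size_const c eps.
have ld : ln delta < 0 by rewrite ln_lt0 // d0.
have C10 : 0 < C1.
  have : 0 <= (c / (c - 1)) ^+ 2 * (eps^-1 - ln delta) / 2.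
    by rewrite divr_ge0 // mulr_ge0 ?sqr_ge0 // subr_ge0 (le_trans (ltW ld)) // invr_ge0 ltW.
  by rewrite /C1; lra.
have C20 : 0 < C2.
  rewrite /C2 /lattice_size_const mulr_gt0 //; first lra.
  rewrite ltr_wpDr // mulr_ge0 ?mulr_ge0 ?powR_ge0 ?invr_ge0 ?(ltW eps0) //.
  by rewrite ln_ge0 // ler1n.
have s0 : 0 < Num.sqrt (2 * lambda - 1) by rewrite sqrtr_gt0; lra.
(* The numerator comes from [size_absorb], the denominator from the tail sum. *)
exists (2 * C1 * (C1 * C2) `^ e / Num.sqrt (2 * lambda - 1)).
  by apply: divr_gt0 s0; apply: mulr_gt0; [exact: mulr_gt0 | exact/powR_gt0/mulr_gt0].
move=> alpha ha la d dpos gamma g0 M M1 A A2 L n hL hn z covz.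
have G0 j : 0 < Gamma_wt alpha gamma j by exact: Gamma_wt_gt0.
have alpha0 : 0 < alpha by move: ha => /andP[+ _]; apply: lt_trans.
have A0 : (0 < cardA A)%N by exact: leq_trans A2.
have finA := cardA_finite A0.
have n0 : (0 < n)%N by case: hn => /prime_gt0.
have [L0 LC] := num_lattices_le hc hdelta A2 eps0 hL.
have nC := smallest_prime_le hc A2 (spread_le alpha0 G0 finA) eps0 hn.
have r0 h : 0 < r_wt_vec alpha (Gamma_wt alpha gamma) (@abs_vec d h).
  by apply: prodr_gt0 => j _; exact: r_wt_gt0.
set V := V_const alpha lambda gamma.
have tl X := @asym_tail_le R d alpha lambda M _ X hlambda la G0 A0.
set a : R := (cardA A)%:R in LC nC tl.
have a1 : 1 <= a by rewrite ler1n.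
have V0 : 0 <= V.
  apply: prodr_ge0 => j _; rewrite addr_ge0 // mulr_ge0 ?mulr_ge0 ?powR_ge0 //.
  have := @zeta_partial_le R (alpha / lambda) 0; rewrite big_ord0; apply.
  by rewrite ltr_pdivlMr ?mul1r; lra.
apply: ub_ereal_sup => _ [f [hf nf] <-]; apply: ub_ereal_sup => _ [x xc <-]; rewrite lee_fin.
apply: le_trans (sob_error ha n0 finA covz r0 tl hf xc) _.
rewrite -[\prod_(j < d) _]/V sqrt_tail //; last by rewrite (lt_le_trans ltr01).
apply: (@le_trans _ _ ((1 + L%:R) * (V `^ lambda * (a `^ (2^-1 - lambda) / Num.sqrt (2 * lambda - 1))))).
  rewrite ler_wpM2l ?addr_ge0 // -[leRHS]mulr1 ler_wpM2l //.
  by rewrite mulr_ge0 ?powR_ge0 // divr_ge0 ?powR_ge0 // ltW.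
have nL0 : 0 < (n * L)%:R `^ e :> R by rewrite powR_gt0 // ltr0n muln_gt0 n0.
(* The resulting [a ^ (lambda - 1/2)] cancels the factor [a ^ (1/2 - lambda)] of the tail
   exactly. *)
have := @size_absorb R a L%:R n%:R C1 C2 e eps _ a1 _ _ C10 C20 e0 LC nC epsE.
rewrite ler1n ltr0n -natrM => /(_ L0 n0) H.
rewrite mulrA mulrA [X in _ <= X]mulrA ler_pdivlMr //.
rewrite mulrAC [leRHS]mulrAC ler_pM2r ?invr_gt0 //.
have a0 : 0 < a by exact: lt_le_trans a1.
have : (1 + L%:R) * (n * L)%:R `^ e * (V `^ lambda * a `^ (2^-1 - lambda)) <=
       2 * C1 * (C1 * C2) `^ e * a `^ (lambda - 2^-1) * (V `^ lambda * a `^ (2^-1 - lambda)).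
  by rewrite ler_wpM2r ?mulr_ge0 ?powR_ge0.
have -> : 2 * C1 * (C1 * C2) `^ e * a `^ (lambda - 2^-1) * (V `^ lambda * a `^ (2^-1 - lambda)) =
  2 * C1 * (C1 * C2) `^ e * V `^ lambda * (a `^ (lambda - 2^-1) * a `^ (2^-1 - lambda)) by ring.
rewrite -powRD ?(gt_eqF a0) ?implybT // (_ : lambda - 2^-1 + _ = 0) ?powRr0 ?mulr1; last by ring.
by apply: le_trans; rewrite le_eqVlt; apply/orP; left; apply/eqP; ring.
Qed.
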